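(* Let $\mathbb{F}$ be any field of characteristic $p>2$ (not necessarily perfect), let $L=L_0\oplus L_1$ be a restricted Lie superalgebra over $\mathbb{F}$ with bracket $(\,,\,)$, and let $u(L)$ be its restricted enveloping algebra. Let $M$ be the $\mathbb{F}$-subspace of $L_1$ spanned by all $y\in L_1$ such that $(y,y)$ is $p$-nilpotent. Suppose that $u(L)$ satisfies a polynomial identity, $(L_0,L_0)$ is $p$-nilpotent, $\dim L_1/M\leq 1$, $(M,L_1)$ is $p$-nilpotent, and $(L_1,L_0)\subseteq M$. Then the commutator ideal of $u(L)$ is nil of bounded index.
   Context: Let $\mathbb{F}$ be a field of characteristic $p>2$. Lie superalgebra: a $\mathbb{Z}_2$-graded vector space $L=L_0\oplus L_1$ with a bilinear bracket $(\,,\,)$ satisfying $(L_i,L_j)\subseteq L_{i+j}$, $(x,y)=-(-1)^{ij}(y,x)$ and $(x,(y,z))=((x,y),z)+(-1)^{ij}(y,(x,z))$ for $x\in L_i$, $y\in L_j$, $z\in L$; if $p=3$ one also requires $((y,y),y)=0$ for all $y\in L_1$. Write $\mathrm{ad}\,x(y)=(y,x)$. Restricted: $L$ is restricted if there is a $p$-th power map $x\mapsto x^{[p]}$, $L_0\to L_0$, with (a) $(\alpha x)^{[p]}=\alpha^p x^{[p]}$ for $\alpha\in\mathbb{F}$, $x\in L_0$; (b) $(y,x^{[p]})=(\mathrm{ad}\,x)^p(y)$ for $x\in L_0$, $y\in L$; (c) $(x+y)^{[p]}=x^{[p]}+y^{[p]}+\sum_{i=1}^{p-1}s_i(x,y)$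 for $x,y\in L_0$, where $i s_i(x,y)$ is the coefficient of $\lambda^{i-1}$ in $(\mathrm{ad}(\lambda x+y))^{p-1}(x)$. Restricted enveloping algebra: $u(L)$ is the unital associative $\mathbb{F}$-algebra generated by $L$ subject to $xy-(-1)^{ij}yx=(x,y)$ for $x\in L_i$, $y\in L_j$, and $x^p=x^{[p]}$ for $x\in L_0$. $L$ embeds in $u(L)$, and $x^{[p]}$ is identified with $x^p$. For subspaces $B,C\subseteq L$, $(B,C)$ is the subspace spanned by all $(b,c)$ with $b\in B$, $c\in C$. An element $x\in L_0$ is $p$-nilpotent if $x^{p^t}=0$ for some $t\ge 0$. A subset $X\subseteq L_0$ is $p$-nilpotent if there is an integer $s$ with $x^{p^s}=0$ for every $x\in X$. The commutator ideal of an associative algebra $R$ is the two-sided ideal generated by all $[a,b]=ab-ba$, $a,b\in R$. An ideal $I$ is nil of bounded index if there is $n$ with $a^n=0$ for all $a\in I$. *)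

(* Defs.v *)
From HB Require Import structures.
From mathcomp Require Import all_boot all_order all_algebra finmap.
From mathcomp Require Import boolp classical_sets.

Set Implicit Arguments.
Unset Strict Implicit.
Unset Printing Implicit Defensive.

Import GRing.Theory.
Local Open Scope classical_set_scope.
Local Open Scope ring_scope.
Local Open Scope quotient_scope.

(* Vector spaces may be infinite-dimensional, so that subspaces are           *)
(* Prop-valued sets instead of {vspace V}.                                    *)
Section Subspaces.
Variables (F : fieldType) (V : lmodType F).

Definition subspace (W : set V) : Prop :=
  W 0 /\ forall (a : F) (x y : V), W x -> W y -> W (a *: x + y).

Definition lspan (A : set V) : set V := smallest subspace A.

(* For subspaces W `<=` U: dim (U / W) <= n, that is, the classes modulo W of *)
(* some n vectors of U span U / W.                                            *)
Definition quot_dim_le (n : nat) (U W : set V) : Prop :=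
  exists e : 'I_n -> V, (forall i, U (e i)) /\
    forall u, U u -> exists c : 'I_n -> F, W (u - \sum_(i < n) c i *: e i).

End Subspaces.

(* The degree in Z_2 is a boolean (false = 0, true = 1), so that i + j is     *)
(* i (+) j and (-1)^(ij) is (-1) ^+ (i && j).                                 *)
Record lieSuperalgebra (F : fieldType) := LieSuperalgebra {
  lsa_space :> lmodType F;
  part : bool -> set lsa_space;
  br : lsa_space -> lsa_space -> lsa_space;
  part_subspace : forall i, subspace (part i);
  part_sum : forall x, exists x0 x1,
    [/\ part false x0, part true x1 & x = x0 + x1];
  part_cap : forall x, part false x -> part true x -> x = 0;
  br_linearl : forall (a : F) x y z, br (a *: x + y) z = a *: br x z + br y z;
  br_linearr : forall (a : F) x y z, br z (a *: x + y) = a *: br z x + br z y;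
  br_part : forall i j x y, part i x -> part j y -> part (i (+) j) (br x y);
  br_anticomm : forall i j x y, part i x -> part j y ->
    br x y = - ((-1) ^+ (i && j) *: br y x);
  br_jacobi : forall i j x y z, part i x -> part j y ->
    br x (br y z) = br (br x y) z + (-1) ^+ (i && j) *: br y (br x z);
  br_char3 : 3%N \in [pchar F] -> forall y, part true y -> br (br y y) y = 0
}.

Definition ad (F : fieldType) (L : lieSuperalgebra F) (x y : L) : L := br y x.

(* (B, C) for subspaces B and C of L *)
Definition brspace (F : fieldType) (L : lieSuperalgebra F) (B C : set L) :
    set L :=
  lspan [set br b c | b in B & c in C].

Section Jacobson.
Variables (F : fieldType) (L : lieSuperalgebra F).

(* A polynomial in lambda with coefficients in L is represented by its        *)
(* sequence of coefficients f : nat -> L.                                     *)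
Definition lambda_mul (f : nat -> L) (k : nat) : L :=
  if k is k'.+1 then f k' else 0.

(* ad (lambda x + y), extended to polynomials in lambda *)
Definition ad_lambda (x y : L) (f : nat -> L) (k : nat) : L :=
  ad x (lambda_mul f k) + ad y (f k).

(* i%:R times jacobson_s p i x y is the coefficient of lambda ^ (i - 1) in    *)
(* (ad (lambda x + y)) ^ (p - 1) (x), for 0 < i < p.                          *)
Definition jacobson_s (p i : nat) (x y : L) : L :=
  i%:R^-1 *: iter p.-1 (ad_lambda x y) (fun k => if k == 0%N then x else 0) i.-1.

End Jacobson.

(* Only the values of ppow on L_0 are meaningful. *)
Record restrictedLieSuperalgebra (F : fieldType) (p : nat) :=
    RestrictedLieSuperalgebra {
  rlsa_super :> lieSuperalgebra F;
  rlsa_char : p \in [pchar F];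
  ppow : rlsa_super -> rlsa_super;
  ppow_part : forall x, part false x -> part false (ppow x);
  ppowZ : forall (a : F) x, part false x -> ppow (a *: x) = a ^+ p *: ppow x;
  ppow_ad : forall x y, part false x -> br y (ppow x) = iter p (ad x) y;
  ppowD : forall x y, part false x -> part false y ->
    ppow (x + y) = ppow x + ppow y + \sum_(1 <= i < p) jacobson_s p i x y
}.

Section PNilpotent.
Variables (F : fieldType) (p : nat) (L : restrictedLieSuperalgebra F p).

(* Since x ^ p in u(L) is identified with ppow x, the element x ^ (p ^ t) of  *)
(* L is the t-fold iterate of ppow at x.                                      *)
Definition p_nilpotent (x : L) : Prop :=
  part false x /\ exists t : nat, iter t (@ppow F p L) x = 0.

Definition p_nilpotent_set (X : set L) : Prop :=
  X `<=` part false /\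
  exists s : nat, forall x, X x -> iter s (@ppow F p L) x = 0.

End PNilpotent.

(* u(L), by generators and relations: unital associative algebra expressions  *)
(* over L modulo the congruence generated by the axioms of F-algebras,        *)
(* the linearity of the map L -> u(L), and the defining relations.            *)
Section RestrictedEnveloping.
Variables (F : fieldType) (p : nat) (L : restrictedLieSuperalgebra F p).

Inductive uterm : Type :=
  | UGen of L
  | UScal of F
  | UAdd of uterm & uterm
  | UMul of uterm & uterm.

Inductive urel : uterm -> uterm -> Prop :=
  | urel_refl s : urel s s
  | urel_sym s t : urel s t -> urel t s
  | urel_trans s t r : urel s t -> urel t r -> urel s r
  | urel_add s s' t t' : urel s s' -> urel t t' -> urel (UAdd s t) (UAdd s' t')
  | urel_mul s s' t t' : urel s s' -> urel t t' -> urel (UMul s t) (UMul s' t')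
  | urel_addA s t r : urel (UAdd s (UAdd t r)) (UAdd (UAdd s t) r)
  | urel_addC s t : urel (UAdd s t) (UAdd t s)
  | urel_add0 s : urel (UAdd (UScal 0) s) s
  | urel_mulA s t r : urel (UMul s (UMul t r)) (UMul (UMul s t) r)
  | urel_mul1 s : urel (UMul (UScal 1) s) s
  | urel_mulDl s t r : urel (UMul (UAdd s t) r) (UAdd (UMul s r) (UMul t r))
  | urel_mulDr s t r : urel (UMul s (UAdd t r)) (UAdd (UMul s t) (UMul s r))
  | urel_scalD a b : urel (UScal (a + b)) (UAdd (UScal a) (UScal b))
  | urel_scalM a b : urel (UScal (a * b)) (UMul (UScal a) (UScal b))
  | urel_scalC a s : urel (UMul (UScal a) s) (UMul s (UScal a))
  | urel_mul0 s : urel (UMul (UScal 0) s) (UScal 0)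
  | urel_gen a x y :
      urel (UGen (a *: x + y)) (UAdd (UMul (UScal a) (UGen x)) (UGen y))
  | urel_br i j x y : part i x -> part j y ->
      urel (UAdd (UMul (UGen x) (UGen y))
                 (UMul (UScal (- (-1) ^+ (i && j))) (UMul (UGen y) (UGen x))))
           (UGen (br x y))
  | urel_ppow x : part false x ->
      urel (iter p (UMul (UGen x)) (UScal 1)) (UGen (ppow x)).

HB.instance Definition _ := gen_eqMixin uterm.
HB.instance Definition _ := gen_choiceMixin uterm.

Definition urelb (s t : uterm) : bool := `[< urel s t >].

Lemma urelb_refl : reflexive urelb.
Proof. by move=> s; apply/asboolP; apply: urel_refl. Qed.

Lemma urelb_sym : symmetric urelb.
Proof. by move=> s t; apply/asboolP/asboolP; apply: urel_sym. Qed.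

Lemma urelb_trans : transitive urelb.
Proof.
move=> t s r /asboolP st /asboolP tr; apply/asboolP.
exact: urel_trans st tr.
Qed.

Canonical urel_equiv := EquivRel urelb urelb_refl urelb_sym urelb_trans.

Definition uenv : Type := {eq_quot urel_equiv}.
HB.instance Definition _ := Choice.on uenv.

Definition uclass (s : uterm) : uenv := \pi_({eq_quot urel_equiv}) s.
Definition urepr (u : uenv) : uterm := repr (u : {eq_quot urel_equiv}).

Lemma uclassP s t : urel s t <-> uclass s = uclass t.
Proof.
split=> [st|/eqP]; first by apply/eqP; rewrite /uclass eqmodE; apply/asboolP.
by rewrite /uclass eqmodE => /asboolP.
Qed.

Lemma ureprK u : uclass (urepr u) = u.
Proof. exact: reprK. Qed.

Lemma uclass_repr s : urel (urepr (uclass s)) s.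
Proof. by apply/uclassP; rewrite ureprK. Qed.

Definition uadd (u v : uenv) := uclass (UAdd (urepr u) (urepr v)).
Definition umul (u v : uenv) := uclass (UMul (urepr u) (urepr v)).
Definition uscal (a : F) := uclass (UScal a).
Definition uopp (u : uenv) := umul (uscal (-1)) u.
Definition uscale (a : F) (u : uenv) := umul (uscal a) u.

Lemma uaddE s t : uadd (uclass s) (uclass t) = uclass (UAdd s t).
Proof. by apply/uclassP; apply: urel_add; apply: uclass_repr. Qed.

Lemma umulE s t : umul (uclass s) (uclass t) = uclass (UMul s t).
Proof. by apply/uclassP; apply: urel_mul; apply: uclass_repr. Qed.

Lemma uaddA : associative uadd.
Proof.
move=> u v w; rewrite -(ureprK u) -(ureprK v) -(ureprK w) !uaddE.
exact/uclassP/urel_addA.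
Qed.

Lemma uaddC : commutative uadd.
Proof.
by move=> u v; rewrite -(ureprK u) -(ureprK v) !uaddE; apply/uclassP/urel_addC.
Qed.

Lemma uadd0 : left_id (uscal 0) uadd.
Proof. by move=> u; rewrite -(ureprK u) uaddE; apply/uclassP/urel_add0. Qed.

Lemma umulA : associative umul.
Proof.
move=> u v w; rewrite -(ureprK u) -(ureprK v) -(ureprK w) !umulE.
exact/uclassP/urel_mulA.
Qed.

Lemma umul1 : left_id (uscal 1) umul.
Proof. by move=> u; rewrite -(ureprK u) umulE; apply/uclassP/urel_mul1. Qed.

Lemma uscalC a u : umul (uscal a) u = umul u (uscal a).
Proof. by rewrite -(ureprK u) !umulE; apply/uclassP/urel_scalC. Qed.

Lemma umulDl : left_distributive umul uadd.
Proof.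
move=> u v w; rewrite -(ureprK u) -(ureprK v) -(ureprK w) !(uaddE, umulE).
exact/uclassP/urel_mulDl.
Qed.

Lemma umulDr : right_distributive umul uadd.
Proof.
move=> u v w; rewrite -(ureprK u) -(ureprK v) -(ureprK w) !(uaddE, umulE).
exact/uclassP/urel_mulDr.
Qed.

Lemma umul0 u : umul (uscal 0) u = uscal 0.
Proof. by rewrite -(ureprK u) umulE; apply/uclassP/urel_mul0. Qed.

Lemma uscalD a b : uscal (a + b) = uadd (uscal a) (uscal b).
Proof. by rewrite uaddE; apply/uclassP/urel_scalD. Qed.

Lemma uscalM a b : uscal (a * b) = umul (uscal a) (uscal b).
Proof. by rewrite umulE; apply/uclassP/urel_scalM. Qed.

Lemma uaddN : left_inverse (uscal 0) uopp uadd.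
Proof.
by move=> u; rewrite -{2}[u]umul1 -umulDl -uscalD addNr umul0.
Qed.

HB.instance Definition _ := GRing.isZmodule.Build uenv uaddA uaddC uadd0 uaddN.

Lemma umul1r : right_id (uscal 1) umul.
Proof. by move=> u; rewrite -uscalC umul1. Qed.

(* The augmentation of u(L) shows that it is not the zero ring. *)
Fixpoint uaug (s : uterm) : F :=
  match s with
  | UGen _ => 0
  | UScal a => a
  | UAdd s t => uaug s + uaug t
  | UMul s t => uaug s * uaug t
  end.

Lemma uaug_rel s t : urel s t -> uaug s = uaug t.
Proof.
elim=> //=.
- by move=> {}s {}t r _ -> _ ->.
- by move=> ? ? ? ? _ -> _ ->.
- by move=> ? ? ? ? _ -> _ ->.
- by move=> *; rewrite addrA.
- by move=> *; rewrite addrC.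
- by move=> *; rewrite add0r.
- by move=> *; rewrite mulrA.
- by move=> *; rewrite mul1r.
- by move=> *; rewrite mulrDl.
- by move=> *; rewrite mulrDr.
- by move=> *; rewrite mulrC.
- by move=> *; rewrite mul0r.
- by move=> *; rewrite mulr0 addr0.
- by move=> *; rewrite !mul0r mulr0 addr0.
- move=> x _; have /prime_gt0 : prime p by have /andP[] := rlsa_char L.
  by case: p => //= q _; rewrite mul0r.
Qed.

Lemma uoner_neq0 : uscal 1 != uscal 0.
Proof.
apply/eqP => /uclassP/uaug_rel /= /eqP; apply/negP; exact: oner_neq0.
Qed.

HB.instance Definition _ := GRing.Zmodule_isNzRing.Build uenv
  umulA umul1 umul1r umulDl umulDr uoner_neq0.

Lemma uscaleA a b u : uscale a (uscale b u) = uscale (a * b) u.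
Proof. by rewrite /uscale uscalM umulA. Qed.

Lemma uscaleDl u : {morph uscale^~ u : a b / a + b}.
Proof. by move=> a b; rewrite /uscale uscalD umulDl. Qed.

HB.instance Definition _ := GRing.Zmodule_isLmodule.Build F uenv
  uscaleA umul1 (fun a => umulDr (uscal a)) uscaleDl.

Lemma uscaleAl a (u v : uenv) : a *: (u * v) = (a *: u) * v.
Proof. exact: umulA. Qed.

HB.instance Definition _ := GRing.Lmodule_isLalgebra.Build F uenv
  uscaleAl.

Lemma uscaleAr a (u v : uenv) : a *: (u * v) = u * (a *: v).
Proof.
by rewrite /GRing.scale/= /uscale umulA uscalC -[LHS]umulA.
Qed.

HB.instance Definition _ := GRing.Lalgebra_isAlgebra.Build F uenv
  uscaleAr.

(* the canonical map L -> u(L) *)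
Definition uin (x : L) : uenv := uclass (UGen x).

End RestrictedEnveloping.

Section AssociativeAlgebras.

(* A noncommutative polynomial in the variables X_0, X_1, ... is a finitely   *)
(* supported family of coefficients indexed by the words on nat, and          *)
(* [:: i_1; ...; i_k] stands for the monomial X_{i_1} ... X_{i_k}.            *)
Definition ncpoly (F : fieldType) := {fsfun seq nat -> F with 0}.

Definition nceval (F : fieldType) (A : algType F) (f : ncpoly F) (a : nat -> A) :
    A :=
  \sum_(w <- finsupp f) f w *: \prod_(i <- w) a i.

Definition satisfies_PI (F : fieldType) (A : algType F) : Prop :=
  exists f : ncpoly F, (exists w, f w != 0) /\
    forall a : nat -> A, nceval f a = 0.

Definition two_sided_ideal (R : pzRingType) (I : set R) : Prop :=
  [/\ I 0, forall a b, I a -> I b -> I (a - b),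
      forall r a, I a -> I (r * a) & forall r a, I a -> I (a * r)].

Definition commutator_ideal (R : pzRingType) : set R :=
  smallest (@two_sided_ideal R) [set a * b - b * a | a in setT & b in setT].

Definition nil_bounded_index (R : pzRingType) (I : set R) : Prop :=
  exists n : nat, forall a, I a -> a ^+ n = 0.

End AssociativeAlgebras.

Arguments commutator_ideal R : clear implicits.

(* Main.v *)
Require Import Defs.
From mathcomp Require Import all_boot all_order all_algebra finmap.
From mathcomp Require Import boolp classical_sets.
From mathcomp Require Import zify.

Set Implicit Arguments.
Unset Strict Implicit.
Unset Printing Implicit Defensive.

Import GRing.Theory.
Local Open Scope classical_set_scope.
Local Open Scope ring_scope.

(* Write G_i for the image of L_i in R = u(L) and [x, y] for the super        *)
(* commutator. Since the coproduct of u(L) is available, functionals z_k on R *)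
(* give operators (id (x) z_k) o Delta; if u_k, v_k are such that z_k can     *)
(* be chosen to see [u_k, v_k] and no other bracket, then composing them      *)
(* singles out u_0 v_0 u_1 v_1 ... among the permutations of the blocks       *)
(* u_0, v_0 u_1, v_1 u_2, ..., which contradicts a multilinear identity. So   *)
(* such families have bounded length, and linear algebra turns this into the  *)
(* existence of V_i of finite codimension in G_i for which [V, V] is          *)
(* finite-dimensional and each v in V has finite-dimensional [v, G].          *)
(*                                                                            *)
(* Let S be the union of (L_0, L_0), (M, L_1) and M. It is stable under       *)
(* brackets with L, its elements are nilpotent, and the brackets of L lie in  *)
(* its span except for [z, z], where L_1 = M + F z; as z commutes with        *)
(* itself, the commutator ideal lies in R S. By Engel, a power of R S lies in *)
(* R (S /\ V), and R (S /\ [V, V]) is nilpotent. Finally R is a finitely      *)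
(* generated right module over the algebra C generated by V, which is super   *)
(* commutative modulo R (S /\ [V, V]), so elements of R (S /\ V) act by       *)
(* finite matrices whose entries are nil of bounded index, by Frobenius.      *)

(** * Deciding identities in abelian groups and noncommutative rings *)

(** The polynomial identity makes R = u(L) super commutative up to finite-dimensional defects, and
    the p-nilpotency hypotheses make these defects nil.

    Bounding configurations. Suppose that functionals z_k separate the brackets (u_k, v_k), k < m,
    from each other and from the unwanted brackets ([contraction_data]). Cut u_0 v_0 u_1 v_1 ...
    into the m + 1 blocks u_0, v_0 u_1, ..., v_{m-1} and substitute these into a multilinear
    identity of degree m + 1. Each contraction by z_k takes at least two of the 2m letters away,
    hence exactly two, and the number of letters v forces it to take u_k v_k in this order. Only the
    identity permutation of the blocks survives, although its coefficient is nonzero. So m is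
    bounded ([contraction_data_bounded]).

    Linear algebra. If c in G_i acts on G_j by something other than a scalar plus a finite-rank map,
    it can serve as some v_k; hence such elements vanish in a quotient of G_i by a subspace of
    finite codimension ([almost_scalar_fcodim]), and the elements with finite-rank adjoint maps have
    finite codimension too ([finite_adjoint_fcodim]). Choosing pairs among the latter shows that
    their brackets span a finite-dimensional space ([finite_adjoint_derived]).

    Three ideals. Let B be spanned by the brackets [V, V], where V consists of the elements with
    finite-rank adjoint maps, restricted to M in degree 1. The ideals R S, R (S meet V) and R (S
    meet B) are called I, J and P. I contains all commutators. [engel] shows that powers of elements
    of I lie in J, since S has finite codimension modulo J, and that P is nil of bounded index,
    since B is finite-dimensional. From J to P: the algebra C generated by V super commutes modulo
    P, and R is a finitely generated right C-module ([finitely_generated]), so an element of J acts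
    by a finite matrix whose entries are nil modulo P; a long product of entries repeats one of them
    too often ([J_nil_mod]). The index in [commutator_ideal_nil] is the product of the three. *)

Inductive zexpr := ZZero | ZAtom of nat | ZAdd of zexpr & zexpr | ZOpp of zexpr.

Fixpoint zeval (V : zmodType) (env : seq V) (e : zexpr) : V :=
  match e with
  | ZZero => 0
  | ZAtom n => env`_n
  | ZAdd e1 e2 => zeval env e1 + zeval env e2
  | ZOpp e1 => - zeval env e1
  end.

Fixpoint zcoef (e : zexpr) (i : nat) : int :=
  match e with
  | ZZero => 0
  | ZAtom n => (i == n)%:R
  | ZAdd e1 e2 => zcoef e1 i + zcoef e2 i
  | ZOpp e1 => - zcoef e1 i
  end.

Lemma zevalE (V : zmodType) (env : seq V) e :
  zeval env e = \sum_(i < size env) env`_i *~ zcoef e i.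
Proof.
elim: e => [|n|e1 IH1 e2 IH2|e1 IH1] /=.
- by rewrite big1 // => i _; rewrite mulr0z.
- have [n_lt|n_ge] := ltnP n (size env).
    rewrite (bigD1 (Ordinal n_lt)) //= eqxx mulr1z big1 ?addr0 // => i.
    by rewrite -val_eqE /= => /negPf->; rewrite mulr0z.
  rewrite nth_default // big1 // => i _.
  by rewrite ltn_eqF ?mulr0z // (leq_trans (ltn_ord i)).
- by rewrite IH1 IH2 -big_split; apply: eq_bigr => i _; rewrite mulrzDr.
- by rewrite IH1 -sumrN; apply: eq_bigr => i _; rewrite mulrNz.
Qed.

Lemma zeval_eq (V : zmodType) (env : seq V) e1 e2 :
  all (fun i => zcoef e1 i == zcoef e2 i) (iota 0 (size env)) ->
  zeval env e1 = zeval env e2.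
Proof.
move=> /allP H; rewrite !zevalE; apply: eq_bigr => i _.
by congr (_ *~ _); apply/eqP/H; rewrite mem_iota add0n ltn_ord.
Qed.

(** Matching on a dummy term lets the tactic [unify] run while a term is being returned. Atoms are
    thus identified up to conversion and not only syntactically. *)
Ltac z_same a b := match constr:(Set) with
  | _ => let _ := match constr:(Set) with _ => unify a b end in constr:(true)
  | _ => constr:(false)
  end.

Ltac z_mem a l :=
  match l with
  | nil => constr:(false)
  | cons ?b ?l' => let t := z_same a b in
    match t with true => constr:(true) | false => z_mem a l' end
  end.

Ltac z_insert t l :=
  let b := z_mem t l in match b with true => l | false => constr:(cons t l) end.

Ltac z_index a l :=
  match l with
  | cons ?b ?l' => let t := z_same a b in
    match t with
    | true => constr:(0%N)
    | false => let n := z_index a l' in constr:(S n)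
    end
  end.

Ltac z_atoms t l :=
  match t with
  | (?a + ?b)%R => let l1 := z_atoms a l in z_atoms b l1
  | (- ?a)%R => z_atoms a l
  | 0%R => l
  | _ => z_insert t l
  end.

Ltac z_reify t l :=
  match t with
  | (?a + ?b)%R => let ea := z_reify a l in let eb := z_reify b l in
                   constr:(ZAdd ea eb)
  | (- ?a)%R => let ea := z_reify a l in constr:(ZOpp ea)
  | 0%R => constr:(ZZero)
  | _ => let n := z_index t l in constr:(ZAtom n)
  end.

Ltac abel :=
  match goal with
  | |- @eq ?T ?x ?y =>
    let l0 := z_atoms x (@nil T) in
    let l := z_atoms y l0 in
    let ex := z_reify x l in
    let ey := z_reify y l in
    refine (@zeval_eq _ l ex ey _); vm_compute; reflexivity
  end.

Inductive rexpr := RZero | ROne | RAtom of nat | RAdd of rexpr & rexpr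
  | ROpp of rexpr | RMul of rexpr & rexpr.

Fixpoint reval (R : pzRingType) (env : seq R) (e : rexpr) : R :=
  match e with
  | RZero => 0
  | ROne => 1
  | RAtom n => env`_n
  | RAdd e1 e2 => reval env e1 + reval env e2
  | ROpp e1 => - reval env e1
  | RMul e1 e2 => reval env e1 * reval env e2
  end.

Fixpoint rnorm (e : rexpr) : seq (int * seq nat) :=
  match e with
  | RZero => [::]
  | ROne => [:: (1, [::])]
  | RAtom n => [:: (1, [:: n])]
  | RAdd e1 e2 => rnorm e1 ++ rnorm e2
  | ROpp e1 => [seq (- m.1, m.2) | m <- rnorm e1]
  | RMul e1 e2 => [seq (m.1 * n.1, m.2 ++ n.2) | m <- rnorm e1, n <- rnorm e2]
  end.

Definition rmono (R : pzRingType) (env : seq R) (w : seq nat) : R :=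
  \prod_(i <- w) env`_i.

Lemma revalE (R : pzRingType) (env : seq R) e :
  reval env e = \sum_(m <- rnorm e) rmono env m.2 *~ m.1.
Proof.
elim: e => [||n|e1 IH1 e2 IH2|e1 IH1|e1 IH1 e2 IH2] /=.
- by rewrite big_nil.
- by rewrite big_seq1 /rmono big_nil.
- by rewrite big_seq1 /rmono big_seq1.
- by rewrite big_cat IH1 IH2.
- by rewrite big_map IH1 -sumrN; apply: eq_bigr => m _; rewrite mulrNz.
rewrite big_allpairs_dep IH1 IH2 mulr_suml; apply: eq_bigr => m _.
rewrite mulr_sumr; apply: eq_bigr => n _ /=.
by rewrite /rmono big_cat /= mulrzAl mulrzAr -mulrzA mulrC.
Qed.

Definition rcoef (l : seq (int * seq nat)) (w : seq nat) : int :=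
  foldr (fun m s => if m.2 == w then m.1 + s else s) 0 l.

Lemma rcoefE (V : zmodType) (f : seq nat -> V) l s : uniq s ->
  {subset unzip2 l <= s} ->
  \sum_(m <- l) f m.2 *~ m.1 = \sum_(w <- s) f w *~ rcoef l w.
Proof.
move=> us; elim: l => [|m l IH] ls /=.
  by rewrite big_nil big1 // => w _; rewrite mulr0z.
have ms : m.2 \in s by apply: ls; rewrite mem_head.
rewrite big_cons IH => [|w wl]; last by apply: ls; rewrite inE wl orbT.
rewrite [RHS](bigD1_seq m.2) //= (bigD1_seq m.2 ms us) /= eqxx mulrzDr addrA.
by congr (_ + _); apply: eq_bigr => w wm; rewrite eq_sym (negPf wm).
Qed.

(** It suffices that every noncommutative monomial of the expanded difference has total integer
    coefficient 0, which is decided by computation. *)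
Lemma reval_eq (R : pzRingType) (env : seq R) e1 e2 :
  (let l := rnorm (RAdd e1 (ROpp e2)) in
   all (fun w => rcoef l w == 0) (undup (unzip2 l))) ->
  reval env e1 = reval env e2.
Proof.
move=> /allP H; apply/eqP; rewrite -subr_eq0; apply/eqP.
rewrite -[LHS]/(reval env (RAdd e1 (ROpp e2))) revalE.
move: (rnorm _) H => l H.
rewrite (@rcoefE _ (rmono env) l (undup (unzip2 l))) ?undup_uniq //; last first.
  by move=> w; rewrite mem_undup.
by rewrite big1_seq // => w /andP[_ /H/eqP->]; rewrite mulr0z.
Qed.

Ltac r_atoms t l :=
  match t with
  | (?a + ?b)%R => let l1 := r_atoms a l in r_atoms b l1
  | (?a * ?b)%R => let l1 := r_atoms a l in r_atoms b l1
  | (- ?a)%R => r_atoms a l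
  | 0%R => l
  | 1%R => l
  | _ => z_insert t l
  end.

Ltac r_reify t l :=
  match t with
  | (?a + ?b)%R => let ea := r_reify a l in let eb := r_reify b l in
                   constr:(RAdd ea eb)
  | (?a * ?b)%R => let ea := r_reify a l in let eb := r_reify b l in
                   constr:(RMul ea eb)
  | (- ?a)%R => let ea := r_reify a l in constr:(ROpp ea)
  | 0%R => constr:(RZero)
  | 1%R => constr:(ROne)
  | _ => let n := z_index t l in constr:(RAtom n)
  end.

Ltac nring :=
  match goal with
  | |- @eq ?T ?x ?y =>
    let l0 := r_atoms x (@nil T) in
    let l := r_atoms y l0 in
    let ex := r_reify x l in
    let ey := r_reify y l in
    refine (@reval_eq _ l ex ey _); vm_compute; reflexivity
  end.

(** * Spans and finite codimension *)


Definition is_linear (F : fieldType) (U V : lmodType F) (g : U -> V) :=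
  forall a x y, g (a *: x + y) = a *: g x + g y.

Section IsLinear.
Variables (F : fieldType) (U V : lmodType F) (g : U -> V).
Hypothesis gL : is_linear g.

Lemma lin0 : g 0 = 0.
Proof. by have := gL (-1) 0 0; rewrite scaler0 addr0 scaleN1r addNr. Qed.

Lemma linD x y : g (x + y) = g x + g y.
Proof. by have := gL 1 x y; rewrite !scale1r. Qed.

Lemma linZ a x : g (a *: x) = a *: g x.
Proof. by have := gL a x 0; rewrite lin0 !addr0. Qed.

Lemma linN x : g (- x) = - g x.
Proof. by rewrite -scaleN1r linZ scaleN1r. Qed.

Lemma linB x y : g (x - y) = g x - g y.
Proof. by rewrite linD linN. Qed.

Lemma lin_sum I (r : seq I) (P : pred I) (f : I -> U) :
  g (\sum_(i <- r | P i) f i) = \sum_(i <- r | P i) g (f i).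
Proof. exact: (big_morph g linD lin0). Qed.

End IsLinear.

Section Spans.
Variables (F : fieldType) (V : lmodType F).
Implicit Types (U W A : set V) (s t : seq V).

Lemma subspace_scale W a x : subspace W -> W x -> W (a *: x).
Proof. by move=> [W0 WL] Wx; rewrite -[_ *: _]addr0; apply: WL. Qed.

Lemma subspaceD W x y : subspace W -> W x -> W y -> W (x + y).
Proof. by move=> [W0 WL] Wx Wy; rewrite -[x]scale1r; apply: WL. Qed.

Lemma subspaceN W x : subspace W -> W x -> W (- x).
Proof. by move=> sW Wx; rewrite -scaleN1r; apply: subspace_scale. Qed.

Lemma subspaceB W x y : subspace W -> W x -> W y -> W (x - y).
Proof. by move=> sW Wx Wy; apply: subspaceD => //; apply: subspaceN. Qed.

Lemma subspace_sum W I (r : seq I) (P : pred I) (f : I -> V) :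
  subspace W -> (forall i, P i -> W (f i)) -> W (\sum_(i <- r | P i) f i).
Proof. by move=> sW Wf; elim/big_ind: _ => // [|x y];
  [case: sW|apply: subspaceD]. Qed.

Lemma subspaceI U W : subspace U -> subspace W -> subspace (U `&` W).
Proof.
by move=> [U0 UL] [W0 WL]; split=> // a x y [Ux Wx] [Uy Wy]; split; auto.
Qed.

Lemma subspace_preim (V' : lmodType F) (g : V -> V') (W : set V') :
  is_linear g -> subspace W -> subspace (g @^-1` W).
Proof.
move=> gL [W0 WL]; split=> [|a x y]; first by rewrite /= (lin0 gL).
by rewrite /= gL; apply: WL.
Qed.

Lemma subspace0 : subspace [set (0 : V)].
Proof. by split=> [|a x y /= -> ->] /=; rewrite ?scaler0 ?addr0. Qed.

Lemma lspan_subspace A : subspace (lspan A).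
Proof.
split=> [W [[W0 _] _] //|a x y Ax Ay W [[W0 WL] AW]].
by apply: (WL a); [apply: Ax|apply: Ay].
Qed.

Lemma lspan_gen A : A `<=` lspan A.
Proof. exact: sub_gen_smallest. Qed.

Lemma lspan_min A W : subspace W -> A `<=` W -> lspan A `<=` W.
Proof. exact: smallest_sub. Qed.

(* W + F s_1 + ... + F s_n                                                    *)
Fixpoint spn W s : set V :=
  if s is a :: s' then [set v | exists c : F, spn W s' (v - c *: a)] else W.

Lemma spn_subspace W s : subspace W -> subspace (spn W s).
Proof.
move=> sW; elim: s => //= b s [IH0 IHL]; split.
  by exists 0; rewrite scale0r subr0.
move=> a x y [c xc] [d yd]; exists (a * c + d).
rewrite scalerDl -scalerA [X in spn _ _ X](_ : _ =
  a *: (x - c *: b) + (y - d *: b)); first exact: IHL.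
by rewrite scalerBr addrACA opprD.
Qed.

Lemma spn_sub W s : W `<=` spn W s.
Proof.
by elim: s => //= b s IH x Wx; exists 0; rewrite scale0r subr0; apply: IH.
Qed.

Lemma spn_mem W s x : subspace W -> x \in s -> spn W s x.
Proof.
move=> sW; elim: s => //= b s IH; rewrite inE => /predU1P[->|/IH xs].
  by exists 1; rewrite scale1r subrr; case: (spn_subspace s sW).
by exists 0; rewrite scale0r subr0.
Qed.

Lemma spn_min W s U : subspace U -> W `<=` U -> (forall x, x \in s -> U x) ->
  spn W s `<=` U.
Proof.
move=> sU WU; elim: s => //= b s IH sU' x [c xc].
rewrite -[x](subrK (c *: b)); apply: subspaceD => //.
  by apply: IH xc => y ys; apply: sU'; rewrite inE ys orbT.
by apply: subspace_scale => //; apply: sU'; rewrite inE eqxx.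
Qed.

Lemma spn_mono W W' s t : subspace W' -> W `<=` W' -> {subset s <= t} ->
  spn W s `<=` spn W' t.
Proof.
move=> sW' WW' st; apply: spn_min; first exact: spn_subspace.
  by move=> x /WW'; apply: spn_sub.
by move=> x /st; apply: spn_mem.
Qed.

Lemma spn_cat W s t : spn W (s ++ t) = spn (spn W t) s.
Proof. by elim: s => //= b s ->. Qed.

Lemma spn_cons W a s x : subspace W ->
  spn W (a :: s) x <-> exists c y, W y /\ spn [set 0] s (x - c *: a - y).
Proof.
move=> sW; split=> [[c]|[c [y [Wy h]]]]; last first.
  exists c; rewrite -[_ - _](subrK y); apply: subspaceD.
  - exact: spn_subspace.
  - by apply: spn_mono h => // z ->; case: sW.
  - exact: spn_sub.
move=> h; exists c; move: (_ - _) h => z.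
elim: s z => [|b s IH] z /=; first by move=> Wz; exists z; rewrite subrr.
by move=> [d /IH[y [Wy h]]]; exists y; split=> //; exists d; rewrite addrAC.
Qed.

Definition fdim A := exists s, A `<=` spn [set 0] s.

Definition fcodim U W := exists s, U `<=` spn W s.

Lemma fdim_sub A B : A `<=` B -> fdim B -> fdim A.
Proof. by move=> AB [s Bs]; exists s => x /AB/Bs. Qed.

Lemma fdim_spn s : fdim (spn [set 0] s).
Proof. by exists s. Qed.

Lemma fdimU A B : fdim A -> fdim B -> fdim (A `|` B).
Proof.
move=> [s As] [t Bt]; exists (s ++ t) => x [/As|/Bt];
  apply: spn_mono => //; try exact: subspace0.
  by move=> y ys; rewrite mem_cat ys.
by move=> y yt; rewrite mem_cat yt orbT.
Qed.

Lemma fdim_lspan A : fdim A -> fdim (lspan A).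
Proof.
move=> [s As]; exists s; apply: lspan_min => //; exact: (spn_subspace _ subspace0).
Qed.

Lemma fdimD A B : fdim A -> fdim B ->
  fdim [set z | exists x y, [/\ A x, B y & z = x + y]].
Proof.
move=> fA fB; apply: fdim_sub (fdim_lspan (fdimU fA fB)).
move=> z [x [y [Ax By ->]]]; apply: (subspaceD (lspan_subspace _)).
  by apply: lspan_gen; left.
by apply: lspan_gen; right.
Qed.

End Spans.

Lemma fdim_image (F : fieldType) (U V : lmodType F) (g : U -> V) (A : set U) :
  is_linear g -> fdim A -> fdim (g @` A).
Proof.
move=> gL [s As]; exists (map g s) => _ [x /As xs <-].
elim: s x {As} xs => [|b s IH] x /=; first by move=> ->; rewrite (lin0 gL).
by move=> [c /IH]; rewrite (linB gL) (linZ gL); exists c.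
Qed.

Section FiniteCodimension.
Variables (F : fieldType).

(** Induction on [s]: if some [w] in [X] involves the first vector [b], subtracting multiples of [w]
    removes [b] from every [g x]. That the representatives [t] lie in [X] matters later, as in
    [infinite_left] and [finitely_generated]. *)
Lemma preim_fcodim (U V : lmodType F) (X : set U) (W : set V) (g : U -> V) s :
    subspace X -> subspace W -> is_linear g ->
    (forall x, X x -> spn W s (g x)) ->
  exists t, (forall x, x \in t -> X x) /\ X `<=` spn (X `&` g @^-1` W) t.
Proof.
move=> sX sW gL; elim: s X sX => [|b s IH] X sX /= Xs.
  by exists [::]; split=> // x Xx; split=> //; apply: Xs.
pose X' := X `&` g @^-1` spn W s.
have sX' : subspace X'.
  by apply: subspaceI => //; apply: subspace_preim => //; apply: spn_subspace.
have [|t [tX' X't]] := IH X' sX'; first by move=> x [].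
have sP : subspace (X `&` g @^-1` W).
  by apply: subspaceI => //; apply: subspace_preim.
have sub : X' `&` g @^-1` W `<=` X `&` g @^-1` W by move=> x [[]].
have [XX'|/existsNP[w /not_implyP[Xw X'w]]] := pselect (X `<=` X').
  exists t; split=> [x /tX'[]//|x /XX'/X't].
  exact: spn_mono.
have [c wc] := Xs w Xw.
have c0 : c != 0.
  by apply: contra_notN X'w => /eqP c0; split=> //; rewrite c0 scale0r subr0 in wc.
exists (w :: t); split=> [x|x Xx].
  by rewrite inE => /predU1P[->//|/tX'[]].
have [d xd] := Xs x Xx; exists (d / c).
suff /X't : X' (x - d / c *: w) by apply: spn_mono.
split; first by apply: subspaceB => //; apply: subspace_scale.
rewrite /= (linB gL) (linZ gL).
rewrite [X in spn _ _ X](_ : _ = (g x - d *: b) - d / c *: (g w - c *: b)).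
  apply: subspaceB => //; first exact: spn_subspace.
  by apply: subspace_scale => //; apply: spn_subspace.
by rewrite scalerBr scalerA divfK // opprB addrA subrK.
Qed.

Lemma ker_fcodim (U V : lmodType F) (X : set U) (g : U -> V) :
    subspace X -> is_linear g -> fdim (g @` X) ->
  exists t, (forall x, x \in t -> X x) /\ X `<=` spn (X `&` [set x | g x = 0]) t.
Proof.
move=> sX gL [s gs].
by apply: (preim_fcodim (s := s) sX (subspace0 V) gL) => x Xx; apply: gs; exists x.
Qed.

Variable V : lmodType F.
Implicit Types (X W : set V).

Lemma fcodim_basis X W : subspace X -> subspace W -> fcodim X W ->
  exists t, (forall x, x \in t -> X x) /\ X `<=` spn (X `&` W) t.
Proof.
by move=> sX sW [s Xs]; apply: (preim_fcodim (g := id) (s := s) sX sW).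
Qed.

Lemma fcodim_trans X Y W : subspace W ->
  fcodim X Y -> fcodim Y W -> fcodim X W.
Proof.
move=> sW [s Xs] [t Yt]; exists (s ++ t) => x /Xs; rewrite spn_cat.
by apply: spn_mono => //; apply: spn_subspace.
Qed.

Lemma fcodim_sub X W W' : subspace W' -> W `<=` W' -> fcodim X W -> fcodim X W'.
Proof. by move=> sW' WW' [s Xs]; exists s => x /Xs; apply: spn_mono. Qed.

Lemma fcodimI X W W' : subspace X -> subspace W -> subspace W' ->
  fcodim X W -> fcodim X W' -> fcodim X (X `&` W `&` W').
Proof.
move=> sX sW sW' /(fcodim_basis sX sW)[t [_ Xt]] [s Xs].
have sXW := subspaceI sX sW.
apply: (@fcodim_trans _ (X `&` W)); first exact: subspaceI.
  by exists t.
have [|u [_ uP]] := @fcodim_basis (X `&` W) W' sXW sW'; last by exists u.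
by exists s => x [/Xs].
Qed.

Lemma fdim_fcodim X W : fcodim X W -> fdim W -> fdim X.
Proof.
move=> [s Xs] [t Wt]; exists (s ++ t) => x /Xs; rewrite spn_cat.
by apply: spn_mono => //; apply: (spn_subspace _ (subspace0 _)).
Qed.

End FiniteCodimension.

Section Functionals.
Variables (F : fieldType) (V : lmodType F).
Implicit Types (W : set V).

(* A maximal subspace avoiding b is a hyperplane complementary to F b. *)
Lemma functional_exists W b : subspace W -> ~ W b ->
  exists g : V -> F^o, [/\ is_linear g, g b = 1 & forall x, W x -> g x = 0].
Proof.
move=> sW Wb.
pose P (X : set V) := X = set0 \/ [/\ subspace X, W `<=` X & ~ X b].
have [C CP totC|A [AP Amax]] := @Zorn_bigcup V P.
  have [allC0|] := pselect (forall X, C X -> X = set0).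
    by left; apply/seteqP; split=> // x [X /allC0->].
  move=> /existsNP[X0 /not_implyP[CX0 X0n]].
  have [//|[sX0 WX0 X0b]] := CP _ CX0.
  right; split.
  - split=> [|a x y [X CX Xx] [Y CY Yy]]; first by exists X0 => //; case: sX0.
    have [XY|YX] := totC X Y CX CY.
      exists Y => //; case: (CP _ CY) => [Y0|[[_ YL] _ _]]; first by rewrite Y0 in Yy.
      by apply: YL => //; apply: XY.
    exists X => //; case: (CP _ CX) => [X00|[[_ XL] _ _]]; first by rewrite X00 in Xx.
    by apply: XL => //; apply: YX.
  - by move=> x Wx; exists X0 => //; apply: WX0.
  - by move=> [X CX Xb]; case: (CP _ CX) => [X00|[]//]; rewrite X00 in Xb.
have {AP}[sA WA Ab] : [/\ subspace A, W `<=` A & ~ A b].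
  case: AP => // A0; case: (Amax W); last by right; split.
  by rewrite A0; split=> [x []|W0]; case: sW => /W0 [].
have decomp x : exists c, A (x - c *: b).
  apply: contrapT => /forallNP nx.
  have nAx : ~ A x by move=> Ax; apply: (nx 0); rewrite scale0r subr0.
  apply: (Amax (spn A [:: x])).
    split; first exact: spn_sub.
    move=> h; apply: nAx; apply: h; apply: spn_mem => //; exact: mem_head.
  right; split; first exact: spn_subspace.
    by move=> y /WA; apply: spn_sub.
  move=> /= [c Ac]; have [c0|c0] := eqVneq c 0.
    by rewrite c0 scale0r subr0 in Ac.
  apply: (nx c^-1); rewrite [X in A X](_ : _ = - c^-1 *: (b - c *: x)).
    exact: subspace_scale.
  by rewrite scalerBr !scaleNr scalerA mulVf // scale1r opprK addrC.
have uniq_c x c d : A (x - c *: b) -> A (x - d *: b) -> c = d.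
  move=> Ac Ad; apply: contrapT => /eqP; rewrite -subr_eq0 => cd; apply: Ab.
  rewrite -[b](scalerK cd); apply: subspace_scale => //.
  rewrite [X in A X](_ : _ = (x - d *: b) - (x - c *: b)); first exact: subspaceB.
  by rewrite scalerBl opprB [RHS]addrC subrKA.
pose g x : F^o := xget 0 [set c : F | A (x - c *: b)].
have gP x : A (x - g x *: b).
  exact: (@xgetPex _ 0 [set c : F | A (x - c *: b)] (decomp x)).
exists g; split.
- move=> a x y; apply: (uniq_c (a *: x + y)) => //.
  rewrite scalerDl -scalerA [X in A X](_ : _ =
     a *: (x - g x *: b) + (y - g y *: b)); first by case: sA => _; apply.
  by rewrite scalerBr addrACA opprD.
- by apply: (uniq_c b) => //; rewrite scale1r subrr; case: sA.
- by move=> x /WA Ax; apply: (uniq_c x) => //; rewrite scale0r subr0.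
Qed.

Fixpoint indep W s : Prop :=
  if s is a :: s' then ~ spn W s' a /\ indep W s' else True.

Lemma indep_functional W s (c : nat -> F) : subspace W -> indep W s ->
  exists g : V -> F^o, [/\ is_linear g, forall x, W x -> g x = 0
    & forall k, (k < size s)%N -> g s`_k = c k].
Proof.
move=> sW; elim: s c => [c _|a s IH c [as_ ind]].
  by exists (fun=> 0); split=> // a x y; rewrite scaler0 addr0.
have [g [gL gW gs]] := IH (c \o S) ind.
have [h [hL ha hs]] := functional_exists (spn_subspace s sW) as_.
exists (fun x => g x + (c 0 - g a) *: h x); split.
- move=> d x y; rewrite gL hL !scalerDr !scalerA addrACA.
  by congr (_ + _ + (_ + _)); rewrite [X in X *: _]mulrC.
- by move=> x Wx; rewrite gW // hs ?scaler0 ?addr0 //; apply: spn_sub.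
- case=> [_|k /= ks] /=; first by rewrite ha /GRing.scale /= mulr1 addrC subrK.
  by rewrite hs ?scaler0 ?addr0 ?gs //; apply: spn_mem => //; apply: mem_nth.
Qed.

Lemma indep_sub W W' s : subspace W' -> W `<=` W' -> indep W' s -> indep W s.
Proof.
move=> sW' WW'; elim: s => //= a s IH [as_ /IH]; split=> //.
by apply: contra_not as_; apply: spn_mono.
Qed.

End Functionals.

(** * Operators that are independent modulo finite rank take independent values at some point *)

Section LocalIndependence.
Variables (F : fieldType).

Lemma spnP (V : lmodType F) (W : set V) s x : subspace W ->
  spn W s x <-> exists c : nat -> F, W (x - \sum_(i < size s) c i *: s`_i).
Proof.
move=> sW; elim: s x => [|a s IH] x /=.
  by split=> [Wx|[c]]; [exists (fun=> 0)|]; rewrite big_ord0 subr0.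
split=> [[c /IH[d h]]|[c h]].
  exists (fun i => if i is i'.+1 then d i' else c).
  by rewrite big_ord_recl /= opprD addrA.
exists (c 0); apply/IH; exists (c \o S).
by move: h; rewrite big_ord_recl /= opprD addrA.
Qed.

Lemma indep_coef (V : lmodType F) (W : set V) s (c : nat -> F) : subspace W ->
  indep W s -> W (\sum_(i < size s) c i *: s`_i) ->
  forall i, (i < size s)%N -> c i = 0.
Proof.
move=> sW; elim: s c => //= a s IH c [as_ ind].
rewrite big_ord_recl /= => h.
have c0 : c 0 = 0.
  apply: contrapT => /eqP c0; apply: as_; apply/(spnP _ _ sW).
  exists (fun i => - (c i.+1 / c 0)); rewrite -sumrN.
  rewrite [X in W X](_ : _ = (c 0)^-1 *:
    (c 0 *: a + \sum_(i < size s) c i.+1 *: s`_i)); first exact: subspace_scale.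
  rewrite scalerDr scalerK // scaler_sumr; congr (_ + _).
  by apply: eq_bigr => i _; rewrite scaleNr opprK scalerA mulrC.
rewrite c0 scale0r add0r in h.
by case=> // i /=; apply: (IH (c \o S)).
Qed.

Variables (U V : lmodType F) (X : set U).
Hypothesis sX : subspace X.
Implicit Types (Ts : seq (U -> V)) (c : nat -> F).

Definition comb Ts c (u : U) : V :=
  \sum_(i < size Ts) c i *: nth (fun=> 0) Ts i u.

(** Linear independence of the operators on [X] modulo operators of finite rank. *)
Fixpoint rank_indep Ts : Prop :=
  if Ts is T :: Ts' then
    [/\ is_linear T, rank_indep Ts'
      & forall c, ~ fdim ((fun u => T u - comb Ts' c u) @` X)]
  else True.

Lemma rank_indep_lin Ts i : rank_indep Ts -> is_linear (nth (fun=> 0) Ts i).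
Proof.
elim: Ts i => [|T Ts IH] [|i] //=; try by move=> _ a x y; rewrite scaler0 addr0.
  by case.
by case=> _ /IH.
Qed.

Lemma comb_lin Ts c : rank_indep Ts -> is_linear (comb Ts c).
Proof.
move=> Tsi a x y; rewrite /comb scaler_sumr -big_split /=; apply: eq_bigr => i _.
by rewrite (rank_indep_lin i Tsi) scalerDr !scalerA mulrC.
Qed.

Lemma combB Ts c d u : comb Ts c u - comb Ts d u = comb Ts (fun i => c i - d i) u.
Proof.
by rewrite /comb -sumrB; apply: eq_bigr => i _; rewrite scalerBl.
Qed.

Lemma comb_map Ts c u :
  comb Ts c u = \sum_(i < size (map (@^~ u) Ts)) c i *: (map (@^~ u) Ts)`_i.
Proof.
rewrite /comb size_map; apply: eq_bigr => i _.
by rewrite (nth_map (fun=> 0)).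
Qed.

Lemma comb_spn W Ts c u : subspace W -> spn W (map (@^~ u) Ts) (comb Ts c u).
Proof.
move=> sW; apply/spnP => //; exists c.
by rewrite -comb_map subrr; case: sW.
Qed.

Lemma indep_shift W Ts u v : subspace W -> rank_indep Ts ->
  (forall c, W (comb Ts c u)) ->
  indep W (map (@^~ v) Ts) -> indep W (map (@^~ (u + v)) Ts).
Proof.
move=> sW; elim: Ts => //= T Ts IH [TL Tsi _] Wu [Tv ind]; split; last first.
  apply: IH => // c; have := Wu (fun i => if i is i'.+1 then c i' else 0).
  by rewrite /comb /= big_ord_recl /= scale0r add0r.
apply: contra_not Tv => /(spnP _ _ sW)[c].
rewrite -comb_map (linD TL) (linD (comb_lin c Tsi)) => h.
apply/(spnP _ _ sW); exists c; rewrite -comb_map.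
have Wuc : W (T u - comb Ts c u).
  have := Wu (fun i => if i is i'.+1 then - c i' else 1).
  rewrite /comb /= big_ord_recl /= scale1r; congr (W (_ + _)).
  by rewrite -sumrN; apply: eq_bigr => i _; rewrite scaleNr.
rewrite [X in W X](_ : _ = (T u + T v - (comb Ts c u + comb Ts c v)) -
   (T u - comb Ts c u)); first exact: subspaceB.
by rewrite opprD addrACA [RHS]addrC addKr.
Qed.

(* Operators that take linearly dependent values at every point (modulo a     *)
(* finite-dimensional space) have a nontrivial combination of finite rank.    *)
Lemma local_independence Ts (W : set V) : rank_indep Ts ->
  subspace W -> fdim W -> exists2 u, X u & indep W (map (@^~ u) Ts).
Proof.
elim: Ts W => [|T Ts IH] W.
  by move=> _ _ _; exists 0 => //; case: sX.
move=> /= [TL Tsi Tr] sW fW.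
apply: contrapT => /forall2NP nu.
have H u : X u -> indep W (map (@^~ u) Ts) -> spn W (map (@^~ u) Ts) (T u).
  by move=> Xu ind; case: (nu u) => // h; apply: contrapT => h'; apply: h; split.
have [u0 Xu0 ind0] := IH W Tsi sW fW.
have [c] := (spnP _ _ sW).1 (H _ Xu0 ind0); rewrite -comb_map => Wc.
(* The aim is that [T'], which sends [u0] into [W], sends all of [X] into [W]; this contradicts rank
   independence. *)
pose T' u := T u - comb Ts c u.
have T'L : is_linear T'.
  move=> a x y; rewrite /T' TL (comb_lin c Tsi) scalerBr opprD addrACA.
  by [].
have H' u : X u -> indep W (map (@^~ u) Ts) -> exists d, W (T' u - comb Ts d u).
  move=> Xu /(H u Xu)/(spnP _ _ sW)[d]; rewrite -comb_map => h.
  exists (fun i => d i - c i); rewrite -combB /T'.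
  by rewrite opprB addrA subrK.
pose W1 := spn W (map (@^~ u0) Ts).
have sW1 : subspace W1 by apply: spn_subspace.
have fdim_spns s W' : fdim W' -> fdim (spn W' s).
  by move=> fW'; apply: fdim_fcodim fW'; exists s.
(* For [v] generic relative to [u0], comparing the relations at [v] and at [u0 + v] shows that their
   coefficients agree, and the values at [u0] then force them to be 0. *)
have good v : X v -> indep W1 (map (@^~ v) Ts) -> W (T' v).
  move=> Xv ind.
  have [a Wa] := H' v Xv (indep_sub sW1 (@spn_sub _ _ W _) ind).
  have Xuv : X (u0 + v) by apply: subspaceD.
  have iuv : indep W1 (map (@^~ (u0 + v)) Ts).
    by apply: indep_shift => // d; apply: comb_spn.
  have [b] := H' (u0 + v) Xuv (indep_sub sW1 (@spn_sub _ _ W _) iuv).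
  rewrite (linD T'L) (linD (comb_lin b Tsi)) => Wb.
  have Wab : W (comb Ts (fun i => a i - b i) v - comb Ts b u0).
    rewrite -combB [X in W X](_ : _ = (T' u0 + T' v - (comb Ts b u0 + comb Ts b v))
       - T' u0 - (T' v - comb Ts a v)).
      by apply: subspaceB => //; apply: subspaceB.
    by abel.
  have abs : forall i, (i < size Ts)%N -> a i = b i.
    move=> i iTs; apply/eqP; rewrite -subr_eq0; apply/eqP.
    apply: (@indep_coef _ W1 (map (@^~ v) Ts) (fun i => a i - b i)) => //;
      last by rewrite size_map.
    rewrite -(comb_map Ts (fun i => a i - b i) v) -[comb _ _ _](subrK (comb Ts b u0)).
    by apply: subspaceD => //; [apply: spn_sub|apply: comb_spn].
  have b0 : forall i, (i < size Ts)%N -> b i = 0.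
    move=> i iTs; apply: (@indep_coef _ W (map (@^~ u0) Ts)) => //;
      last by rewrite size_map.
    rewrite -comb_map; move: Wab.
    rewrite [comb _ _ v](_ : _ = 0) ?add0r ?opprK; last first.
      by apply: big1 => k _; rewrite abs ?subrr ?scale0r.
    by move/(subspaceN sW); rewrite opprK.
  move: Wa; rewrite [comb _ _ _](_ : _ = 0) ?subr0 //.
  by apply: big1 => k _; rewrite abs ?b0 ?scale0r.
(* An arbitrary [u] is the difference of [u + v] and [v], which are both generic for a suitable
   [v]. *)
have all u : X u -> W (T' u).
  move=> Xu; have [|||v Xv iv] := IH (spn W1 (map (@^~ u) Ts)) => //.
  - exact: spn_subspace.
  - by apply/fdim_spns/fdim_spns.
  rewrite -[T' u](addrK (T' v)) -(linD T'L); apply: subspaceB => //.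
    apply: good; first exact: subspaceD.
    apply: (indep_sub _ _ (indep_shift _ Tsi _ iv)) => //.
    - exact: spn_subspace.
    - exact: spn_sub.
    - exact: spn_subspace.
    - by move=> d; apply: comb_spn.
  by apply: good => //; apply: (indep_sub _ _ iv);
    [apply: spn_subspace|apply: spn_sub].
by apply: (Tr c); apply: fdim_sub fW => _ [u Xu <-]; apply: all.
Qed.
End LocalIndependence.

(** * The augmentation and the parity automorphism of u(L) *)


Section Enveloping.
Variables (F : fieldType) (p : nat) (L : restrictedLieSuperalgebra F p).
Local Notation R := (uenv L).

Lemma uscalE a : uscal L a = a *: (1 : R).
Proof. by rewrite /GRing.scale /= /uscale umul1r. Qed.

Lemma uclassD s t : uclass (UAdd s t) = uclass s + uclass t :> R.
Proof. by rewrite -uaddE. Qed.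

Lemma uclassM s t : uclass (UMul s t) = uclass s * uclass t :> R.
Proof. by rewrite -umulE. Qed.

Lemma uin_linear : is_linear (@uin F p L : L -> R).
Proof.
move=> a x y; have /uclassP := urel_gen (L := L) a x y.
by rewrite uclassD uclassM -[uclass (UScal _ _)]/(uscal L a) uscalE -scalerAl mul1r.
Qed.

Lemma uin_br i j x y : part i x -> part j y ->
  uin (br x y) = uin x * uin y - (-1) ^+ (i && j) *: (uin y * uin x) :> R.
Proof.
move=> xi yj; have /uclassP := urel_br xi yj (L := L).
rewrite uclassD !uclassM -[uclass (UScal _ _)]/(uscal L _) uscalE.
by rewrite -scalerAl mul1r scaleNr /uin => <-.
Qed.

Lemma uclass_iter s n :
  uclass (iter n (UMul s) (UScal L 1)) = (uclass s : R) ^+ n.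
Proof. by elim: n => [|n IH]; rewrite ?iterS ?uclassM ?IH ?exprS. Qed.

Lemma uin_ppow x : part false x -> uin (ppow x) = uin x ^+ p :> R.
Proof.
move=> x0; have /uclassP := urel_ppow x0 (L := L); rewrite /uin => <-.
exact: uclass_iter.
Qed.

Lemma uenv_gen (P : set R) : (forall a, P (a *: 1)) -> (forall x, P (uin x)) ->
  (forall r s, P r -> P s -> P (r + s)) ->
  (forall r s, P r -> P s -> P (r * s)) -> forall r, P r.
Proof.
move=> P1 Pin PD PM r; rewrite -(ureprK r).
elim: (urepr r) => [x|a|s IHs t IHt|s IHs t IHt].
- exact: Pin.
- by rewrite -/(uscal _ _) uscalE.
- by rewrite uclassD; apply: PD.
- by rewrite uclassM; apply: PM.
Qed.

Definition ueps (r : R) : F^o := uaug (urepr r).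

Lemma ueps_class s : ueps (uclass s) = uaug s.
Proof. exact: (uaug_rel (uclass_repr s)). Qed.

Lemma uepsM r s : ueps (r * s) = ueps r * ueps s.
Proof. by rewrite -[r * s]umulE ?ureprK // /umul ueps_class. Qed.

Lemma ueps1 : ueps 1 = 1.
Proof. exact: ueps_class. Qed.

Lemma ueps_linear : is_linear ueps.
Proof.
move=> a r s.
have D u v : ueps (u + v) = ueps u + ueps v by rewrite -[LHS]/(ueps (uadd u v)) ueps_class.
rewrite D; congr (_ + _).
by rewrite -[r in LHS]mul1r scalerAl uepsM -uscalE ueps_class.
Qed.

Lemma ueps_in x : ueps (uin x) = 0.
Proof. exact: ueps_class. Qed.

Section Lift.
Variables (A : algType F) (phi : L -> A).
Hypothesis phiL : is_linear phi.
Hypothesis phi_br : forall i j x y, part i x -> part j y ->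
  phi (br x y) = phi x * phi y - (-1) ^+ (i && j) *: (phi y * phi x).
Hypothesis phi_ppow : forall x, part false x -> phi (ppow x) = phi x ^+ p.

Fixpoint uterm_lift (s : uterm L) : A :=
  match s with
  | UGen x => phi x
  | UScal a => a *: 1
  | UAdd s t => uterm_lift s + uterm_lift t
  | UMul s t => uterm_lift s * uterm_lift t
  end.

Lemma uterm_lift_iter s n :
  uterm_lift (iter n (UMul s) (UScal L 1)) = uterm_lift s ^+ n.
Proof. by elim: n => [|n /= ->]; rewrite ?exprS //= scale1r. Qed.

Lemma uterm_lift_rel s t : urel s t -> uterm_lift s = uterm_lift t.
Proof.
elim=> //=.
- by move=> {}s {}t r _ -> _ ->.
- by move=> ? ? ? ? _ -> _ ->.
- by move=> ? ? ? ? _ -> _ ->.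
- by move=> *; rewrite addrA.
- by move=> *; rewrite addrC.
- by move=> *; rewrite scale0r add0r.
- by move=> *; rewrite mulrA.
- by move=> *; rewrite scale1r mul1r.
- by move=> *; rewrite mulrDl.
- by move=> *; rewrite mulrDr.
- by move=> a b; rewrite scalerDl.
- by move=> a b; rewrite -scalerAl mul1r scalerA.
- by move=> a u; rewrite -scalerAl -scalerAr mul1r mulr1.
- by move=> u; rewrite !scale0r mul0r.
- by move=> a x y; rewrite phiL -scalerAl mul1r.
- by move=> i j x y xi yj; rewrite (phi_br xi yj) -scalerAl mul1r scaleNr.
- move=> x x0; rewrite phi_ppow //.
  exact: uterm_lift_iter.
Qed.

Definition ulift (r : R) : A := uterm_lift (urepr r).

Lemma ulift_class s : ulift (uclass s) = uterm_lift s.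
Proof. by apply: uterm_lift_rel; apply: uclass_repr. Qed.

Lemma uliftM r s : ulift (r * s) = ulift r * ulift s.
Proof. by rewrite -[r * s]/(umul r s) ulift_class. Qed.

Lemma ulift1 : ulift 1 = 1.
Proof. by rewrite ulift_class /= scale1r. Qed.

Lemma ulift_in x : ulift (uin x) = phi x.
Proof. exact: ulift_class. Qed.

Lemma ulift_linear : is_linear ulift.
Proof.
move=> a r s; rewrite -[_ + s]/(uadd _ s) ulift_class /=; congr (_ + _).
rewrite -[uterm_lift _]/(ulift _) -[r in LHS]mul1r scalerAl uliftM -uscalE.
by rewrite ulift_class /= -scalerAl mul1r.
Qed.

End Lift.

(** [part_sum] only asserts that the components exist, so they are chosen classically; [part_cap]
    makes them unique and the projections linear. *)
Definition lsplit (x : L) : L * L := xget (0, 0)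
  [set z : L * L | [/\ part false z.1, part true z.2 & x = z.1 + z.2]].

Definition lpart (i : bool) x := if i then (lsplit x).2 else (lsplit x).1.

Lemma lsplitP x : [/\ part false (lsplit x).1, part true (lsplit x).2
  & x = (lsplit x).1 + (lsplit x).2].
Proof.
have [x0 [x1 H]] := part_sum x.
rewrite /lsplit; case: xgetP => [_ -> //|none].
by case: (none (x0, x1)).
Qed.

Lemma lpartP i x : part i (lpart i x).
Proof. by case: (lsplitP x); case: i. Qed.

Lemma lpartD x : x = lpart false x + lpart true x.
Proof. by case: (lsplitP x). Qed.

Lemma lpart_uniq x0 x1 : part false x0 -> part true x1 ->
  lpart false (x0 + x1) = x0 /\ lpart true (x0 + x1) = x1.
Proof.
move=> p0 p1; set x := x0 + x1.
have E : lpart false x - x0 = x1 - lpart true x.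
  by rewrite -[lpart false x](addrK (lpart true x)) -lpartD /x; abel.
have D0 : part false (lpart false x - x0).
  by apply: (subspaceB (part_subspace _ _)) => //; apply: lpartP.
have D1 : part true (lpart false x - x0).
  by rewrite E; apply: (subspaceB (part_subspace _ _)) => //; apply: lpartP.
have Z := part_cap D0 D1; split; apply/eqP; first by rewrite -subr_eq0 Z.
by rewrite eq_sym -subr_eq0 -E Z.
Qed.

Lemma lpart_linear i : is_linear (lpart i).
Proof.
move=> a x y.
have [||H0 H1] := @lpart_uniq (a *: lpart false x + lpart false y)
    (a *: lpart true x + lpart true y).
- by have [_ h] := part_subspace L false; apply: h; apply: lpartP.
- by have [_ h] := part_subspace L true; apply: h; apply: lpartP.
have E : a *: x + y = a *: lpart false x + lpart false y +
   (a *: lpart true x + lpart true y).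
  by rewrite {1}(lpartD x) {1}(lpartD y) scalerDr; abel.
by rewrite E; case: i; rewrite ?H0 ?H1.
Qed.

Lemma lpart_hom i j x : part j x -> lpart i x = if i == j then x else 0.
Proof.
have P0 k : part k (0 : L) by case: (part_subspace L k).
case: j => xj.
  have [H0 H1] := lpart_uniq (P0 false) xj; rewrite add0r in H0 H1.
  by case: i.
have [H0 H1] := lpart_uniq xj (P0 true); rewrite addr0 in H0 H1.
by case: i.
Qed.

Definition ltheta (x : L) : L := lpart false x - lpart true x.

Lemma ltheta_linear : is_linear ltheta.
Proof. by move=> a x y; rewrite /ltheta !lpart_linear scalerBr; abel. Qed.

Lemma ltheta_hom i x : part i x -> ltheta x = (-1) ^+ i *: x.
Proof.
move=> xi; rewrite /ltheta !(lpart_hom _ xi).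
by case: i {xi}; rewrite /= ?sub0r ?subr0 ?scaleN1r ?scale1r.
Qed.

Definition utheta : R -> R := ulift (fun x => uin (ltheta x)).

Let phiL : is_linear (fun x => uin (ltheta x) : R).
Proof. by move=> a x y; rewrite ltheta_linear uin_linear. Qed.

Let phi_br i j x y : part i x -> part j y -> uin (ltheta (br x y)) =
  uin (ltheta x) * uin (ltheta y)
  - (-1) ^+ (i && j) *: (uin (ltheta y) * uin (ltheta x)) :> R.
Proof.
move=> xi yj; have bij := br_part xi yj.
rewrite (ltheta_hom xi) (ltheta_hom yj) (ltheta_hom bij) !(linZ uin_linear).
rewrite (uin_br xi yj) -!scalerAl -!scalerAr !scalerA scalerBr scalerA.
by congr (_ *: _ - _ *: _); case: i j {xi yj bij} => [] [] /=;
  rewrite ?(expr1, expr0, mulrN, mulNr, mulr1, opprK).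
Qed.

Let phi_ppow x : part false x -> uin (ltheta (ppow x)) = uin (ltheta x) ^+ p :> R.
Proof.
move=> x0; rewrite (ltheta_hom x0) (ltheta_hom (ppow_part x0)) !scale1r.
exact: uin_ppow.
Qed.

Lemma uthetaM r s : utheta (r * s) = utheta r * utheta s.
Proof. exact: uliftM. Qed.

Lemma utheta1 : utheta 1 = 1.
Proof. exact: ulift1. Qed.

Lemma utheta_linear : is_linear utheta.
Proof. exact: ulift_linear. Qed.

Lemma utheta_hom i x : part i x -> utheta (uin x) = (-1) ^+ i *: uin x.
Proof.
by move=> xi; rewrite /utheta ulift_in // (ltheta_hom xi) (linZ uin_linear).
Qed.

Lemma uthetaK r : utheta (utheta r) = r.
Proof.
apply: (uenv_gen (P := fun r => utheta (utheta r) = r)) r =>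
  [a|x|r s rK sK|r s rK sK].
- by rewrite !(linZ utheta_linear) !utheta1.
- have H0 := utheta_hom (lpartP false x); have H1 := utheta_hom (lpartP true x).
  rewrite (lpartD x) (linD uin_linear) (linD utheta_linear) H0 H1 scale1r scaleN1r.
  by rewrite (linD utheta_linear) (linN utheta_linear) H0 H1 scale1r scaleN1r opprK.
- by rewrite !(linD utheta_linear) rK sK.
- by rewrite !uthetaM rK sK.
Qed.

End Enveloping.

Arguments lpart {F p L} i x : simpl never.

(** * The coproduct of u(L) *)

(** The prime p divides the inner binomial coefficients. This serves both the coproduct of x ^ p and
    the Frobenius map modulo an ideal. *)
Lemma sum_binomial_pchar (F : fieldType) (V : lmodType F) p (B : nat -> V) :
  p \in [pchar F] -> \sum_(k < p.+1) 'C(p, k)%:R *: B k = B 0 + B p.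
Proof.
move=> /andP[pP /eqP p0]; rewrite big_ord_recr /= binn scale1r; congr (_ + _).
case: p pP p0 => // n pP p0; rewrite big_ord_recl /= bin0 scale1r.
rewrite big1 ?addr0 // => i _; rewrite /bump /= add1n.
have /dvdnP[m ->] : (n.+1 %| 'C(n.+1, i.+1))%N.
  by apply: prime_dvd_bin => //; case: i => i /= i_n; rewrite ltnS.
by rewrite natrM p0 mulr0 scale0r.
Qed.

Lemma pascal_sum (F : fieldType) (V : lmodType F) n (B : nat -> nat -> V) :
  \sum_(k < n.+1) 'C(n, k)%:R *: B k.+1 (n - k)%N +
  \sum_(k < n.+1) 'C(n, k)%:R *: B k (n - k).+1 =
  \sum_(k < n.+2) 'C(n.+1, k)%:R *: B k (n.+1 - k)%N.
Proof.
rewrite [RHS]big_ord_recl [X in _ + X = _]big_ord_recl /=.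
rewrite !bin0 !subn0 addrCA; congr (_ + _).
rewrite [RHS](_ : _ = \sum_(i < n.+1) 'C(n, i)%:R *: B i.+1 (n - i)%N +
  \sum_(i < n.+1) 'C(n, i.+1)%:R *: B i.+1 (n - i)%N); last first.
  rewrite -big_split; apply: eq_bigr => i _ /=.
  by rewrite /bump /= add1n subSS binS natrD scalerDl addrC.
congr (_ + _); rewrite [RHS]big_ord_recr /= bin_small // scale0r addr0.
by apply: eq_bigr => i _; rewrite /bump /= add1n -subSn.
Qed.

Section Coproduct.
Variables (F : fieldType) (p : nat) (L : restrictedLieSuperalgebra F p).
Local Notation R := (uenv L).
Variable V : lmodType F.
Implicit Types (b : R -> R -> V) (r s : R).

Definition twist (i : bool) r : R := if i then utheta r else r.

Lemma twist_linear i : is_linear (twist i).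
Proof. by case: i => //; apply: utheta_linear. Qed.

Lemma twistM i r s : twist i (r * s) = twist i r * twist i s.
Proof. by case: i => //; apply: uthetaM. Qed.

Lemma twist1 i : twist i 1 = 1.
Proof. by case: i => //; apply: utheta1. Qed.

Lemma twist_twist i j r : twist i (twist j r) = twist (i (+) j) r.
Proof. by case: i j => [] []; rewrite /= ?uthetaK. Qed.

Lemma twist_hom i j x : part j x -> twist i (uin x) = (-1) ^+ (i && j) *: uin x.
Proof. by case: i => xj; rewrite /= ?scale1r // (utheta_hom xj). Qed.

Definition bilinear_map b : Prop :=
  (forall s, is_linear (b^~ s)) /\ (forall r, is_linear (b r)).

(* u(L) acts on the bilinear maps b on the right of the two arguments, with   *)
(* x : L acting as x (x) 1 + 1 (x) x; the parity twist is the Koszul sign of  *)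
(* moving x past the second argument. So coact u b 1 1 is the value at the    *)
(* coproduct of u of the map that b induces on u(L) (x) u(L).                 *)
Fixpoint coact (u : uterm L) b r s : V :=
  match u with
  | UGen x => b (r * uin (lpart false x)) s
              + b (r * uin (lpart true x)) (utheta s) + b r (s * uin x)
  | UScal a => a *: b r s
  | UAdd u v => coact u b r s + coact v b r s
  | UMul u v => coact u (coact v b) r s
  end.

Lemma funext2 b c : (forall r s, b r s = c r s) -> b = c.
Proof. by move=> bc; apply/funext => r; apply/funext => s. Qed.

Lemma coactM u v b : coact (UMul u v) b = coact u (coact v b).
Proof. by []. Qed.

Lemma coactD u v b r s : coact (UAdd u v) b r s = coact u b r s + coact v b r s.
Proof. by []. Qed.

Lemma coactZ a b r s : coact (UScal L a) b r s = a *: b r s.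
Proof. by []. Qed.

Lemma coactL u b c (a : F) r s :
  coact u (fun r s => a *: b r s + c r s) r s = a *: coact u b r s + coact u c r s.
Proof.
elim: u b c r s => [x|d|u IHu v IHv|u IHu v IHv] b c r s /=.
- by rewrite !scalerDr; abel.
- by rewrite scalerDr !scalerA mulrC.
- by rewrite IHu IHv scalerDr; abel.
rewrite -IHu; congr (coact u _ _ _).
exact: funext2.
Qed.

Lemma coact_bil u b : bilinear_map b -> bilinear_map (coact u b).
Proof.
elim: u b => [x|d|u IHu v IHv|u IHu v IHv] b bL /=.
- have [bl br] := bL; split=> s a y z; rewrite !scalerDr.
    by rewrite !mulrDl -!scalerAl !bl; abel.
  by rewrite mulrDl -scalerAl utheta_linear !br; abel.
- have [bl br] := bL; split=> s a y z; rewrite ?bl ?br scalerDr !scalerA;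
    by rewrite mulrC.
- have [ul ur] := IHu b bL; have [vl vr] := IHv b bL.
  by split=> s a y z; rewrite ?ul ?vl ?ur ?vr scalerDr; abel.
by apply: IHu; apply: IHv.
Qed.

Lemma coact_gen i x b r s : bilinear_map b -> part i x ->
  coact (UGen x) b r s = b (r * uin x) (twist i s) + b r (s * uin x).
Proof.
move=> [bl br] xi /=; rewrite !(lpart_hom _ xi); congr (_ + _).
have z0 : uin (0 : L) = 0 :> R := lin0 (@uin_linear F p L).
by case: i {xi}; rewrite /= z0 mulr0 (lin0 (bl _)) ?add0r ?addr0.
Qed.

Lemma coact_pow x b r s n : bilinear_map b -> part false x ->
  coact (iter n (UMul (UGen x)) (UScal L 1)) b r s =
  \sum_(k < n.+1) 'C(n, k)%:R *: b (r * uin x ^+ k) (s * uin x ^+ (n - k)).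
Proof.
move=> bL x0; elim: n r s => [|n IH] r s.
  by rewrite big_ord1 /= !expr0 !mulr1 scale1r.
rewrite iterS coactM (coact_gen _ _ _ x0) /twist; last exact: coact_bil.
rewrite !IH -(pascal_sum n (fun k l => b (r * uin x ^+ k) (s * uin x ^+ l))).
by congr (_ + _); apply: eq_bigr => k _; rewrite -mulrA -exprS.
Qed.

(** This makes the coproduct well defined. In the bracket relation the Koszul signs cancel the mixed
    terms x (x) y and y (x) x; in the relation for x ^ p the mixed terms have binomial coefficients
    divisible by p. *)
Lemma coact_rel u v : urel u v ->
  forall b, bilinear_map b -> coact u b = coact v b.
Proof.
elim=> {u v}.
- by [].
- by move=> u v _ IH b bL; rewrite IH.
- by move=> u v w _ IH1 _ IH2 b bL; rewrite IH1 ?IH2.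
- by move=> u u' v v' _ IH1 _ IH2 b bL; apply: funext2 => r s /=; rewrite IH1 ?IH2.
- move=> u u' v v' _ IH1 _ IH2 b bL; apply: funext2 => r s /=; rewrite IH2 ?IH1 //.
  exact: coact_bil.
- by move=> u v w b bL; apply: funext2 => r s /=; rewrite addrA.
- by move=> u v b bL; apply: funext2 => r s /=; rewrite addrC.
- by move=> u b bL; apply: funext2 => r s /=; rewrite scale0r add0r.
- by move=> u v w b bL; apply: funext2 => r s.
- by move=> u b bL; apply: funext2 => r s /=; rewrite scale1r.
- by move=> u v w b bL; apply: funext2 => r s.
- move=> u v w b bL; apply: funext2 => r s /=.
  rewrite -[coact u (coact v b) r s]scale1r -coactL; congr (coact u _ _ _).
  by apply: funext2 => r' s' /=; rewrite scale1r.
- by move=> a a' b bL; apply: funext2 => r s /=; rewrite scalerDl.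
- by move=> a a' b bL; apply: funext2 => r s /=; rewrite scalerA.
- move=> a u b bL; apply: funext2 => r s /=.
  have Z : coact u (fun _ _ => 0) r s = 0.
    rewrite (_ : (fun _ _ => 0) = (fun r s : R => -1 *: (0 : V) + 0)).
      by rewrite coactL scaleN1r addNr.
    by apply: funext2 => r' s'; rewrite scaler0 addr0.
  rewrite -[LHS]addr0 -Z -coactL; congr (coact u _ _ _).
  by apply: funext2 => r' s'; rewrite addr0.
- by move=> u b bL; apply: funext2 => r s /=; rewrite !scale0r.
- move=> a x y b [bl br]; apply: funext2 => r s /=.
  rewrite !lpart_linear !uin_linear !mulrDr -!scalerAr !bl br !scalerDr; abel.
- move=> i j x y xi yj b bL; apply: funext2 => r s.
  have bij := br_part xi yj; have [bl br] := bL.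
  have bxL := coact_bil (UGen x) bL; have byL := coact_bil (UGen y) bL.
  rewrite (coact_gen _ _ bL bij) (uin_br xi yj).
  rewrite coactD !coactM coactZ.
  rewrite (coact_gen _ _ byL xi) (coact_gen _ _ bxL yj).
  rewrite !(coact_gen _ _ bL xi) !(coact_gen _ _ bL yj).
  rewrite !twistM !twist_twist (twist_hom _ xi) (twist_hom _ yj).
  rewrite -!scalerAr !mulrBr -!scalerAr !mulrA (linB (bl _)) (linB (br _)).
  rewrite !(linZ (bl _)) !(linZ (br _)) addbC andbC !scalerDr !scalerA.
  case: i j {xi yj bij} => [] [] /=;
    rewrite ?(expr1, expr0, mulNr, mulrN, mulr1, mul1r, opprK, scaleN1r, scale1r);
    abel.
- move=> x x0 b bL; apply: funext2 => r s;
  rewrite coact_pow // (coact_gen _ _ bL (ppow_part x0)).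
  rewrite (uin_ppow x0) /=.
  rewrite (sum_binomial_pchar (fun k => b (r * uin x ^+ k) (s * uin x ^+ (p - k)))
    (rlsa_char L)).
  by rewrite /= subnn subn0 !expr0 !mulr1 addrC.
Qed.

Definition cop b r : V := coact (urepr r) b 1 1.

Lemma cop_class b u : bilinear_map b -> cop b (uclass u) = coact u b 1 1.
Proof. by move=> bL; rewrite /cop (coact_rel (uclass_repr u)). Qed.

Lemma cop_linear b : bilinear_map b -> is_linear (cop b).
Proof.
move=> bL a r s.
have D u v : cop b (u + v) = cop b u + cop b v.
  by rewrite -[_ + _]/(uadd u v) cop_class.
rewrite D -[a *: r]/(umul (uscal L a) r) cop_class //=; congr (_ + _).
by rewrite (coact_rel (uclass_repr _)) //; apply: coact_bil.
Qed.

Fixpoint coactw (w : seq (bool * L)) b r s : V :=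
  if w is (i, x) :: w' then coactw w' b (r * uin x) (twist i s) + coactw w' b r (s * uin x)
  else b r s.

Definition wprod (w : seq (bool * L)) : R := \prod_(l <- w) uin l.2.

Lemma cop_word b w : bilinear_map b -> (forall l, l \in w -> part l.1 l.2) ->
  cop b (wprod w) = coactw w b 1 1.
Proof.
move=> bL hw; pose tw (w : seq (bool * L)) :=
  foldr (fun l u => UMul (UGen l.2) u) (UScal L 1) w.
have -> : wprod w = uclass (tw w).
  rewrite /wprod; elim: w {hw} => [|l w IH]; first by rewrite big_nil.
  by rewrite big_cons IH uclassM.
rewrite cop_class //.
have : forall r s, coact (tw w) b r s = coactw w b r s; last exact.
move=> r s.
elim: w r s hw => [|[i x] w IH] r s hw; first by rewrite /= scale1r.
have xi : part i x by apply: (hw (i, x)); rewrite mem_head.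
have hw' l : l \in w -> part l.1 l.2 by move=> lw; apply: hw; rewrite inE lw orbT.
rewrite coactM (coact_gen _ _ (coact_bil _ bL) xi).
by rewrite !IH.
Qed.

End Coproduct.

(** * Contractions *)


Section Contractions.
Variables (F : fieldType) (p : nat) (L : restrictedLieSuperalgebra F p).
Hypothesis two_neq0 : (2%:R : F) != 0.
Local Notation R := (uenv L).

Lemma cop_1 (V : lmodType F) (b : R -> R -> V) : bilinear_map b -> cop b 1 = b 1 1.
Proof. by move=> bL; rewrite cop_class //= scale1r. Qed.

Lemma cop_in (V : lmodType F) (b : R -> R -> V) x : bilinear_map b ->
  cop b (uin x) = b (uin x) 1 + b 1 (uin x).
Proof.
move=> bL; have [bl br] := bL.
have h i : cop b (uin (lpart i x)) = b (uin (lpart i x)) 1 + b 1 (uin (lpart i x)).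
  by rewrite cop_class // (coact_gen _ _ bL (lpartP i x)) !mul1r twist1.
rewrite (lpartD x) (linD (@uin_linear F p L)) (linD (cop_linear bL)).
by rewrite (linD (bl _)) (linD (br _)) !h; abel.
Qed.

Lemma cop_in2 (V : lmodType F) (b : R -> R -> V) i j x y : bilinear_map b ->
  part i x -> part j y -> cop b (uin x * uin y) =
  b (uin x * uin y) 1 + b (uin x) (uin y) + (-1) ^+ (i && j) *: b (uin y) (uin x)
  + b 1 (uin x * uin y).
Proof.
move=> bL xi yj; have [bl br] := bL.
have := @cop_word _ _ _ _ b [:: (i, x); (j, y)] bL.
rewrite /wprod !big_cons big_nil mulr1 /= => -> => [|l]; last first.
  by rewrite !inE => /orP[] /eqP ->.
rewrite !mul1r !twist1 (twist_hom _ xi) (linZ (br (uin y))) [j && i]andbC ?mul1r.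
by abel.
Qed.

Lemma comb_linear (V : lmodType F) (c h : F) (x y z t : V) :
  c *: x + y + h *: (c *: z + t) = c *: (x + h *: z) + (y + h *: t).
Proof. by rewrite !scalerDr !scalerA [h * c]mulrC; abel. Qed.

(** Brackets of two letters u are left free; counting letters v in [contractions_long] compensates
    for this. Each v occurs only once in the words considered, so that only distinct [v l], [v l']
    have to be controlled. *)
Definition contraction_data i j m (u v : nat -> L) : Prop :=
  [/\ forall k, (k < m)%N -> part j (u k) /\ part i (v k),
    forall a b : nat -> F, exists g : R -> F^o, [/\ is_linear g, g 1 = 0 &
      forall k, (k < m)%N -> g (uin (u k)) = a k /\ g (uin (v k)) = b k]
    & forall k, (k < m)%N -> exists g : R -> F^o, [/\ is_linear g, g 1 = 0,
        forall l, (l < m)%N -> g (uin (u l)) = 0 /\ g (uin (v l)) = 0,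
        forall l l', (l < m)%N -> (l' < m)%N -> l != l' ->
          g (uin (br (v l) (v l'))) = 0
      & forall l l', (l < m)%N -> (l' < m)%N ->
          g (uin (br (u l) (v l'))) = ((l == k) && (l' == k))%:R]].

Section WithData.
Variables (i j : bool) (m : nat) (u v : nat -> L).
Hypothesis D : contraction_data i j m u v.

Let uj k : (k < m)%N -> part j (u k). Proof. by case: D => h _ _ /h[]. Qed.
Let vi k : (k < m)%N -> part i (v k). Proof. by case: D => h _ _ /h[]. Qed.

Definition letter (c : bool * nat) : bool * L :=
  if c.1 then (i, v c.2) else (j, u c.2).

Definition contraction (k : nat) (g : R -> F^o) : Prop :=
  [/\ is_linear g, g 1 = 0, forall c, (c.2 < m)%N -> g (uin (letter c).2) = 0
    & forall c c', (c.2 < m)%N -> (c'.2 < m)%N -> c != c' -> c.1 || c'.1 ->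
      g (uin (letter c).2 * uin (letter c').2) =
      ((c == (false, k)) && (c' == (true, k)))%:R].

(* On products of two generators, pi - mult o (pi (x) pi) o Delta / 2 with    *)
(* pi := id - eps is half of the super commutator; adding a suitable product  *)
(* of two functionals makes it vanish on v_k u_k.                             *)
Lemma contraction_exists k : (k < m)%N -> exists g, contraction k g.
Proof.
move=> km; have [_ dual zex] := D.
have [z [zL z1 zlet zvv zuv]] := zex k km.
have [a [aL a1 alet]] := dual (fun=> 0) (fun l => (l == k)%:R).
have [b [bL b1 blet]] := dual (fun l => (l == k)%:R) (fun=> 0).
have {}alet l : (l < m)%N -> a (uin (u l)) = 0 /\ a (uin (v l)) = (l == k)%:R.
  exact: alet.
have {}blet l : (l < m)%N -> b (uin (u l)) = (l == k)%:R /\ b (uin (v l)) = 0.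
  exact: blet.
pose pi (r : R) : R := r - (ueps r : F) *: 1.
have piL : is_linear pi.
  by move=> c r s; rewrite /pi ueps_linear scalerDl -[(c *: ueps r) *: _]scalerA scalerBr; abel.
pose b1' (r s : R) : R := pi r * pi s.
have b1L : bilinear_map b1'.
  split=> s c r t; rewrite /b1' piL.
    by rewrite (mulrDl (c *: pi r) (pi t) (pi s)) -(scalerAl c (pi r) (pi s)).
  by rewrite (mulrDr (pi s) (c *: pi r) (pi t)) -(scalerAr c (pi s) (pi r)).
pose b2 (r s : R) : F^o := a r * b s.
have b2L : bilinear_map b2.
  split=> s c r t; rewrite /b2.
    by rewrite aL mulrDl -scalerAl.
  by rewrite bL mulrDr -scalerAr.
pose s : F := (-1) ^+ (i && j).
pose E (r : R) : R := pi r + (- 2%:R^-1) *: cop b1' r.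
have EL : is_linear E.
  by move=> c r t; rewrite /E piL (cop_linear b1L) comb_linear.
have pi1 : pi 1 = 0 by rewrite /pi ueps1 scale1r subrr.
have pix x : pi (uin x) = uin x by rewrite /pi ueps_in scale0r subr0.
have E1 : E 1 = 0 by rewrite /E cop_1 // /b1' pi1 mul0r scaler0 addr0.
have Ein x : E (uin x) = uin x.
  by rewrite /E cop_in // /b1' pi1 mul0r mulr0 addr0 scaler0 addr0 pix.
have Ein2 i' j' x y : part i' x -> part j' y ->
    E (uin x * uin y) = 2%:R^-1 *: uin (br x y).
  move=> xi yj; rewrite /E (cop_in2 b1L xi yj) /b1' pi1 mul0r mulr0 addr0 add0r !pix.
  rewrite /pi uepsM !ueps_in mul0r scale0r subr0 (uin_br xi yj).
  rewrite -{1}[uin x * _]scale1r -{1}(mulVf two_neq0) mulr_natr scalerBr scaleNr.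
  rewrite mulr2n !scalerDl !scalerDr; abel.
(* On u_k v_k both summands equal 1/2; on v_k u_k they equal -s/2 and s/2. This dictates the
   coefficient s/2. *)
pose g r : F^o := z (E r) + (2%:R^-1 * s) *: cop b2 r.
have gL : is_linear g.
  by move=> c r t; rewrite /g EL zL (cop_linear b2L) comb_linear.
exists g; split=> //.
- by rewrite /g E1 (lin0 zL) cop_1 // /b2 a1 mul0r scaler0 addr0.
- move=> [c l] /= lm; rewrite /g Ein cop_in // /b2 a1 b1 mulr0 mul0r addr0 scaler0 addr0.
  by have [zu zv] := zlet l lm; case: c.
have g2 i' j' x y : part i' x -> part j' y -> g (uin x * uin y) =
   2%:R^-1 * z (uin (br x y)) + 2%:R^-1 * s *
     (a (uin x) * b (uin y) + (-1) ^+ (i' && j') * (a (uin y) * b (uin x))).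
  move=> xi yj; rewrite /g (Ein2 _ _ _ _ xi yj) (linZ zL) (cop_in2 b2L xi yj).
  by rewrite /b2 a1 b1 mulr0 mul0r addr0 add0r.
have half2 (x : F) : 2%:R^-1 * x + 2%:R^-1 * x = x.
  by rewrite -mulrDl -mulr2n -(mulr_natr 2%:R^-1) mulVf // mul1r.
case=> [[] l] [[] l'] //= lm l'm ll' _; rewrite /letter /=.
- rewrite (g2 _ _ _ _ (vi lm) (vi l'm)) zvv //.
  have [_ al] := alet l lm; have [_ al'] := alet l' l'm.
  have [_ bl] := blet l lm; have [_ bl'] := blet l' l'm.
  by rewrite bl bl' !(mulr0, addr0).
- rewrite (g2 _ _ _ _ (vi lm) (uj l'm)).
  have [_ al] := alet l lm; have [al' _] := alet l' l'm.
  have [_ bl] := blet l lm; have [bl' _] := blet l' l'm.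
  rewrite al al' bl bl' mul0r mulr0 addr0 (br_anticomm (vi lm) (uj l'm)).
  rewrite (linN (@uin_linear F p L)) (linZ (@uin_linear F p L)) (linN zL) (linZ zL) zuv //.
  rewrite -/s -[s *: _]/(s * _).
  by case: (l == k); case: (l' == k);
    rewrite /= ?(mulr0, mulr1, oppr0, addr0) // mulrN addNr.
- rewrite (g2 _ _ _ _ (uj lm) (vi l'm)) zuv //.
  have [al _] := alet l lm; have [_ al'] := alet l' l'm.
  have [bl _] := blet l lm; have [_ bl'] := blet l' l'm.
  rewrite al al' bl bl' mul0r add0r [j && i]andbC -/s.
  rewrite mulrA -[_ * s * s]mulrA -expr2 sqrr_sign mulr1.
  rewrite -[RHS]half2 !xpair_eqE /=; congr (_ + _ * _).
  by case: (l == k); case: (l' == k); rewrite /= ?(mulr0, mulr1).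
Qed.

End WithData.
End Contractions.

(** * Composing contractions on words in the letters u_k, v_k *)

Section IteratedContractions.
Variables (F : fieldType) (p : nat) (L : restrictedLieSuperalgebra F p).
Local Notation R := (uenv L).

(* (id (x) g) o Delta                                                         *)
Definition contract (g : R -> F^o) (r : R) : R := cop (fun r s => (g s : F) *: r) r.

Lemma contract_bil (g : R -> F^o) : is_linear g ->
  bilinear_map (fun r s : R => (g s : F) *: r).
Proof.
move=> gL; split=> s a x y; first by rewrite scalerDr !scalerA mulrC.
by rewrite gL scalerDl; congr (_ + _); rewrite -[LHS]/((a * g x) *: (s : R)) scalerA.
Qed.

Lemma contract_linear g : is_linear g -> is_linear (contract g).
Proof. by move=> gL; apply/cop_linear/contract_bil. Qed.

Variables (i j : bool) (m : nat) (u v : nat -> L).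
Hypothesis uj : forall k, (k < m)%N -> part j (u k).
Hypothesis vi : forall k, (k < m)%N -> part i (v k).
Local Notation letter := (letter i j u v).

Definition word (w : seq (bool * nat)) : R := wprod (map letter w).

Lemma word0 : word [::] = 1.
Proof. exact: big_nil. Qed.

Lemma word_cat w w' : word (w ++ w') = word w * word w'.
Proof. by rewrite /word /wprod map_cat big_cat. Qed.

Lemma word_rcons w x : word (rcons w x) = word w * uin (letter x).2.
Proof. by rewrite -cats1 word_cat /word /wprod /= big_seq1. Qed.

Lemma word1 x : word [:: x] = uin (letter x).2.
Proof. exact: big_seq1. Qed.

Lemma word2 x y : word [:: x; y] = uin (letter x).2 * uin (letter y).2.
Proof. by rewrite -[[:: x; y]]/(rcons [:: x] y) word_rcons word1. Qed.

Definition bounded (w : seq (bool * nat)) := all (fun c => c.2 < m)%N w.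

Lemma letterP c : (c.2 < m)%N -> part (letter c).1 (letter c).2.
Proof. by case: c => [[] k] /= km; [apply: vi|apply: uj]. Qed.

Lemma twist_word t w : bounded w -> exists e : F, twist t (word w) = e *: word w.
Proof.
elim/last_ind: w => [|w x IH]; first by exists 1; rewrite word0 twist1 scale1r.
rewrite /bounded all_rcons => /andP[xm /IH[e E]].
rewrite word_rcons twistM E (twist_hom _ (letterP xm)).
by eexists; rewrite -scalerAl -scalerAr scalerA.
Qed.

Lemma contract_word g w : is_linear g -> bounded w ->
  contract g (word w) = coactw (map letter w) (fun r s => (g s : F) *: r) 1 1.
Proof.
move=> gL wb; rewrite /contract cop_word //; first exact: contract_bil.
by move=> _ /mapP[c cw ->]; apply: letterP; apply: (allP wb).
Qed.

Lemma coactw_cons (V : lmodType F) l w (b : R -> R -> V) r s :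
  coactw (l :: w) b r s =
  coactw w b (r * uin l.2) (twist l.1 s) + coactw w b r (s * uin l.2).
Proof. by case: l. Qed.

(** The coproduct distributes the letters of [w], in order, over its two sides: [w1] joins [c] in
    the slot of [g], [w2] joins the word [a] that is kept. A nonzero value comes from some
    distribution with both factors nonzero; the scalar [e] absorbs the signs of the parity
    twists. *)
Lemma coactw_support (P g : R -> F^o) w a c e : is_linear P -> is_linear g ->
    bounded w -> bounded c ->
    P (coactw (map letter w) (fun r s => (g s : F) *: r) (word a) (e *: word c)) != 0 ->
  exists w1 w2 : seq (bool * nat), [/\ perm_eq (w1 ++ w2) w, subseq w1 w, subseq w2 w,
    g (word (c ++ w1)) != 0 & P (word (a ++ w2)) != 0].
Proof.
move=> PL gL; elim: w a c e => [|x w IH] a c e.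
  move=> _ _ /= h; exists [::], [::]; rewrite !cats0; split=> //.
    by apply: contraNneq h => gc; rewrite (linZ gL) gc scaler0 scale0r (lin0 PL).
  by apply: contraNneq h => Pa; rewrite (linZ PL) Pa scaler0.
move=> /andP[xm wb] cb; rewrite map_cons coactw_cons (linD PL).
set X := P (coactw _ _ (word a * _) _).
have [->|h1 _] := eqVneq X 0; last first.
  move: h1; rewrite /X; have [e' E] := twist_word (letter x).1 cb.
  rewrite (linZ (@twist_linear _ _ _ _)) E scalerA -word_rcons => /IH [//|//|w1 [w2]].
  case=> [pw sw1 sw2 gw Pw]; exists w1, (x :: w2); split=> //.
  - by rewrite -[x :: w2]cat1s perm_catCA /= perm_cons.
  - exact: subseq_trans sw1 (subseq_cons _ _).
  - by rewrite /= eqxx.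
  - by rewrite -cat_rcons.
rewrite add0r -scalerAl -word_rcons => /IH[//||w1 [w2]].
  by rewrite /bounded all_rcons xm.
case=> [pw sw1 sw2 gw Pw]; exists (x :: w1), w2; split=> //.
- by rewrite /= perm_cons.
- by rewrite /= eqxx.
- exact: subseq_trans sw2 (subseq_cons _ _).
- by rewrite -cat_rcons.
Qed.

Variable z : nat -> R -> F^o.
Hypothesis zP : forall k, (k < m)%N -> contraction i j m u v k (z k).

Fixpoint contractions (k : nat) (r : R) : F^o :=
  if k is k'.+1 then contractions k' (contract (z k') r) else ueps r.

Lemma contractions_linear k : (k <= m)%N -> is_linear (contractions k).
Proof.
elim: k => [_|k IH km a x y]; first exact: ueps_linear.
have [zL _ _ _] := zP km.
by rewrite /= (contract_linear zL) (IH (ltnW km)).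
Qed.

Lemma contraction_size k w : (k < m)%N -> bounded w -> z k (word w) != 0 ->
  (2 <= size w)%N.
Proof.
move=> km; have [_ z1 zl _] := zP km.
case: w => [|x [|y w]] //; first by rewrite word0 z1 eqxx.
by rewrite word1 /= andbT => xm; rewrite zl ?eqxx.
Qed.

Lemma bounded_subseq w w' : subseq w w' -> bounded w' -> bounded w.
Proof. by move=> sw /allP h; apply/allP => x /(mem_subseq sw)/h. Qed.

Lemma contractions_support k w a c : (k < m)%N -> bounded w -> bounded c ->
    contractions k (coactw (map letter w) (fun r s => (z k s : F) *: r)
      (word a) (word c)) != 0 ->
  exists w1 w2 : seq (bool * nat), [/\ perm_eq (w1 ++ w2) w, subseq w1 w, subseq w2 w,
    z k (word (c ++ w1)) != 0 & contractions k (word (a ++ w2)) != 0].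
Proof.
move=> km wb cb h; apply: (@coactw_support _ _ w a c 1) => //.
- exact: contractions_linear (ltnW km).
- by case: (zP km).
- by rewrite scale1r.
Qed.

Lemma contractions_short k w : (k <= m)%N -> bounded w -> (size w < k.*2)%N ->
  contractions k (word w) = 0.
Proof.
elim: k w => // k IH w km wb sw; apply/eqP/negPn/negP => /=.
have [zL _ _ _] := zP km.
rewrite (contract_word zL wb) -word0.
move=> /(@contractions_support _ _ _ [::] km wb isT)[w1 [w2 [pw s1 s2 z1]]].
rewrite IH ?eqxx //; first exact: ltnW.
  exact: bounded_subseq wb.
have : (1 < size w1)%N := contraction_size km (bounded_subseq s1 wb) z1.
have : size (w1 ++ w2) = size w := perm_size pw; rewrite size_cat /=.
by clear - sw; lia.
Qed.

Definition isv (c : bool * nat) := c.1.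

(* Each contraction consumes two letters; k letters v can only be consumed in *)
(* k pairs u_l v_l, occurring in this order.                                  *)
Lemma contractions_long k w : (k <= m)%N -> bounded w -> uniq w ->
  size w = k.*2 -> (k <= count isv w)%N -> contractions k (word w) != 0 ->
  count isv w = k /\
  forall l, (l < k)%N -> subseq [:: (false, l); (true, l)] w.
Proof.
elim: k w => [|k IH] w.
  by move=> _ _ _ /size0nil->.
move=> km wb uw sw cw /=; have [zL _ _ z2] := zP km.
rewrite (contract_word zL wb) -word0.
move=> /(@contractions_support _ _ _ [::] km wb isT)[w1 [w2 [pw s1 s2 z1 c2]]].
have b1 := bounded_subseq s1 wb; have b2 := bounded_subseq s2 wb.
have := contraction_size km b1 z1.
have sz : (size w1 + size w2 = k.*2.+2)%N by rewrite -size_cat (perm_size pw).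
have cnt : (count isv w1 + count isv w2 = count isv w)%N.
  by rewrite -count_cat; apply/permP.
have u2 : uniq w2 by apply: subseq_uniq uw.
have : (k.*2 <= size w2)%N.
  rewrite leqNgt; apply/negP => h.
  by move: c2; rewrite /= contractions_short ?eqxx // ltnW.
move=> ge2 /= ge1.
have size1 : size w1 = 2 by clear - sz ge1 ge2; lia.
have size2 : size w2 = k.*2 by clear - sz size1; lia.
have u1 : uniq w1 by apply: subseq_uniq uw.
case: w1 size1 {ge1} pw s1 z1 b1 u1 sz cnt => [|x [|y []]] //= _ pw s1.
rewrite word2 andbT inE => z1 /andP[xm ym] /andP[xy _] _ cnt.
have IH2 := IH w2 (ltnW km) b2 u2 size2.
have [xyv|] := boolP (x.1 || y.1); last first.
  rewrite negb_or => /andP[xf yf].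
  have ex : isv x = false by apply: negPf.
  have ey : isv y = false by apply: negPf.
  rewrite ex ey in cnt; have [||c2k _] := IH2 => //; first by clear - cnt cw; lia.
  by clear - c2k cnt cw; lia.
move: z1; rewrite z2 //.
case: andP => [[/eqP Ex /eqP Ey] _|_]; last by rewrite eqxx.
rewrite Ex Ey /= in cnt s1 *.
have [||c2k h2] := IH2 => //; first by clear - cnt cw; lia.
split=> [|l]; first by rewrite -cnt c2k.
rewrite ltnS leq_eqVlt => /predU1P[->//|lk].
exact: subseq_trans (h2 l lk) s2.
Qed.

Definition word_uv k : seq (bool * nat) :=
  flatten [seq [:: (false, l); (true, l)] | l <- iota 0 k].

Lemma word_uvS k : word_uv k.+1 = word_uv k ++ [:: (false, k); (true, k)].
Proof. by rewrite /word_uv -addn1 iotaD map_cat flatten_cat. Qed.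

Lemma mem_word_uv k c : (c \in word_uv k) = (c.2 < k)%N.
Proof.
elim: k => [|k IH]; first by rewrite in_nil.
rewrite word_uvS mem_cat IH !inE ltnS [RHS]leq_eqVlt [RHS]orbC.
by case: c {IH} => [[] l]; rewrite !xpair_eqE /= ?orbF.
Qed.

Lemma word_uv_uniq k : uniq (word_uv k).
Proof.
elim: k => // k IH; rewrite word_uvS cat_uniq IH /= orbF !mem_word_uv /= ltnn.
by [].
Qed.

Lemma word_uv_size k : size (word_uv k) = k.*2.
Proof. by elim: k => // k IH; rewrite word_uvS size_cat IH addn2. Qed.

Lemma word_uv_count k : count isv (word_uv k) = k.
Proof. by elim: k => // k IH; rewrite word_uvS count_cat IH addn1. Qed.

Lemma word_uv_bounded k : (k <= m)%N -> bounded (word_uv k).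
Proof. by move=> km; apply/allP => c; rewrite mem_word_uv => /leq_trans; apply. Qed.

Lemma contractions_uv k : (k <= m)%N -> contractions k (word (word_uv k)) = 1.
Proof.
elim: k => [_|k IH km]; first by rewrite word0; apply: ueps1.
have [zL z1 zl z2] := zP km; have cL := contractions_linear (ltnW km).
have wb := word_uv_bounded km.
rewrite /= (contract_word zL wb).
pose t := [:: (false, k); (true, k)].
(* No letter before the final pair can enter the slot of [z k]: a second letter would join it, and
   as the first is not u_k, both would have to be letters u. That leaves k + 1 letters v for k
   contractions, against [contractions_long]. *)
have skip w a : perm_eq (a ++ w ++ t) (word_uv k.+1) ->
    contractions k (coactw (map letter (w ++ t)) (fun r s => (z k s : F) *: r) (word a) 1)
    = contractions k (coactw (map letter t) (fun r s => (z k s : F) *: r) (word (a ++ w)) 1).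
  elim: w a => [|x w IHw] a pw; first by rewrite cats0.
  rewrite cat_cons map_cons coactw_cons twist1 mul1r (linD cL) -word_rcons.
  rewrite IHw ?cat_rcons // -[RHS]addr0; congr (_ + _).
  apply/eqP/negPn/negP; rewrite -word1.
  have bt c : c \in a ++ (x :: w) ++ t -> (c.2 < m)%N.
    by rewrite (perm_mem pw) => /(allP wb).
  have xm : (x.2 < m)%N by apply: bt; rewrite !mem_cat mem_head orbT.
  move=> /(@contractions_support _ _ _ _ km)[||w1 [w2 [pw12 s1 s2 zx]]].
  - by apply/allP => c cwt; apply: bt; rewrite mem_cat inE cwt !orbT.
  - by rewrite /bounded /= xm.
  move=> c2.
  have bx : bounded (x :: w1).
    apply/allP => c; rewrite inE => /predU1P[->//|/(mem_subseq s1) cw].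
    by apply: bt; rewrite mem_cat inE cw !orbT.
  have b2 : bounded (a ++ w2).
    apply/allP => c; rewrite mem_cat => /orP[ca|/(mem_subseq s2) cw].
      by apply: bt; rewrite mem_cat ca.
    by apply: bt; rewrite mem_cat inE cw !orbT.
  have ge1 := contraction_size km bx zx.
  have ge2 : (k.*2 <= size (a ++ w2))%N.
    rewrite leqNgt; apply/negP => h.
    by move: c2; rewrite contractions_short ?eqxx // ltnW.
  have pall : perm_eq (a ++ (x :: w1) ++ w2) (word_uv k.+1).
    by apply: perm_trans pw; rewrite perm_cat2l /= perm_cons.
  have sz : (size (a ++ w2) + (size w1).+1 = k.*2.+2)%N.
    have := perm_size pall; rewrite word_uv_size !size_cat /=; clear; lia.
  have {sz ge1} [size1 size2] : size w1 = 1 /\ size (a ++ w2) = k.*2.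
    by rewrite /= in ge1; clear - sz ge1 ge2; lia.
  have upw : uniq (a ++ (x :: w1) ++ w2) by rewrite (perm_uniq pall) word_uv_uniq.
  have u2 : uniq (a ++ w2).
    apply: subseq_uniq upw; apply: cat_subseq => //; exact: suffix_subseq.
  have := upw; rewrite cat_uniq => /and3P[_ _].
  rewrite cat_uniq => /and3P[ux _ _].
  have cnt : (count isv (a ++ w2) + count isv (x :: w1) = k.+1)%N.
    rewrite -(word_uv_count k.+1) -(permP pall) !count_cat.
    by rewrite -addnA [(count _ w2 + _)%N]addnC.
  have xfm : x != (false, k).
    have : uniq (a ++ (x :: w) ++ t) by rewrite (perm_uniq pw) word_uv_uniq.
    rewrite catA cat_uniq => /and3P[_ /hasPn h _].
    apply/eqP => Ex; have := h (false, k); rewrite mem_head => /(_ isT).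
    by rewrite -Ex mem_cat mem_head orbT.
  case: w1 size1 zx bx ux cnt {pw12 s1 pall upw} => [|y []] //= _.
  rewrite word2 inE => zx /and3P[_ ym _] /andP[xy _] cnt.
  have := zx; have [xyv|] := boolP (x.1 || y.1).
    by rewrite z2 // (negPf xfm) eqxx.
  rewrite negb_or => /andP[xf yf] _.
  have ex : isv x = false by apply: negPf.
  have ey : isv y = false by apply: negPf.
  rewrite ex ey in cnt.
  have [|c2k _] := contractions_long (ltnW km) b2 u2 size2 _ c2.
    by clear - cnt; lia.
  by clear - cnt c2k; lia.
have := skip (word_uv k) [::]; rewrite word0 -word_uvS => -> //=.
have g0 (e : F) : z k (e *: (1 : R)) = 0 by rewrite (linZ zL) z1 scaler0.
have gu : z k (uin (u k)) = 0 by exact: (zl (false, k) km).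
have gv : z k (uin (v k)) = 0 by exact: (zl (true, k) km).
have guv : z k (uin (u k) * uin (v k)) = 1.
  by have := z2 (false, k) (true, k) km km isT isT; rewrite !eqxx.
rewrite !twist1 !mul1r z1 gv (twist_hom _ (uj km)) (linZ zL) gu guv.
by rewrite !(scale0r, scaler0, add0r) scale1r IH // ltnW.
Qed.

End IteratedContractions.

(** * Multilinear identities *)


Section Polarization.
Variables (F : fieldType) (A : algType F).
Hypothesis two_neq0 : (2%:R : F) != 0.

(* Inclusion-exclusion; the complement of B is toggled at a point k0 missed   *)
(* by the map, and 2 is invertible.                                           *)
Lemma signed_sum_covering n N (c : {ffun 'I_N -> 'I_n}) :
  \sum_(B : {set 'I_n}) (-1) ^+ #|~: B| * ([forall l, c l \in B])%:R =
  ([forall k, exists l, c l == k])%:R :> F.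
Proof.
have [/forallP cov|] := boolP [forall k, exists l, c l == k].
  rewrite (bigD1 (finset.setTfor 'I_n)) //= finset.setCT cards0 expr0 mul1r big1 ?addr0.
    by case: forallP => // h; case: h => l; rewrite finset.in_setT.
  move=> B BT; case: forallP => [h|]; last by rewrite mulr0.
  case/eqP: BT; apply/setP => k; rewrite finset.in_setT.
  by have /existsP[l /eqP <-] := cov k; apply: h.
rewrite negb_forall => /existsP[k0]; rewrite negb_exists => /forallP k0P.
set S := \sum_B _.
pose t (B : {set 'I_n}) := if k0 \in B then B :\ k0 else k0 |: B.
have tK : involutive t.
  move=> B; rewrite /t; have [kB|kB] := boolP (k0 \in B).
    by rewrite !inE eqxx /= finset.setD1K.
  by rewrite !inE eqxx /= finset.setU1K.
have /eqP : S = - S.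
  rewrite /S [LHS](reindex_inj (can_inj tK)) -sumrN; apply: eq_bigr => B _.
  have -> : [forall l, c l \in t B] = [forall l, c l \in B].
    apply: eq_forallb => l; rewrite /t; case: ifP => _; rewrite !inE.
      by rewrite k0P.
    by rewrite (negPf (k0P l)).
  rewrite -mulNr; congr (_ * _).
  rewrite /t; case: ifP => kB.
    by rewrite finset.setCD finset.setUC cardsU1 !inE kB /= exprS mulN1r.
  have -> : ~: B = k0 |: ~: (k0 |: B).
    by apply/setP => k; rewrite !inE; case: eqP => // ->; rewrite kB.
  by rewrite cardsU1 !inE eqxx /= exprS mulN1r opprK.
rewrite -addr_eq0 -mulr2n -(mulr_natr S) mulf_eq0 (negPf two_neq0) orbF => /eqP ->.
by [].
Qed.

(** Each product expands over the maps c from positions to indices, and by [signed_sum_covering] the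
    signs cancel the maps that are not onto. *)
Lemma polarized_word n N (s : 'I_n -> nat) (t : N.-tuple nat) (Y : 'I_n -> A) :
  \sum_(B : {set 'I_n}) (-1) ^+ #|~: B| *:
    \prod_(x <- t) \sum_(k in B | s k == x) Y k =
  \sum_(c : {ffun 'I_N -> 'I_n} |
      [forall k, exists l, c l == k] && [forall l, s (c l) == tnth t l])
    \prod_l Y (c l).
Proof.
transitivity (\sum_(B : {set 'I_n}) \sum_(c : {ffun 'I_N -> 'I_n})
   ((-1) ^+ #|~: B| * ([forall l, c l \in B])%:R * ([forall l, s (c l) == tnth t l])%:R)
   *: \prod_l Y (c l)).
  apply: eq_bigr => B _; rewrite big_tuple.
  under eq_bigr do rewrite big_mkcond /=.
  rewrite bigA_distr_bigA scaler_sumr; apply: eq_bigr => c _ /=.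
  rewrite -mulrA -scalerA; congr (_ *: _).
  rewrite (eq_bigr (fun l => ((c l \in B)%:R * (s (c l) == tnth t l)%:R : F) *: Y (c l)));
    last first.
    move=> l _; case: (c l \in B); case: (s (c l) == tnth t l);
    by rewrite /= ?(mulr0, mul0r, mulr1, scale0r, scale1r).
  rewrite scaler_prod.
  rewrite big_split /=; congr (_ *: _).
  have prodb (P : pred 'I_N) : \prod_l (P l)%:R = [forall l, P l]%:R :> F.
    have [/forallP h|] := boolP [forall l, P l]; first by rewrite big1 // => l _;
      rewrite h.
    rewrite negb_forall => /existsP[l /negPf Pl]; apply/eqP/prodf_eq0.
    by exists l; rewrite // Pl.
  by rewrite !prodb.
rewrite exchange_big /= [RHS]big_mkcond /=; apply: eq_bigr => c _.
rewrite -scaler_suml -mulr_suml signed_sum_covering -natrM mulnb.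
by case: ifP; rewrite ?scale1r ?scale0r.
Qed.


Lemma covering_inj n (c : {ffun 'I_n -> 'I_n}) :
  [forall k, exists l, c l == k] = injectiveb c.
Proof.
apply/forallP/injectiveP => [cov|ci k].
  have /image_injP ci : #|image_mem c (mem 'I_n)| == #|'I_n|.
    rewrite eqn_leq leq_image_card /=; apply/subset_leq_card.
    by apply/fintype.subsetP => k _; have /existsP[l /eqP <-] := cov k;
      apply/fintype.imageP; exists l.
  by move=> x y; apply: ci.
have /codomP[l ->] : k \in codom c by rewrite (inj_card_onto ci).
by apply/existsP; exists l.
Qed.

Lemma covering_size n N (c : {ffun 'I_N -> 'I_n}) :
  [forall k, exists l, c l == k] -> (n <= N)%N.
Proof.
move=> /forallP cov; rewrite -{1}(card_ord n) -[X in (_ <= X)%N](card_ord N).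
apply: leq_trans (leq_image_card c 'I_N); apply/subset_leq_card.
by apply/fintype.subsetP => k _; have /existsP[l /eqP <-] := cov k;
  apply/fintype.imageP; exists l.
Qed.

(* Take a longest monomial X_{s 0} ... X_{s (n-1)} of the identity, put       *)
(* X_i := \sum_(s k = i) Y_k, and extract the part in which every Y_k occurs. *)
Lemma multilinear_identity : satisfies_PI A ->
  exists n (b : {ffun 'I_n -> 'I_n} -> F), b [ffun k => k] != 0 /\
    forall Y : 'I_n -> A,
      \sum_(c : {ffun 'I_n -> 'I_n} | injectiveb c) b c *: \prod_l Y (c l) = 0.
Proof.
move=> [f [[w1 fw1] fE]].
have [w fw maxw] : exists2 w, f w != 0 & forall w',
  f w' != 0 -> (size w' <= size w)%N.
  pose P n := has (fun w => size w == n) (finsupp f).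
  have exP : exists n, P n.
    by exists (size w1); apply/hasP; exists w1; rewrite // mem_finsupp.
  have ubP n : P n -> (n <= \max_(w <- finsupp f) size w)%N.
    by move=> /hasP[w' w'f /eqP <-]; apply: leq_bigmax_seq.
  case: (ex_maxnP exP ubP) => n /hasP[w wf /eqP <-] maxn; exists w.
    by rewrite -mem_finsupp.
  by move=> w' fw'; apply: maxn; apply/hasP; exists w'; rewrite // mem_finsupp.
pose n := size w; pose s (k : 'I_n) := nth 0%N w k.
pose ws (c : {ffun 'I_n -> 'I_n}) := [seq s (c l) | l <- enum 'I_n].
exists n, (fun c => f (ws c)); split.
  rewrite /ws; under eq_map do rewrite ffunE.
  rewrite (_ : map s _ = w) //.
  by rewrite -[RHS](mkseq_nth 0%N) /mkseq -val_enum_ord -map_comp.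
move=> Y.
have word_part w' : (size w' <= n)%N ->
  \sum_(B : {set 'I_n}) (-1) ^+ #|~: B| *:
    \prod_(x <- w') \sum_(k in B | s k == x) Y k =
  \sum_(c : {ffun 'I_n -> 'I_n} | injectiveb c && (ws c == w')) \prod_l Y (c l).
  rewrite leq_eqVlt => /orP[sw|sw].
    rewrite -[w']/(tval (Tuple sw)) polarized_word; apply: eq_bigl => c.
    rewrite covering_inj; congr (_ && _); apply/forallP/eqP => [h|E l].
      rewrite -[RHS](map_tnth_enum (Tuple sw)).
      by apply: eq_map => l; apply/eqP.
    have {}E : ws c = w' by [].
    by rewrite (tnth_nth 0%N) /= -E (nth_map l) ?size_enum_ord // nth_ord_enum.
  rewrite -[w' in LHS]/(tval (in_tuple w')) polarized_word !big_pred0 // => c.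
    apply/negP => /andP[_ /eqP E]; move: sw.
    by rewrite -E size_map size_enum_ord ltnn.
  by apply/negP => /andP[/covering_size]; rewrite leqNgt sw.
transitivity (\sum_(B : {set 'I_n}) (-1) ^+ #|~: B| *:
   nceval f (fun x => \sum_(k in B | s k == x) Y k)); last first.
  by apply: big1 => B _; rewrite fE scaler0.
rewrite /nceval; under [RHS]eq_bigr do rewrite scaler_sumr.
rewrite exchange_big /=.
transitivity (\sum_(w' <- finsupp f) f w' *:
  \sum_(c : {ffun 'I_n -> 'I_n} | injectiveb c && (ws c == w')) \prod_l Y (c l)).
  under [RHS]eq_bigr do rewrite scaler_sumr big_mkcondr.
  rewrite exchange_big /=; apply: eq_bigr => c ci.
  have [wf|wf] := boolP (ws c \in finsupp f); last first.
    rewrite fsfun_dflt // scale0r big1_seq // => w' /andP[_ w'f].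
    by case: eqP => // E; rewrite E w'f in wf.
  rewrite (bigD1_seq (ws c)) //=; last exact: fset_uniq.
  rewrite ifT; last exact/eqP; rewrite [X in _ + X]big1 ?addr0 // => w' /eqP wn.
  by rewrite ifF //; apply/eqP => E; apply: wn.
rewrite !big_seq; apply: eq_bigr => w' w'f.
rewrite -word_part; last by apply: maxw; rewrite -mem_finsupp.
rewrite scaler_sumr; apply: eq_bigr => B _.
by rewrite !scalerA mulrC.
Qed.

End Polarization.

Lemma increasing_index_iota n (t : seq nat) : perm_eq t (iota 0 n) ->
  (forall k, (k.+1 < n)%N -> (index k t < index k.+1 t)%N) -> t = iota 0 n.
Proof.
move=> pt incr.
have st : size t = n by rewrite (perm_size pt) size_iota.
have mt k : (k \in t) = (k < n)%N by rewrite (perm_mem pt) mem_iota.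
have lo k : (k < n)%N -> (k <= index k t)%N.
  elim: k => // k IH kn; apply: leq_ltn_trans (incr k kn); apply: IH; exact: ltnW.
have hi d k : (k + d).+1 = n -> (index k t + d < n)%N.
  elim: d k => [|d IH] k kd.
    by rewrite addn0 -st index_mem mt -kd addn0.
  have := IH k.+1; rewrite addSnnS => /(_ kd); apply: leq_ltn_trans.
  by rewrite addnS -addSn leq_add2r; apply: incr; rewrite -kd addnS !ltnS leq_addr.
apply: (@eq_from_nth _ 0%N); first by rewrite st size_iota.
move=> k; rewrite st => kn; rewrite nth_iota // add0n.
have ik : index k t = k.
  have := lo k kn; have := hi (n.-1 - k)%N k; clear -kn; lia.
by rewrite -{1}ik nth_index // mt.
Qed.

(** * A polynomial identity bounds the length of contraction data *)

Section PolynomialIdentity.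
Variables (F : fieldType) (p : nat) (L : restrictedLieSuperalgebra F p).
Hypothesis two_neq0 : (2%:R : F) != 0.
Local Notation R := (uenv L).

(* The letters of the monomials u_0, v_0 u_1, ..., v_{m-2} u_{m-1}, v_{m-1}   *)
(* that are substituted into the multilinear identity.                        *)
Definition letters m k : seq (bool * nat) :=
  (if k is k'.+1 then [:: (true, k')] else [::]) ++
  (if (k < m)%N then [:: (false, k)] else [::]).

Lemma mem_letters_u m k l : ((false, l) \in letters m k) = (l == k) && (k < m)%N.
Proof.
by rewrite mem_cat; case: k => [|k]; case: ifP => _; rewrite !inE ?andbT ?andbF.
Qed.

Lemma mem_letters_v m k l : ((true, l) \in letters m k) = (l.+1 == k).
Proof.
by rewrite mem_cat; case: k => [|k]; case: ifP => _; rewrite !inE ?xpair_eqE ?orbF.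
Qed.

Lemma letters_word_uv m :
  flatten [seq letters m k | k <- iota 0 m.+1] = word_uv m.
Proof.
have h q : (q < m)%N ->
    flatten [seq letters m k | k <- iota 0 q.+1] = word_uv q ++ [:: (false, q)].
  elim: q => [|q IH] qm; first by rewrite /= cats0 /letters qm.
  rewrite -[in iota _ _](addn1 q.+1) iotaD map_cat flatten_cat IH; last exact: ltnW.
  by rewrite word_uvS /= cats0 /letters add0n qm -!catA.
case: m h => [|m] h; first by [].
rewrite -[in iota _ _](addn1 m.+1) iotaD map_cat flatten_cat h //.
by rewrite word_uvS /= add0n ltnn -!catA.
Qed.

(** After the contractions a permutation of the blocks survives only if u_k precedes v_k for all k,
    that is, if block k precedes block k + 1; so only the identity permutation does, with value
    1. *)
Lemma contraction_data_bounded : satisfies_PI R ->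
  exists m, forall i j (u v : nat -> L), ~ contraction_data i j m u v.
Proof.
move=> /(multilinear_identity two_neq0)[n [b [b0 idn]]].
exists n.-1 => i j u v D.
(* An identity of degree 0 would make a nonzero scalar vanish in R. *)
case: n b b0 idn D => [|m] b b0 idn D.
  have := idn (fun=> 0); rewrite (bigD1 [ffun k => k]) /=; last first.
    by apply/injectiveP => -[].
  rewrite [X in _ + X]big1 => [|c /andP[_ /eqP cid]]; last first.
    by case: cid; apply/ffunP => -[].
  rewrite addr0.
  rewrite big_ord0 => /eqP; rewrite scaler_eq0 (negPf b0) /=.
  by rewrite oner_eq0.
rewrite /= in D.
have /choice[z zP] : forall k, exists g, (k < m)%N -> contraction i j m u v k g.
  move=> k; have [km|km] := ltnP k m; last by exists (fun=> 0).
  by have [g gP] := contraction_exists two_neq0 D km; exists g.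
have uj k : (k < m)%N -> part j (u k) by case: D => h _ _ /h[].
have vi k : (k < m)%N -> part i (v k) by case: D => h _ _ /h[].
have cL := contractions_linear zP (leqnn m).
pose ks (c : {ffun 'I_m.+1 -> 'I_m.+1}) := [seq val (c l) | l <- enum 'I_m.+1].
pose wd c := flatten [seq letters m k | k <- ks c].
have := congr1 (contractions z m) (idn (fun k => word i j u v (letters m k))).
rewrite (lin_sum cL) (lin0 cL).
have prodE (c : {ffun 'I_m.+1 -> 'I_m.+1}) :
    \prod_l word i j u v (letters m (c l)) = word i j u v (wd c).
  transitivity (\prod_(l <- enum 'I_m.+1) word i j u v (letters m (c l))).
    by apply: congr_big => //; rewrite [index_enum _]unlock enumT.
  rewrite /wd /ks -map_comp.
  elim: (enum _) => [|x s IH]; first by rewrite big_nil word0.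
  by rewrite big_cons IH -word_cat.
under eq_bigr => c ci do rewrite (linZ cL) prodE.
rewrite (bigD1 [ffun k => k]) /=; last first.
  by apply/injectiveP => x y; rewrite !ffunE.
have ksid : ks [ffun k => k] = iota 0 m.+1.
  by rewrite /ks; under eq_map do rewrite ffunE; apply: val_enum_ord.
have wdid : wd [ffun k => k] = word_uv m by rewrite /wd ksid letters_word_uv.
rewrite wdid (contractions_uv uj vi zP (leqnn m)) [X in _ + X]big1 ?addr0.
  by move=> /eqP; rewrite [_ *: _]mulr1 (negPf b0).
move=> c /andP[/injectiveP ci cid].
suff -> : contractions z m (word i j u v (wd c)) = 0 by rewrite scaler0.
apply: contraNeq cid => h.
have pk : perm_eq (ks c) (iota 0 m.+1).
  rewrite -val_enum_ord /ks map_comp perm_map //; apply: uniq_perm.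
  - by rewrite map_inj_uniq ?enum_uniq.
  - exact: enum_uniq.
  move=> x; rewrite mem_enum; apply/mapP; exists (invF ci x); rewrite ?mem_enum //.
  by rewrite f_invF.
have pw : perm_eq (wd c) (word_uv m).
  by rewrite -letters_word_uv; apply/perm_flatten/perm_map.
have bw : bounded m (wd c).
  by apply/allP => x; rewrite (perm_mem pw) mem_word_uv.
have uw : uniq (wd c) by rewrite (perm_uniq pw) word_uv_uniq.
have sw : size (wd c) = m.*2 by rewrite (perm_size pw) word_uv_size.
have cw : count isv (wd c) = m by rewrite (permP pw) word_uv_count.
have [|_ sub] := contractions_long uj vi zP (leqnn m) bw uw sw _ h;
  first by rewrite cw.
have Eks : ks c = iota 0 m.+1.
  apply: (increasing_index_iota pk) => k; rewrite ltnS => km.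
  rewrite ltnNge; apply/negP => ge.
  have kin : k \in ks c by rewrite (perm_mem pk) mem_iota add0n ltnS (ltnW km).
  have kin1 : k.+1 \in ks c by rewrite (perm_mem pk) mem_iota add0n ltnS km.
  (* If block k + 1 came before block k, the prefix ending with block k + 1 would contain v_k but
     not u_k. *)
  pose q := (index k.+1 (ks c)).+1.
  have E : wd c = flatten [seq letters m k | k <- take q (ks c)] ++
                  flatten [seq letters m k | k <- drop q (ks c)].
    by rewrite -flatten_cat -map_cat cat_take_drop.
  set w1 := flatten _ in E; set w2 := flatten _ in E.
  have v1 : (true, k) \in w1.
    apply/flatten_mapP; exists k.+1; last by rewrite mem_letters_v.
    by rewrite in_take.
  have u1 : (false, k) \notin w1.
    apply/negP => /flatten_mapP[k' k'in]; rewrite mem_letters_u => /andP[/eqP Ek _].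
    move: k'in; rewrite -Ek in_take // ltnS leqNgt.
    rewrite ltn_neqAle ge andbT negbK => /eqP/(congr1 (nth 0%N (ks c))).
    by rewrite !nth_index // => /eqP; rewrite gtn_eqF.
  have /eqP := subseq_uniqP uw (sub k km).
  rewrite E filter_cat; have : (true, k) \in [seq x <- w1 | x \in [:: (false, k); (true, k)]].
    by rewrite mem_filter v1 !inE eqxx orbT.
  case Ew : [seq x <- w1 | _] => [|x s] //= _ /eqP[Ex _].
  have : x \in [seq x <- w1 | x \in [:: (false, k); (true, k)]] by rewrite Ew mem_head.
  by rewrite mem_filter -Ex (negPf u1) andbF.
apply/eqP/ffunP => l; rewrite ffunE; apply: val_inj.
have := congr1 (nth 0%N ^~ l) Eks.
by rewrite /ks (nth_map l) ?size_enum_ord // nth_ord_enum nth_iota // add0n.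
Qed.

End PolynomialIdentity.

(** * Elements with finite-rank adjoint maps *)


Section FiniteDimension.
Variables (F : fieldType) (V : lmodType F).
Implicit Types (U W A B : set V).

Lemma not_fdim A s : ~ fdim A -> exists2 x, A x & ~ spn [set 0] s x.
Proof.
move=> nA; apply: contrapT => /forall2NP h; apply: nA; exists s => x Ax.
by case: (h x) => // /contrapT.
Qed.

Lemma not_fcodim_indep U W m : ~ fcodim U W ->
  exists vs : seq V, [/\ size vs = m, forall x, x \in vs -> U x & indep W vs].
Proof.
move=> nU; elim: m => [|m [vs [<- vU vi]]]; first by exists [::].
have [x Ux xvs] : exists2 x, U x & ~ spn W vs x.
  apply: contrapT => /forall2NP h; apply: nU; exists vs => x Ux.
  by case: (h x) => // /contrapT.
exists (x :: vs); split=> // y.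
by rewrite inE => /predU1P[->|/vU].
Qed.

Lemma fdim_seq_union (I : eqType) (s : seq I) (A : I -> set V) :
  (forall i, i \in s -> fdim (A i)) ->
  fdim [set x | exists2 i, i \in s & A i x].
Proof.
elim: s => [|i s IH] h; first by exists [::] => x [].
apply: fdim_sub (fdimU (h i (mem_head _ _)) (IH _)) => [x [k]|k ks].
  by rewrite inE => /predU1P[->|ks] Ax; [left|right; exists k].
by apply: h; rewrite inE ks orbT.
Qed.

End FiniteDimension.

(** Decomposing x along [s] and y along [t] leaves the values on [A] and [B] and finitely many rows
    and columns. It is used in contrapositive form: infinite-dimensional brackets persist on
    subspaces of finite codimension. *)
Lemma fdim_bilinear (F : fieldType) (U V W : lmodType F) (g : U -> V -> W)
    (X A : set U) (Y B : set V) (s : seq U) (t : seq V) :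
  (forall y, is_linear (g^~ y)) -> (forall x, is_linear (g x)) ->
  X `<=` spn A s -> Y `<=` spn B t -> A `<=` X ->
  fdim [set g a b | a in A & b in B] ->
  (forall x, x \in s -> fdim [set g x y | y in Y]) ->
  (forall y, y \in t -> fdim [set g x y | x in X]) ->
  fdim [set g x y | x in X & y in Y].
Proof.
move=> gl gr Xs Yt AX fAB fs ft.
pose S := lspan ([set g a b | a in A & b in B] `|`
  ([set z | exists2 x, x \in s & [set g x y | y in Y] z] `|`
   [set z | exists2 y, y \in t & [set g x y | x in X] z])).
have fS : fdim S.
  by apply/fdim_lspan/fdimU => //; apply: fdimU; apply: fdim_seq_union.
have sS : subspace S by apply: lspan_subspace.
apply: fdim_sub fS => _ [x Xx [y Yy <-]].
have AY a : A a -> forall y, Y y -> S (g a y).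
  move=> Aa y' /Yt; apply: (@spn_min _ _ B t (g a @^-1` S)).
  - exact: subspace_preim.
  - by move=> b Bb; apply: lspan_gen; left; exists a => //; exists b.
  - by move=> b bt; apply: lspan_gen; right; right; exists b => //; exists a => //;
    apply: AX.
have : spn A s x by apply: Xs.
apply: (@spn_min _ _ A s (g^~ y @^-1` S)); first exact: subspace_preim.
  by move=> a Aa; apply: AY.
by move=> a as_; apply: lspan_gen; right; left; exists a => //; exists y.
Qed.

Lemma subspace_kers (F : fieldType) (U V : lmodType F) (X : set U)
    (gs : seq (U -> V)) : subspace X ->
    (forall i, (i < size gs)%N -> is_linear (nth (fun=> 0) gs i)) ->
  subspace [set x | X x /\ forall i, (i < size gs)%N -> nth (fun=> 0) gs i x = 0].
Proof.
move=> [X0 XL] gl; split=> [|a x y [Xx hx] [Xy hy]]; split; auto.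
  by move=> i ig; rewrite (lin0 (gl i ig)).
by move=> i ig; rewrite (gl i ig) hx // hy // scaler0 addr0.
Qed.

Lemma fcodim_kers (F : fieldType) (U V : lmodType F) (X : set U) (gs : seq (U -> V)) :
    subspace X -> (forall i, (i < size gs)%N -> is_linear (nth (fun=> 0) gs i)) ->
    (forall i, (i < size gs)%N -> fdim (nth (fun=> 0) gs i @` X)) ->
  fcodim X [set x | X x /\ forall i, (i < size gs)%N -> nth (fun=> 0) gs i x = 0].
Proof.
move=> sX; elim: gs => [|g gs IH] gl gf.
  by exists [::] => x Xx; split.
have gL : is_linear g by apply: (gl 0).
have gl' i : (i < size gs)%N -> is_linear (nth (fun=> 0) gs i) by apply: (gl i.+1).
have sk : subspace (X `&` [set x | g x = 0]).
  by apply: subspaceI => //; apply: (subspace_preim gL (subspace0 V)).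
have Xt := IH gl' (fun i => gf i.+1).
have [|s [_ Xs]] := @ker_fcodim _ _ _ X g sX gL; first exact: (gf 0).
set W' := [set x | _] in Xt.
have sW' : subspace W' by apply: subspace_kers.
have [u ut] : fcodim X (X `&` (X `&` [set x | g x = 0]) `&` W').
  by apply: fcodimI => //; exists s.
exists u => x /ut; apply: spn_mono => //; first exact: (subspace_kers sX gl).
by move=> y [[_ [Xy gy]] [_ hy]]; split=> // -[|i] //= ig; apply: hy.
Qed.

Section SuperBracket.
Variables (F : fieldType) (R : algType F).
Implicit Types (a b c : R).

(* the super commutator of elements of degrees i and j, for e = i && j        *)
Definition sbr (e : bool) a b : R := a * b - (-1) ^+ e *: (b * a).

Lemma sbr_linl e b : is_linear (sbr e ^~ b).
Proof.
move=> k x y; rewrite /sbr mulrDl mulrDr -scalerAl -scalerAr scalerDr scalerBr.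
by rewrite !scalerA [k * _]mulrC; abel.
Qed.

Lemma sbr_linr e a : is_linear (sbr e a).
Proof.
move=> k x y; rewrite /sbr mulrDl mulrDr -scalerAl -scalerAr scalerDr scalerBr.
by rewrite !scalerA [k * _]mulrC; abel.
Qed.

Lemma sbrC e a b : sbr e a b = - ((-1) ^+ e *: sbr e b a).
Proof.
rewrite /sbr; case: e; rewrite ?(expr1, expr0, scaleN1r, scale1r); nring.
Qed.

End SuperBracket.

Section FiniteRank.
Variables (F : fieldType) (R : algType F) (G : bool -> set R) (aug : R -> F^o).
Hypothesis sG : forall b, subspace (G b).
Hypothesis augL : is_linear aug.
Hypothesis aug1 : aug 1 = 1.
Hypothesis augG : forall b x, G b x -> aug x = 0.

(* contraction_data for u, v in R, with the super commutator in place of br   *)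
Definition contraction_config i j m (u v : nat -> R) : Prop :=
  [/\ forall k, (k < m)%N -> G j (u k) /\ G i (v k),
    forall a b : nat -> F, exists g : R -> F^o, [/\ is_linear g, g 1 = 0 &
      forall k, (k < m)%N -> g (u k) = a k /\ g (v k) = b k]
    & forall k, (k < m)%N -> exists g : R -> F^o, [/\ is_linear g, g 1 = 0,
        forall l, (l < m)%N -> g (u l) = 0 /\ g (v l) = 0,
        forall l l', (l < m)%N -> (l' < m)%N -> l != l' ->
          g (sbr (i && i) (v l) (v l')) = 0
      & forall l l', (l < m)%N -> (l' < m)%N ->
          g (sbr (j && i) (u l) (v l')) = ((l == k) && (l' == k))%:R]].

Variable m : nat.
Hypothesis no_config : forall i j u v, ~ contraction_config i j m u v.

Let one := spn [set 0] [:: (1 : R)].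
Let s_one : subspace one. Proof. exact: (spn_subspace _ (subspace0 _)). Qed.

(** The augmentation kills [G i] and is 1 at 1, so a linear relation between 1 and elements of [G i]
    cannot involve 1. *)
Lemma indep_one i (K : set R) vs : subspace K -> (forall x, x \in vs -> G i x) ->
  indep K vs -> indep one vs.
Proof.
move=> sK; elim: vs => //= a vs IH vG [avs ind]; split; last first.
  by apply: IH => // x xvs; apply: vG; rewrite inE xvs orbT.
apply: contra_not avs; rewrite -spn_cat => h.
have [c [y [y0 h']]] : exists c y, [set 0] y /\ spn [set 0] vs (a - c *: 1 - y).
  apply/(@spn_cons _ _ [set 0] 1 vs a (subspace0 _)).
  apply: spn_mono h => //; first exact: subspace0.
  by move=> x; rewrite mem_cat !inE orbC.
rewrite y0 subr0 in h'.
have Gac : G i (a - c *: 1).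
  apply: (@spn_min _ _ [set 0] vs (G i)) h' => //.
    by move=> x ->; case: (sG i).
  by move=> x xvs; apply: vG; rewrite inE xvs orbT.
have := augG Gac; rewrite (linB augL) (linZ augL) aug1 (augG (vG a (mem_head _ _))).
rewrite sub0r [_ *: _]mulr1 => /eqP; rewrite oppr_eq0 => /eqP c0.
rewrite c0 scale0r subr0 in h'.
by apply: spn_mono h' => // x ->; case: sK.
Qed.

Section AlmostScalar.
Variables (i j : bool).
Let e := j && i.

Definition almost_scalar : set R :=
  [set c | G i c /\ exists b : F, fdim [set sbr e u c - b *: u | u in G j]].

Definition finite_rank : set R :=
  [set c | G i c /\ fdim [set sbr e u c | u in G j]].

Lemma almost_scalar_subspace : subspace almost_scalar.
Proof.
split.
  split; first by case: (sG i).
  exists 0; exists [::] => _ [u _ <-].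
  by rewrite (lin0 (sbr_linr _ _)) scale0r subr0.
move=> a x y [Gx [b fx]] [Gy [c fy]]; split; first by case: (sG i) => _; apply.
exists (a * b + c).
apply: fdim_sub (fdimD (fdim_image (g := fun z => a *: z) _ fx) fy) => [_ [u Gu <-]|].
  exists (a *: (sbr e u x - b *: u)), (sbr e u y - c *: u); split.
  - by exists (sbr e u x - b *: u) => //; exists u.
  - by exists u.
  by rewrite (sbr_linr _ _) scalerDl (scalerBr a (sbr e u x) (b *: u)) scalerA; abel.
by move=> k z t; rewrite scalerDr !scalerA mulrC.
Qed.

Lemma finite_rank_subspace : subspace finite_rank.
Proof.
split.
  split; first by case: (sG i).
  by exists [::] => _ [u _ <-]; rewrite (lin0 (sbr_linr _ _)).
move=> a x y [Gx fx] [Gy fy]; split; first by case: (sG i) => _; apply.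
apply: fdim_sub (fdimD (fdim_image (g := fun z => a *: z) _ fx) fy) => [_ [u Gu <-]|].
  exists (a *: sbr e u x), (sbr e u y); split; last exact: sbr_linr.
  - by exists (sbr e u x) => //; exists u.
  - by exists u.
by move=> k z t; rewrite scalerDr !scalerA mulrC.
Qed.

(** The identity is listed so that functionals can also be prescribed at the points u_l themselves.
    This is why independence is taken modulo [almost_scalar] and not modulo [finite_rank]. *)
Let ads (vs : seq R) : seq (R -> R) :=
  [seq (fun u => sbr e u x) | x <- vs] ++ [:: id].

Lemma comb_ads vs c u : comb (ads vs) c u =
  sbr e u (\sum_(k < size vs) c k *: vs`_k) + c (size vs) *: u.
Proof.
rewrite /comb /ads size_cat size_map addn1 big_ord_recr /=.
rewrite nth_cat size_map ltnn subnn /=; congr (_ + _).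
rewrite (lin_sum (sbr_linr _ _)); apply: eq_bigr => k _ /=.
by rewrite nth_cat size_map ltn_ord (nth_map 0) // (linZ (sbr_linr _ _)).
Qed.

Lemma rank_indep_ads vs : ~ fdim (G j) -> (forall x, x \in vs -> G i x) ->
  indep almost_scalar vs -> rank_indep (G j) (ads vs).
Proof.
move=> nG; elim: vs => [|x vs IH] vG /=.
  move=> _; split=> // c; apply: contra_not nG; apply: fdim_sub => u Gu.
  by exists u; rewrite // /comb big_ord0 subr0.
move=> [xvs ind]; split; first exact: sbr_linl.
  by apply: IH => // y yvs; apply: vG; rewrite inE yvs orbT.
move=> c fd; apply: xvs; apply/(spnP _ _ almost_scalar_subspace); exists c.
split.
  apply: subspaceB => //; first by apply: vG; rewrite mem_head.
  apply: subspace_sum => // k _; apply: subspace_scale => //; apply: vG.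
  by rewrite inE mem_nth ?orbT.
exists (c (size vs)); apply: fdim_sub fd => _ [u Gu <-]; exists u => //.
by rewrite -/(ads vs) comb_ads (linB (sbr_linr _ _)) opprD addrA.
Qed.

(** By [local_independence], each new u_n can be chosen generic modulo [W0] and all values of
    [ads vs] at the earlier points; a functional is then corrected at u_n without disturbing what
    was prescribed before. *)
Lemma block_functionals vs (W0 : set R) n :
    ~ fdim (G j) -> (forall x, x \in vs -> G i x) ->
    indep almost_scalar vs -> subspace W0 -> fdim W0 ->
  exists u : nat -> R, (forall k, (k < n)%N -> G j (u k)) /\
    forall (a : nat -> F) (b : nat -> nat -> F), exists g : R -> F^o,
      [/\ is_linear g, forall x, W0 x -> g x = 0 &
        forall l, (l < n)%N -> g (u l) = a l /\
          forall l', (l' < size vs)%N -> g (sbr e (u l) vs`_l') = b l l'].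
Proof.
move=> nG vG ind sW fW; elim: n => [|n [u [uG uF]]].
  exists (fun=> 0); split=> // a b; exists (fun=> 0); split=> // k x y.
  by rewrite scaler0 addr0.
pose P := flatten [seq map (@^~ (u l)) (ads vs) | l <- iota 0 n].
have sP : subspace (spn W0 P) by apply: spn_subspace.
have fP : fdim (spn W0 P) by apply: fdim_fcodim fW; exists P.
have [x Gx xind] := local_independence (sG j) (rank_indep_ads nG vG ind) sP fP.
exists (fun l => if l == n then x else u l); split.
  move=> k; rewrite ltnS leq_eqVlt; case: eqP => [->//|_ /=]; exact: uG.
move=> a b; have [g [gL gW gu]] := uF a b.
pose T := map (@^~ x) (ads vs).
have sT : size T = (size vs).+1 by rewrite size_map size_cat size_map addn1.
have Tl : T`_(size vs) = x.
  by rewrite /T (nth_map id) ?size_cat ?size_map ?addn1 // nth_cat size_map ltnn subnn.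
have Tk l' : (l' < size vs)%N -> T`_l' = sbr e x vs`_l'.
  move=> lv; rewrite /T (nth_map id) ?size_cat ?size_map ?addn1 ?ltnS 1?ltnW //.
  by rewrite nth_cat size_map lv (nth_map 0).
have [h [hL hW hT]] := indep_functional
  (fun k => (if k == size vs then a n else b n k) - g T`_k) sP xind.
have mP l y : (l < n)%N -> y \in map (@^~ (u l)) (ads vs) -> spn W0 P y.
  move=> ln yl; apply: spn_mem => //; apply/flattenP.
  exists (map (@^~ (u l)) (ads vs)) => //; apply/mapP; exists l => //.
  by rewrite mem_iota.
exists (fun y => g y + h y); split.
- by move=> k y z; rewrite gL hL scalerDr; abel.
- by move=> y Wy; rewrite gW // hW ?addr0 //; apply: spn_sub.
move=> l; rewrite ltnS leq_eqVlt; have [-> _|ln /= lln] := eqVneq l n.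
  split=> [|l' lv].
    by rewrite -{2}Tl hT -?/T ?sT // eqxx Tl addrC subrK.
  rewrite -[in h _]Tk // hT -?/T ?sT ?ltnS 1?ltnW // (ltn_eqF lv) Tk //.
  by rewrite addrC subrK.
have [gul gvl] := gu l lln; split=> [|l' lv].
  rewrite hW ?addr0 //; apply: (mP l) => //.
  by rewrite /ads map_cat mem_cat mem_head orbT.
rewrite hW ?addr0 ?gvl //; apply: (mP l) => //.
rewrite /ads map_cat mem_cat -map_comp; apply/orP; left; apply/mapP.
by exists vs`_l' => //; apply: mem_nth.
Qed.

(* Vectors v_l independent modulo almost_scalar and generic u_l in G j would  *)
(* form a contraction_config.                                                 *)
Lemma almost_scalar_fcodim : fcodim (G i) almost_scalar.
Proof.
have [[s Gs]|nG] := pselect (fdim (G j)).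
  exists [::] => x Gx; split=> //; exists 0.
  apply: fdim_sub (fdim_image (g := fun u => sbr e u x) (sbr_linl _ _) (ex_intro _ s Gs)).
  by move=> _ [u Gu <-]; exists u; rewrite // scale0r subr0.
apply: contrapT => nK.
have [vs [sv vG ind]] := not_fcodim_indep m nK.
have indo := indep_one almost_scalar_subspace vG ind.
pose B := [seq sbr (i && i) x y | x <- vs, y <- vs].
pose W0 := spn [set 0] (1 :: vs ++ B).
have sW0 : subspace W0 by apply: (spn_subspace _ (subspace0 _)).
have [u [uG uF]] := block_functionals m nG vG ind sW0 (fdim_spn _).
have mW0 x : x \in 1 :: vs ++ B -> W0 x by apply: spn_mem; apply: subspace0.
apply: (@no_config i j u (nth 0 vs)); split.
- by move=> k km; split; [apply: uG|apply: vG; rewrite mem_nth ?sv].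
- move=> a b.
  have [h [hL h1 hv]] := indep_functional b s_one indo.
  (* [h] has the right values at 1 and the v_k; [g] vanishes there and corrects the values at the
     u_k. *)
  have [g [gL gW gu]] := uF (fun l => a l - h (u l)) (fun _ _ => 0).
  exists (fun x => g x + h x); split.
  + by move=> k y z; rewrite gL hL scalerDr; abel.
  + rewrite gW ?h1 ?addr0 //; last by apply: mW0; rewrite mem_head.
    by apply: spn_mem; [apply: subspace0|rewrite mem_head].
  move=> k km; have [-> _] := gu k km; rewrite subrK; split=> //.
  rewrite gW ?add0r ?hv ?sv //; apply: mW0.
  by rewrite inE mem_cat mem_nth ?sv ?orbT.
move=> k km.
have [g [gL gW gu]] := uF (fun _ => 0) (fun l l' => ((l == k) && (l' == k))%:R).
exists g; split=> //.
- by apply: gW; apply: mW0; rewrite mem_head.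
- move=> l lm; have [-> _] := gu l lm; split=> //; apply: gW; apply: mW0.
  by rewrite inE mem_cat mem_nth ?sv ?orbT.
- move=> l l' lm l'm _; apply: gW; apply: mW0; rewrite inE mem_cat.
  by rewrite (allpairs_f _ (mem_nth _ _) (mem_nth _ _)) ?sv ?orbT.
by move=> l l' lm l'm; have [_] := gu l lm; apply; rewrite sv.
Qed.

(* The codimension in almost_scalar is at most 1, as b is linear in c.        *)
Lemma finite_rank_fcodim : fcodim (G i) finite_rank.
Proof.
have sV := finite_rank_subspace.
apply: fcodim_trans almost_scalar_fcodim _ => //.
have [sub|] := pselect (almost_scalar `<=` finite_rank).
  by exists [::].
move=> /existsNP[c1 /not_implyP[[G1 [b1 f1]] n1]].
have b10 : b1 != 0.
  apply: contra_notN n1 => /eqP b10; split=> //; apply: fdim_sub f1 => _ [u Gu <-].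
  by exists u => //; rewrite b10 scale0r subr0.
exists [:: c1] => c [Gc [b fc]]; exists (b / b1); split.
  by apply: subspaceB => //; apply: subspace_scale.
apply: fdim_sub (fdimD fc (fdim_image (g := fun z => - (b / b1) *: z) _ f1));
  last first.
  by move=> k z t; rewrite scalerDr !scalerA mulrC.
move=> _ [u Gu <-]; exists (sbr e u c - b *: u),
  (- (b / b1) *: (sbr e u c1 - b1 *: u)).
split; [by exists u|by exists (sbr e u c1 - b1 *: u) => //; exists u|].
rewrite (linB (sbr_linr _ _)) (linZ (sbr_linr _ _)) scaleNr.
rewrite (scalerBr _ (sbr e u c1) (b1 *: u)) scalerA.
by rewrite divfK //; abel.
Qed.

End AlmostScalar.
End FiniteRank.

(** * Elements with finite-rank adjoint maps have finite-dimensional brackets *)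

Section FiniteDerived.
Variables (F : fieldType) (R : algType F) (G : bool -> set R) (aug : R -> F^o).
Hypothesis sG : forall b, subspace (G b).
Hypothesis augL : is_linear aug.
Hypothesis aug1 : aug 1 = 1.
Hypothesis augG : forall b x, G b x -> aug x = 0.
Variable m : nat.
Hypothesis no_config : forall i j u v, ~ contraction_config G i j m u v.

Definition finite_adjoint i : set R := finite_rank G i false `&` finite_rank G i true.
Local Notation V := finite_adjoint.

Lemma finite_adjointP i c : V i c <->
  G i c /\ forall j, fdim [set sbr (j && i) u c | u in G j].
Proof. by split=> [[[Gc f0] [_ f1]]|[Gc f]]; [split=> // -[]|split; split]. Qed.

Lemma finite_adjoint_subspace i : subspace (V i).
Proof. by apply: subspaceI; apply: finite_rank_subspace. Qed.

Lemma finite_adjoint_fcodim i : fcodim (G i) (V i).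
Proof.
have s0 := finite_rank_subspace sG i false; have s1 := finite_rank_subspace sG i true.
have c0 := finite_rank_fcodim sG augL aug1 augG no_config i false.
have c1 := finite_rank_fcodim sG augL aug1 augG no_config i true.
apply: fcodim_sub (fcodimI (sG i) s0 s1 c0 c1); first exact: finite_adjoint_subspace.
by move=> x [[_ ?] ?]; split.
Qed.

Lemma finite_adjoint_fdiml i j x : V i x -> fdim [set sbr (i && j) x u | u in G j].
Proof.
move=> /finite_adjointP[_ /(_ j) fx].
apply: fdim_sub (fdim_image (g := fun z => - ((-1) ^+ (i && j) *: z)) _ fx).
  move=> _ [u Gu <-]; exists (sbr (j && i) u x); first by exists u.
  by rewrite [RHS]sbrC [j && i]andbC.
by move=> k y z; rewrite !scalerDr opprD scalerN !scalerA mulrC.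
Qed.

Section Pair.
Variables (i j : bool).
Let e := j && i.
Hypothesis infinite : ~ fdim [set sbr e a c | a in V j & c in V i].

Let s_one : subspace (spn [set 0] [:: (1 : R)]).
Proof. exact: (spn_subspace _ (subspace0 _)). Qed.

Let VG k x : V k x -> G k x. Proof. by case=> -[]. Qed.

Lemma infinite_left : ~ fdim (V j).
Proof.
apply: contra_not infinite => fV.
have [t [tV Vt]] := fcodim_basis (finite_adjoint_subspace j) (subspace0 R) fV.
apply: (@fdim_bilinear _ _ _ _ (sbr e) _ [set 0] _ (V i) t [::]) => //.
- by move=> y; apply: sbr_linl.
- by move=> x; apply: sbr_linr.
- by move=> x /Vt; apply: (spn_mono (subspace0 R)) => // y [].
- by move=> x ->; case: (finite_adjoint_subspace j).
- by exists [::] => _ [_ -> [b _ <-]]; rewrite (lin0 (sbr_linl _ _)).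
move=> x /tV /(@finite_adjoint_fdiml j i); apply: fdim_sub => _ [y /VG Gy <-].
by exists y.
Qed.

Lemma infinite_right : ~ fdim (V i).
Proof.
apply: contra_not infinite => fV.
have [t [tV Vt]] := fcodim_basis (finite_adjoint_subspace i) (subspace0 R) fV.
apply: (@fdim_bilinear _ _ _ _ (sbr e) (V j) (V j) (V i) [set 0] [::] t) => //.
- by move=> y; apply: sbr_linl.
- by move=> x; apply: sbr_linr.
- by move=> x /Vt; apply: (spn_mono (subspace0 R)) => // y [].
- by exists [::] => _ [a _ [_ -> <-]]; rewrite (lin0 (sbr_linr _ _)).
move=> y /tV /finite_adjointP[_ /(_ j)]; apply: fdim_sub => _ [x /VG Gx <-].
by exists x.
Qed.

Lemma infinite_sub k (X : set R) s : subspace X -> ~ fdim (V k) -> fcodim (V k) X ->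
  exists2 x, X x & ~ spn [set 0] s x.
Proof.
move=> sX nV fX; apply: contrapT => /forall2NP h; apply: nV; apply: fdim_fcodim fX _.
by exists s => x Xx; case: (h x) => // /contrapT.
Qed.

(** The unwanted brackets now vanish outright, and functionals are arbitrary on the u_l, v_l and
    [u_l, v_l]. So m pairs form a forbidden [contraction_config]. *)
Definition commuting_pairs n (u v : nat -> R) : Prop :=
  [/\ forall k, (k < n)%N -> V j (u k) /\ V i (v k),
    forall l l', (l < n)%N -> (l' < n)%N -> l != l' ->
      sbr e (u l) (v l') = 0 /\ sbr (i && i) (v l) (v l') = 0
    & forall a b c : nat -> F, exists g : R -> F^o, [/\ is_linear g, g 1 = 0 &
        forall l, (l < n)%N ->
          [/\ g (u l) = a l, g (v l) = b l & g (sbr e (u l) (v l)) = c l]]].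

(* A pair with bracket z outside a given finite-dimensional space is moved    *)
(* off that space by adding to each of its members a commuting element.       *)
Lemma commuting_pairs_extend n : exists u v, commuting_pairs n u v.
Proof.
elim: n => [|n [u [v [uvV uv0 uvF]]]].
  exists (fun=> 0), (fun=> 0); split=> // a b c; exists (fun=> 0); split=> //.
  by move=> k x y; rewrite scaler0 addr0.
have Vu k : (k < n)%N -> V j (u k) by move=> /uvV[].
have Vv k : (k < n)%N -> V i (v k) by move=> /uvV[].
pose gA := mkseq (fun l (x : R) => sbr e x (v l)) n.
pose gB := mkseq (fun l (y : R) => sbr e (u l) y) n ++
           mkseq (fun l (y : R) => sbr (i && i) y (v l)) n.
(* [A] and [B] centralize the pairs found so far, as far as [commuting_pairs] requires. They have
   finite codimension in [V j] and [V i] because the adjoint maps have finite rank, so [A, B] is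
   still infinite-dimensional. *)
pose A := [set x | V j x /\ forall k, (k < size gA)%N -> nth (fun=> 0) gA k x = 0].
pose B := [set x | V i x /\ forall k, (k < size gB)%N -> nth (fun=> 0) gB k x = 0].
have gAl k : (k < size gA)%N -> is_linear (nth (fun=> 0) gA k).
  by rewrite size_mkseq => kn; rewrite nth_mkseq //; apply: sbr_linl.
have gBl k : (k < size gB)%N -> is_linear (nth (fun=> 0) gB k).
  rewrite size_cat !size_mkseq nth_cat size_mkseq => kn; case: ltnP => kn'.
    by rewrite nth_mkseq //; apply: sbr_linr.
  by rewrite nth_mkseq; [apply: sbr_linl|rewrite ltn_subLR].
have gAf k : (k < size gA)%N -> fdim (nth (fun=> 0) gA k @` V j).
  rewrite size_mkseq => kn; rewrite nth_mkseq //.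
  have /finite_adjointP[_ /(_ j)] := Vv k kn.
  by apply: fdim_sub => _ [x /VG Gx <-]; exists x.
have gBf k : (k < size gB)%N -> fdim (nth (fun=> 0) gB k @` V i).
  rewrite size_cat !size_mkseq nth_cat size_mkseq => kn; case: ltnP => kn'.
    rewrite nth_mkseq //; apply: fdim_sub (finite_adjoint_fdiml i (Vu k kn')).
    by move=> _ [x /VG Gx <-]; exists x.
  have kn2 : (k - n < n)%N by rewrite ltn_subLR.
  rewrite nth_mkseq //; have /finite_adjointP[_ /(_ i)] := Vv _ kn2.
  by apply: fdim_sub => _ [x /VG Gx <-]; exists x.
have sVj := finite_adjoint_subspace j; have sVi := finite_adjoint_subspace i.
have sA : subspace A by apply: subspace_kers.
have sB : subspace B by apply: subspace_kers.
have cA : fcodim (V j) A by apply: fcodim_kers.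
have cB : fcodim (V i) B by apply: fcodim_kers.
have AV x : A x -> V j x by case.
have BV x : B x -> V i x by case.
have infAB : ~ fdim [set sbr e a c | a in A & c in B].
  apply: contra_not infinite => fAB.
  have [tA [tAV At]] := fcodim_basis sVj sA cA.
  have [tB [tBV Bt]] := fcodim_basis sVi sB cB.
  apply: (@fdim_bilinear _ _ _ _ (sbr e) (V j) A (V i) B tA tB) => //.
  - by move=> y; apply: sbr_linl.
  - by move=> x; apply: sbr_linr.
  - by move=> x /At; apply: spn_mono => // y [].
  - by move=> x /Bt; apply: spn_mono => // y [].
  - move=> x /tAV /(@finite_adjoint_fdiml j i); apply: fdim_sub => _ [y /VG Gy <-].
    by exists y.
  move=> y /tBV /finite_adjointP[_ /(_ j)]; apply: fdim_sub => _ [x /VG Gx <-].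
  by exists x.
pose P := mkseq u n ++ mkseq v n ++ mkseq (fun l => sbr e (u l) (v l)) n ++ [:: 1].
have [z [a Aa [c Bc Ez]] zP] := not_fdim P infAB.
have [c' [Bc' ac'] c'P] : exists2 x,
  B x /\ sbr e a x = 0 & ~ spn [set 0] (c :: z :: P) x.
  have sk : subspace (B `&` [set x | sbr e a x = 0]).
    by apply: subspaceI => //; apply: (subspace_preim (sbr_linr e a) (subspace0 R)).
  apply: (infinite_sub _ sk infinite_right); apply: fcodim_trans cB _ => //.
  have [|t [_ Bt]] := ker_fcodim sB (sbr_linr e a); last by exists t.
  apply: fdim_sub (finite_adjoint_fdiml i (AV _ Aa)) => _ [x /BV/VG Gx <-].
  by exists x.
pose y := c + c'.
have By : B y by apply: subspaceD.
have Ey : sbr e a y = z by rewrite (linD (sbr_linr e a)) ac' addr0.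
have [a' [Aa' ay'] a'P] : exists2 x, A x /\ sbr e x y = 0 &
    ~ spn [set 0] (a :: y :: z :: P) x.
  have sk : subspace (A `&` [set x | sbr e x y = 0]).
    by apply: subspaceI => //; apply: (subspace_preim (sbr_linl e y) (subspace0 R)).
  apply: (infinite_sub _ sk infinite_left); apply: fcodim_trans cA _ => //.
  have [|t [_ At]] := ker_fcodim sA (sbr_linl e y); last by exists t.
  have /finite_adjointP[_ /(_ j)] := BV _ By.
  by apply: fdim_sub => _ [x /AV/VG Gx <-]; exists x.
pose x := a + a'.
have Ax : A x by apply: subspaceD.
have Ex : sbr e x y = z by rewrite (linD (sbr_linl e y)) ay' addr0.
have s0 := subspace0 R.
have ind : indep (spn [set 0] P) [:: x; y; z].
  change (~ spn (spn [set 0] P) [:: y; z] x /\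
          (~ spn (spn [set 0] P) [:: z] y /\ (~ spn [set 0] P z /\ True))).
  rewrite -!spn_cat !cat_cons !cat0s; split; [|split=> //].
  - apply: contra_not a'P => xP; rewrite -[a'](addKr a) addrC.
    apply: subspaceB; first exact: spn_subspace.
      by apply: spn_mono xP => // w wP; rewrite inE wP orbT.
    by apply: spn_mem => //; rewrite mem_head.
  apply: contra_not c'P => yP; rewrite -[c'](addKr c) addrC.
  apply: subspaceB; first exact: spn_subspace.
    by apply: spn_mono yP => // w wP; rewrite inE wP orbT.
  by apply: spn_mem => //; rewrite mem_head.
have xv l : (l < n)%N -> sbr e x (v l) = 0.
  by move=> ln; case: Ax => _ /(_ l); rewrite size_mkseq nth_mkseq //; apply.
have uy l : (l < n)%N -> sbr e (u l) y = 0.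
  move=> ln; have ln2 := ltn_addr n ln; case: By => _ /(_ l).
  by rewrite size_cat !size_mkseq nth_cat size_mkseq ln nth_mkseq // => /(_ ln2).
have yv l : (l < n)%N -> sbr (i && i) y (v l) = 0.
  move=> ln; have nln : (n + l < n)%N = false by rewrite ltnNge leq_addr.
  case: By => _ /(_ (n + l)%N).
  rewrite size_cat !size_mkseq nth_cat size_mkseq nln addKn nth_mkseq //.
  by rewrite ltn_add2l; apply.
pose ext (f : nat -> R) w l := if l == n then w else f l.
exists (ext u x), (ext v y); rewrite /ext; split.
- move=> k; rewrite ltnS leq_eqVlt; case: eqP => [_ _|_ /= kn]; last exact: uvV.
  by split; [apply: AV|apply: BV].
- have lt l : (l < n.+1)%N -> l <> n -> (l < n)%N.
    by rewrite ltnS leq_eqVlt => /orP[/eqP|].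
  move=> l l' ln1 ln1' ll'.
  case: (l =P n) => [E|/(lt _ ln1) ln]; case: (l' =P n) => [E'|/(lt _ ln1') ln'].
  + by rewrite E E' eqxx in ll'.
  + by rewrite xv ?yv.
  + by rewrite uy // sbrC yv // scaler0 oppr0.
  + exact: uv0.
move=> al be ga; have [g [gL g1 guv]] := uvF al be ga.
have sP : subspace (spn [set 0] P) by apply: spn_subspace.
have [h [hL hP hk]] := indep_functional
  (fun k => nth 0 [:: al n - g x; be n - g y; ga n - g z] k) sP ind.
have h0 w : w \in P -> h w = 0 by move=> wP; apply/hP/spn_mem.
exists (fun w => g w + h w); split.
- by move=> k w w'; rewrite gL hL scalerDr; abel.
- by rewrite g1 h0 ?addr0 // !mem_cat mem_head !orbT.
move=> l; rewrite ltnS leq_eqVlt; case: eqP => [-> _|_ /= ln].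
  rewrite Ex (hk 0 isT) (hk 1 isT) (hk 2 isT) /=.
  by split; rewrite addrC subrK.
have [-> -> ->] := guv l ln.
have mk (f : nat -> R) : f l \in mkseq f n.
  by apply/mapP; exists l; rewrite // mem_iota.
by split; rewrite h0 ?addr0 // !mem_cat ?(mk u) ?(mk v)
  ?(mk (fun l => sbr e (u l) (v l))) ?orbT.
Qed.

Lemma infinite_absurd : False.
Proof.
have [u [v [uvV uv0 uvF]]] := commuting_pairs_extend m.
apply: (@no_config i j u v); split.
- by move=> k /uvV[/VG ? /VG].
- move=> a b; have [g [gL g1 guv]] := uvF a b (fun=> 0); exists g; split=> // k km.
  by have [-> ->] := guv k km.
move=> k km; have [g [gL g1 guv]] := uvF (fun=> 0) (fun=> 0) (fun l => (l == k)%:R).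
exists g; split=> //.
- by move=> l lm; have [-> ->] := guv l lm.
- by move=> l l' lm l'm ll'; have [_ ->] := uv0 l l' lm l'm ll'; rewrite (lin0 gL).
move=> l l' lm l'm; have [<-|ll'] := eqVneq l l'.
  by have [_ _ ->] := guv l lm; rewrite andbb.
have [-> _] := uv0 l l' lm l'm ll'; rewrite (lin0 gL).
by case: eqP => // lk; rewrite -lk eq_sym (negPf ll').
Qed.

End Pair.

Lemma finite_adjoint_derived i j :
  fdim [set sbr (j && i) a c | a in V j & c in V i].
Proof. by apply: contrapT => /infinite_absurd. Qed.

End FiniteDerived.

(** * Ideals and an Engel theorem *)


Section Ideals.
Variables (F : fieldType) (R : algType F).
Implicit Types (P J X : set R).

Lemma idealD J x y : two_sided_ideal J -> J x -> J y -> J (x + y).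
Proof.
move=> [J0 JB _ _] Jx Jy; rewrite -[y]opprK -[- y]sub0r.
exact: (JB _ _ Jx (JB _ _ J0 Jy)).
Qed.

Lemma ideal_subspace J : two_sided_ideal J -> subspace J.
Proof.
move=> Ji; have [J0 JB Jl Jr] := Ji; split=> // a x y Jx Jy.
by apply: idealD => //; rewrite -[x]mul1r scalerAl; apply: Jl.
Qed.

Lemma ideal_mull J r x : two_sided_ideal J -> J x -> J (r * x).
Proof. by move=> [_ _ Jl _]; apply: Jl. Qed.

Lemma ideal_mulr J r x : two_sided_ideal J -> J x -> J (x * r).
Proof. by move=> [_ _ _ Jr]; apply: Jr. Qed.

Lemma ideal_exp_le J x m n : two_sided_ideal J -> (m <= n)%N -> J (x ^+ m) -> J (x ^+ n).
Proof. by move=> Ji mn Jx; rewrite -(subnK mn) exprD; apply: ideal_mull. Qed.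

Lemma ideal_zero : two_sided_ideal [set (0 : R)].
Proof.
by split=> //= [a b -> ->|r a ->|r a ->]; rewrite ?subr0 ?mulr0 ?mul0r.
Qed.

Definition left_span X : set R := lspan [set r * x | r in [set: R] & x in X].

Lemma left_span_gen X r x : X x -> left_span X (r * x).
Proof. by move=> Xx; apply: lspan_gen; exists r => //; exists x. Qed.

Lemma left_span_sub X : X `<=` left_span X.
Proof. by move=> x Xx; rewrite -[x]mul1r; apply: left_span_gen. Qed.

Lemma left_span_ind X W : subspace W -> (forall r x, X x -> W (r * x)) ->
  left_span X `<=` W.
Proof. by move=> sW h; apply: lspan_min => // _ [r _ [x Xx <-]]; apply: h. Qed.

Lemma mulr_linear (r : R) : is_linear (fun x : R => r * x).
Proof. by move=> a x y; rewrite mulrDr scalerAr. Qed.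

Lemma mull_linear (r : R) : is_linear (fun x : R => x * r).
Proof. by move=> a x y; rewrite mulrDl scalerAl. Qed.

Lemma left_spanMl X r y : left_span X y -> left_span X (r * y).
Proof.
apply: (@left_span_ind _ ((fun y => r * y) @^-1` left_span X)).
  by apply: subspace_preim (mulr_linear r) _; apply: lspan_subspace.
by move=> s x Xx; rewrite /= mulrA; apply: left_span_gen.
Qed.

Lemma left_spanMr X r y : (forall x, X x -> left_span X (x * r)) ->
  left_span X y -> left_span X (y * r).
Proof.
move=> h; apply: (@left_span_ind _ ((fun y => y * r) @^-1` left_span X)).
  by apply: subspace_preim (mull_linear r) _; apply: lspan_subspace.
by move=> s x Xx; rewrite /= -mulrA; apply: left_spanMl; apply: h.
Qed.

Lemma left_span_ideal X : (forall x r, X x -> left_span X (x * r)) ->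
  two_sided_ideal (left_span X).
Proof.
have sX : subspace (left_span X) by apply: lspan_subspace.
move=> h; split.
- by case: sX.
- by move=> a b; apply: subspaceB.
- by move=> r a; apply: left_spanMl.
- by move=> r a; apply: left_spanMr => x; apply: h.
Qed.

(* The ideal generated by X is R X, so its n-th power is R X^n. *)
Lemma left_span_power X J n : two_sided_ideal (left_span X) -> two_sided_ideal J ->
    (forall w, (forall x, x \in w -> X x) -> size w = n -> J (\prod_(x <- w) x)) ->
  forall a, left_span X a -> J (a ^+ n).
Proof.
move=> Xi Ji Xn a Xa.
pose pw k := left_span [set y | exists w, [/\ forall x, x \in w -> X x, size w = k
  & y = \prod_(x <- w) x]].
have step k b : pw k b -> pw k.+1 (a * b).
  apply: (@left_span_ind _ ((fun b => a * b) @^-1` pw k.+1)).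
    by apply: subspace_preim (mulr_linear a) _; apply: lspan_subspace.
  move=> r _ [w [wX <- ->]]; rewrite /= mulrA.
  have : left_span X (a * r) by exact: (ideal_mulr _ Xi Xa).
  apply: (@left_span_ind _ ((fun b => b * _) @^-1` pw _)).
    by apply: subspace_preim (mull_linear _) _; apply: lspan_subspace.
  move=> s x Xx; rewrite /= -mulrA; apply: left_span_gen.
  exists (x :: w); split; rewrite ?big_cons // => y.
  by rewrite inE => /predU1P[->|/wX].
have : pw n (a ^+ n).
  elim: {Xn} n => [|k IH]; last by rewrite exprS; apply: step.
  by apply: left_span_sub; exists [::]; rewrite big_nil.
apply: left_span_ind; first exact: ideal_subspace.
by move=> r _ [w [wX sw ->]]; apply: ideal_mull => //; apply: Xn.
Qed.

End Ideals.

Section Engel.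
Variables (F : fieldType) (R : algType F).
Hypothesis two_neq0 : (2%:R : F) != 0.
Variables (G : bool -> set R) (theta : R -> R).
Hypothesis thetaL : is_linear theta.
Hypothesis thetaM : forall r s, theta (r * s) = theta r * theta s.
Hypothesis thetaG : forall b x, G b x -> theta x = (-1) ^+ b *: x.
Hypothesis sG : forall b, subspace (G b).

Definition graded (T : set R) : Prop := forall x, T x ->
  exists x0 x1, [/\ T x0, T x1, G false x0, G true x1 & x = x0 + x1].

Lemma graded_lspan (X : bool -> set R) : (forall b, X b `<=` G b) ->
  graded (lspan (X false `|` X true)).
Proof.
move=> XG; have sE : subspace (lspan (X false `|` X true)) by apply: lspan_subspace.
set E := lspan _ in sE *.
apply: (@lspan_min _ _ _ [set x | exists x0 x1,
   [/\ E x0, E x1, G false x0, G true x1 & x = x0 + x1]]).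
  split=> [|a x y]; first by exists 0, 0; rewrite addr0; split=> //;
     by [case: sE|case: (sG false)|case: (sG true)].
  move=> [x0 [x1 [Ex0 Ex1 Gx0 Gx1 ->]]] [y0 [y1 [Ey0 Ey1 Gy0 Gy1 ->]]].
  exists (a *: x0 + y0), (a *: x1 + y1); split; last by rewrite scalerDr; abel.
  - by case: sE => _; apply.
  - by case: sE => _; apply.
  - by case: (sG false) => _; apply.
  - by case: (sG true) => _; apply.
have E0 : E 0 by case: sE.
have G0 b : G b 0 by case: (sG b).
move=> x [] Xx.
  exists x, 0; rewrite addr0; split=> //; last exact: (XG false).
  by apply: lspan_gen; left.
exists 0, x; rewrite add0r; split=> //; last exact: (XG true).
by apply: lspan_gen; right.
Qed.

Variable J : set R.
Hypothesis Ji : two_sided_ideal J.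
Hypothesis Jtheta : forall x, J x -> J (theta x).

(** The homogeneous components of x are (x + theta x) / 2 and (x - theta x) / 2. *)
Lemma graded_setI_ideal T : subspace T -> graded T -> graded (T `&` J).
Proof.
move=> sT gT x [Tx Jx]; have [x0 [x1 [T0 T1 G0 G1 E]]] := gT x Tx.
have sJ := ideal_subspace Ji.
have half y : J (y + y) -> J y.
  move=> Jy; rewrite -[y](scalerK two_neq0) scaler_nat mulr2n.
  exact: subspace_scale.
exists x0, x1; split=> //; split=> //; apply: half.
  have -> : x0 + x0 = x + theta x.
    by rewrite E (linD thetaL) (thetaG G0) (thetaG G1) scale1r scaleN1r; abel.
  by apply: subspaceD => //; apply: Jtheta.
have -> : x1 + x1 = x - theta x.
  by rewrite E (linD thetaL) (thetaG G0) (thetaG G1) scale1r scaleN1r; abel.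
by apply: subspaceB => //; apply: Jtheta.
Qed.

Definition nilpotent_mod (T : set R) a : Prop :=
  forall w : seq R, (forall x, x \in w -> T x) -> (a <= size w)%N ->
  J (\prod_(x <- w) x).

Section Extension.
Variables (T : set R) (a : nat) (b : bool) (x : R) (q : nat).
Hypotheses (sT : subspace T) (gT : graded T) (Tnil : nilpotent_mod T a).
Hypotheses (Gx : G b x) (xnil : J (x ^+ q)).
Hypothesis Tx : forall i t, T t -> G i t -> T (sbr (i && b) t x).

Lemma commute_past t : T t -> exists t1 t2, [/\ T t1, T t2 & x * t = t1 * x + t2].
Proof.
move=> /gT[t0 [t1 [T0 T1 G0 G1 ->]]].
exists (t0 + (-1) ^+ b *: t1), (- sbr false t0 x - (-1) ^+ b *: sbr b t1 x).
have h0 := Tx T0 G0; have h1 := Tx T1 G1.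
split.
- by apply: subspaceD => //; apply: subspace_scale.
- by apply: subspaceB; rewrite // -1?scaleN1r; apply: subspace_scale.
by rewrite /sbr; case: (b); rewrite ?(expr1, expr0, scaleN1r, scale1r); nring.
Qed.

Lemma commute_past_power c t l r : T t ->
  (forall k t', (k <= c)%N -> T t' -> J (l * t' * x ^+ k * r)) ->
  J (l * x ^+ c * t * r).
Proof.
elim: c t r => [|c IH] t r Tt h.
  by have := h 0 t isT Tt; rewrite expr0 !mulr1.
have [t1 [t2 [T1 T2 E]]] := commute_past Tt.
rewrite exprSr -!mulrA [x * (t * r)]mulrA E mulrDl !mulrDr; apply: idealD => //.
  rewrite -!mulrA ![l * _]mulrA [_ * _ * (t1 * _)]mulrA.
  apply: IH => // k t' kc Tt'; rewrite mulrA -[_ * x]mulrA -exprSr; exact: h.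
by rewrite ![l * _]mulrA mulrA; apply: IH => // k t' kc; apply: h; apply: leqW.
Qed.

(** The factors of [w] are processed from the left: x raises [c], while a factor in T moves past x ^
    c to join [s], possibly lowering the power. As c < q, such a move costs at most q letters, so n
    * q letters yield n more factors in T unless x ^ q occurs first. *)
Lemma nilpotent_extension_aux n (w s : seq R) c : (forall y, y \in w -> spn T [:: x] y) ->
  (forall y, y \in s -> T y) -> (a <= size s + n)%N ->
  (n * q <= c + size w)%N -> J (\prod_(y <- s) y * x ^+ c * \prod_(y <- w) y).
Proof.
elim: n w s c => [|n IHn] w s c.
  by move=> _ sT' as_ _; rewrite addn0 in as_; do 2!apply: ideal_mulr => //;
    apply: Tnil.
elim: w c => [|y w IHw] c wT' sT' as_ cw.
  rewrite big_nil mulr1; apply: ideal_mull => //; apply: (ideal_exp_le Ji _ xnil).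
  by rewrite addn0 mulSn in cw; apply: leq_trans cw; apply: leq_addr.
have [cq|cq] := leqP q c.
  by apply: ideal_mulr => //; apply: ideal_mull => //;
    apply: (ideal_exp_le Ji cq xnil).
have wT'' z : z \in w -> spn T [:: x] z by move=> zw; apply: wT'; rewrite inE zw orbT.
have [al Ty] : spn T [:: x] y by apply: wT'; rewrite mem_head.
rewrite /= addnS in cw; rewrite mulSn in cw.
rewrite big_cons -[y](subrK (al *: x)) mulrDl mulrDr; apply: idealD => //; last first.
  rewrite -scalerAl -scalerAr; apply: subspace_scale; first exact: ideal_subspace.
  by rewrite mulrA -[_ * x]mulrA -exprSr; apply: IHw => //; rewrite addSn mulSn.
rewrite mulrA; apply: commute_past_power => // k t' kc Tt'.
have -> : \prod_(z <- s) z * t' = \prod_(z <- rcons s t') z.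
  by rewrite -cats1 big_cat /= big_seq1.
apply: IHn => //.
- by move=> z; rewrite mem_rcons inE => /predU1P[->|/sT'].
- by rewrite size_rcons addSnnS.
- clear - cw cq kc; lia.
Qed.

Lemma nilpotent_extension : nilpotent_mod (spn T [:: x]) (a * q).
Proof.
move=> w wT aw; have := @nilpotent_extension_aux a w [::] 0 wT.
by rewrite big_nil expr0 !mul1r; apply.
Qed.

End Extension.

Variable S : bool -> set R.
Hypothesis SG : forall b, S b `<=` G b.
Hypothesis SI : forall i j g s, G i g -> S j s -> S (i (+) j) (sbr (i && j) g s).
Hypothesis Snil : forall b s, S b s -> exists n, J (s ^+ n).
Let E := lspan (S false `|` S true).

(* Otherwise one can bracket with T forever and stay outside T; but after 2a  *)
(* brackets, every term has a factors in T on one side.                       *)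
Lemma engel_step (T : set R) a : subspace T -> nilpotent_mod T a -> E `&` J `<=` T ->
  ~ E `<=` T -> exists b x, [/\ S b x, ~ T x &
    forall i t, T t -> G i t -> T (sbr (i && b) t x)].
Proof.
move=> sT Tnil JT ET.
have SE b : S b `<=` E by move=> x Sx; apply: lspan_gen; case: b Sx; [right|left].
have [b0 [x0 [S0 T0]]] : exists b x, S b x /\ ~ T x.
  apply: contrapT => /forallNP h; apply: ET; apply: lspan_min => // x [] Sx;
    apply: contrapT => Tx.
    by apply: (h false); exists x.
  by apply: (h true); exists x.
apply: contrapT => none.
have next b x : S b x -> ~ T x -> exists i t,
  [/\ T t, G i t & ~ T (sbr (i && b) t x)].
  move=> Sx nTx; apply: contrapT => h; apply: none; exists b, x; split=> // i t Tt Gt.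
  by apply: contrapT => nT; apply: h; exists i, t.
have chain k : exists b x, [/\ S b x, ~ T x & forall s1 s2 : seq R,
    (forall y, y \in s1 -> T y) -> (forall y, y \in s2 -> T y) ->
    (a + a <= size s1 + size s2 + k)%N ->
    J (\prod_(y <- s1) y * x * \prod_(y <- s2) y)].
  elim: k => [|k [b [x [Sx nTx h]]]].
    exists b0, x0; split=> // s1 s2 s1T s2T sz.
    have [s1a|s1a] := leqP a (size s1).
      by do 2!apply: ideal_mulr => //; apply: Tnil.
    by apply: ideal_mull => //; apply: Tnil => //; clear - sz s1a; lia.
  have [i [t [Tt Gt nT]]] := next b x Sx nTx.
  exists (i (+) b), (sbr (i && b) t x); split=> //; first exact: SI.
  move=> s1 s2 s1T s2T sz; rewrite /sbr mulrBr mulrBl; apply: subspaceB.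
  - exact: ideal_subspace.
  - have := h (rcons s1 t) s2; rewrite -cats1 big_cat big_seq1 /= mulrA; apply=> //.
      by move=> y; rewrite cats1 mem_rcons inE => /predU1P[->|/s1T].
    by rewrite size_cat /=; clear - sz; lia.
  rewrite -scalerAr -scalerAl; apply: subspace_scale; first exact: ideal_subspace.
  have := h s1 (t :: s2); rewrite big_cons -!mulrA; apply=> //.
    by move=> y; rewrite inE => /predU1P[->|/s2T].
  by rewrite /=; clear - sz; lia.
have [b [x [Sx nTx /(_ [::] [::])]]] := chain (a + a)%N.
rewrite !big_nil mul1r mulr1 => Jx; apply/nTx/JT; split; first exact: (SE b).
exact: Jx.
Qed.

Lemma spn_exchange (T : set R) s x : subspace T -> spn T s x -> ~ T x ->
  exists s', (size s').+1 = size s /\ spn T s `<=` spn (spn T [:: x]) s'.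
Proof.
move=> sT; elim: s => [|y s IH] //= [c xc] nTx.
have sTx : subspace (spn T [:: x]) by apply: spn_subspace.
have [c0|c0] := eqVneq c 0.
  rewrite c0 scale0r subr0 in xc; have [s' [<- h]] := IH xc nTx.
  by exists (y :: s'); split=> // z /= [d zd]; exists d; apply: h.
exists s; split=> // z [d zd].
have sS : subspace (spn (spn T [:: x]) s) by apply: spn_subspace.
have sub : spn T s `<=` spn (spn T [:: x]) s.
  by apply: spn_mono => //; apply: spn_sub.
have xS : spn (spn T [:: x]) s x.
  by apply: spn_sub; apply: spn_mem => //; rewrite mem_head.
have yS : spn (spn T [:: x]) s y.
  rewrite -[y](scalerK c0); apply: subspace_scale => //.
  by rewrite -[c *: y](subKr x); apply: subspaceB => //; apply: sub.
by rewrite -[z](subrK (d *: y)); apply: subspaceD;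
  [|apply: sub|apply: subspace_scale].
Qed.

(** [engel_step] supplies an element normalizing T, [nilpotent_extension] adjoins it, and
    [spn_exchange] lowers the number of vectors missing from E. *)
Lemma engel_iter n (T : set R) a s : subspace T -> graded T -> E `&` J `<=` T ->
  T `<=` E -> nilpotent_mod T a -> size s = n -> E `<=` spn T s ->
  exists t, nilpotent_mod E t.
Proof.
elim: n T a s => [|n IH] T a s sT gT JT TE Tnil sn Es.
  exists a => w wE; apply: Tnil => x /wE; rewrite (size0nil sn) in Es; exact: Es.
have [ET|ET] := pselect (E `<=` T).
  by exists a => w wE; apply: Tnil => x /wE/ET.
have [b [x [Sx nTx Tx]]] := engel_step sT Tnil JT ET.
have Ex : E x by apply: lspan_gen; case: b Sx {Tx}; [right|left].
have Gx : G b x by apply: SG.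
have [q xq] := Snil Sx.
have [s' [ss' h]] := spn_exchange sT (Es x Ex) nTx.
apply: (IH (spn T [:: x]) (a * q)%N s').
- exact: spn_subspace.
- move=> y [c /gT[y0 [y1 [T0 T1 G0 G1 E']]]].
  have Tsub := spn_sub (W := T) [:: x].
  have sTx : subspace (spn T [:: x]) by apply: spn_subspace.
  have xTx : spn T [:: x] x by apply: spn_mem => //; rewrite mem_head.
  have Ey : y = y0 + y1 + c *: x by rewrite -E' subrK.
  case: b Sx Tx Gx => Sx Tx Gx.
    exists y0, (y1 + c *: x); split=> //; last by rewrite addrA.
    - exact: Tsub.
    - by apply: subspaceD => //; [apply: Tsub|apply: subspace_scale].
    - by apply: subspaceD => //; apply: subspace_scale.
  exists (y0 + c *: x), y1; split=> //; last by rewrite Ey; abel.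
  - by apply: subspaceD => //; [apply: Tsub|apply: subspace_scale].
  - exact: Tsub.
  - by apply: subspaceD => //; apply: subspace_scale.
- by move=> y /JT; apply: spn_sub.
- apply: spn_min => //; first exact: lspan_subspace.
  by move=> y; rewrite inE => /eqP ->.
- exact: (nilpotent_extension sT gT Tnil xq Tx).
- by apply/eqP; rewrite -eqSS ss' sn.
- by move=> y /Es/h.
Qed.

Lemma engel : fcodim E J -> exists t, nilpotent_mod E t.
Proof.
have sE : subspace E by apply: lspan_subspace.
move=> /(fcodim_basis sE (ideal_subspace Ji))[s [_ Es]].
(* A single factor from the intersection of E and J already puts a product into J, whence the
   exponent 1. *)
apply: (@engel_iter (size s) (E `&` J) 1 s) => //.
- by apply: subspaceI => //; apply: ideal_subspace.
- by apply: graded_setI_ideal => //; apply: graded_lspan.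
- move=> [|x w] // wJ _; rewrite big_cons; apply: ideal_mulr => //.
  by case: (wJ x (mem_head _ _)).
Qed.

End Engel.

(** * Algebras that super commute modulo an ideal *)


Lemma swap_perm_ind (T : eqType) (Q : seq T -> Prop) :
  (forall w1 a b w2, Q (w1 ++ a :: b :: w2) -> Q (w1 ++ b :: a :: w2)) ->
  forall w w', perm_eq w w' -> Q w -> Q w'.
Proof.
move=> sw.
have move1 x s : forall p r, Q (p ++ x :: s ++ r) -> Q (p ++ s ++ x :: r).
  elim: s => [|y s IH] p r // /sw; rewrite -cat_rcons => /IH.
  by rewrite cat_rcons.
have moves s1 : forall p s2 s3, Q (p ++ s1 ++ s2 ++ s3) -> Q (p ++ s2 ++ s1 ++ s3).
  elim: s1 => [|x s1 IH] p s2 s3 //.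
  by rewrite cat_cons -cat_rcons => /IH; rewrite cat_rcons => /move1.
by apply: catCA_perm_ind => s1 s2 s3; apply: (moves s1 [::]).
Qed.

Lemma pigeonhole (T : eqType) (xs w : seq T) k : {subset w <= xs} ->
  (size xs * k < size w)%N -> exists2 x, x \in xs & (k < count_mem x w)%N.
Proof.
elim: xs w => [|x xs IH] w wxs.
  by case: w wxs => // y w /(_ y (mem_head _ _)).
rewrite mulSn => lt.
have [kx|kx] := ltnP k (count_mem x w); first by exists x; rewrite ?mem_head.
have [y||y yxs ky] := IH [seq y <- w | y != x].
- by rewrite mem_filter => /andP[yx /wxs]; rewrite inE (negPf yx).
- rewrite size_filter -(ltn_add2l (count_mem x w)).
  rewrite -[X in (_ < _ + X)%N]/(count (predC (pred1 x)) w).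
  by rewrite count_predC; apply: leq_ltn_trans lt; rewrite leq_add2r.
exists y; first by rewrite inE yxs orbT.
apply: leq_trans ky _; rewrite count_filter; apply: sub_count => z /= /andP[].
by [].
Qed.

Lemma perm_nseq (T : eqType) (x : T) k w : (k <= count_mem x w)%N ->
  exists r, perm_eq w (nseq k x ++ r) /\ {subset r <= w}.
Proof.
elim: k w => [|k IH] w kw; first by exists w; split.
have xw : x \in w by rewrite -has_pred1 has_count; apply: leq_trans kw.
have [|r [pr sr]] := IH (rem x w).
  by rewrite count_mem_rem eqxx subn1 -ltnS prednK //; apply: leq_trans kw.
exists r; split; last by move=> y /sr/mem_rem.
by rewrite (permPl (perm_to_rem xw)) /= perm_cons.
Qed.

Section GeneratedAlgebra.
Variables (F : fieldType) (R : algType F).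
Hypothesis two_neq0 : (2%:R : F) != 0.
Variable V : bool -> set R.

(* the homogeneous components of the subalgebra generated by V                *)
Inductive gen_alg : bool -> R -> Prop :=
  | gen_alg0 b : gen_alg b 0
  | gen_alg1 : gen_alg false 1
  | gen_algL b a x y : gen_alg b x -> gen_alg b y -> gen_alg b (a *: x + y)
  | gen_algM i j v c : V i v -> gen_alg j c -> gen_alg (i (+) j) (v * c).

Lemma gen_alg_subspace b : subspace (gen_alg b).
Proof. by split=> [|a x y]; [apply: gen_alg0|apply: gen_algL]. Qed.

Lemma gen_alg_gen b v : V b v -> gen_alg b v.
Proof. by move=> Vv; rewrite -[v]mulr1 -[b]addbF; apply: gen_algM => //;
  apply: gen_alg1. Qed.

Lemma gen_alg_mul i j c c' : gen_alg i c -> gen_alg j c' -> gen_alg (i (+) j) (c * c').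
Proof.
move=> Cc Cc'; elim: Cc => {i c} [b||b a x y _ IHx _ IHy|i k v c Vv _ IH].
- by rewrite mul0r; apply: gen_alg0.
- by rewrite mul1r.
- by rewrite mulrDl -scalerAl; apply: gen_algL.
- by rewrite -mulrA -addbA; apply: gen_algM.
Qed.

Variable P : set R.
Hypothesis Pi : two_sided_ideal P.
Let sP : subspace P. Proof. exact: ideal_subspace. Qed.

Lemma com_sym e x y : P (sbr e x y) -> P (sbr e y x).
Proof.
by move=> h; rewrite sbrC; apply: subspaceN => //; apply: subspace_scale.
Qed.

Lemma comMl i j k x y z : P (sbr (i && k) x z) -> P (sbr (j && k) y z) ->
  P (sbr ((i (+) j) && k) (x * y) z).
Proof.
move=> Px Py; rewrite (_ : sbr _ _ _ = x * sbr (j && k) y z +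
   (-1) ^+ (j && k) *: (sbr (i && k) x z * y)).
  exact: (idealD Pi (ideal_mull _ Pi Py) (subspace_scale _ sP (ideal_mulr _ Pi Px))).
by rewrite /sbr; case: i j k {Px Py} => [] [] [] /=;
  rewrite ?(expr1, expr0, scaleN1r, scale1r); nring.
Qed.

Hypothesis PV : forall i j v v', V i v -> V j v' -> P (sbr (i && j) v v').

Lemma com_gen i j c c' : gen_alg i c -> gen_alg j c' -> P (sbr (i && j) c c').
Proof.
have P0 : P 0 by case: Pi.
have com1 e z : (e = false) -> P (sbr e 1 z).
  by move=> ->; rewrite /sbr mul1r mulr1 expr0 scale1r subrr.
have comL e x y z a : P (sbr e x z) -> P (sbr e y z) -> P (sbr e (a *: x + y) z).
  by move=> Px Py; rewrite (sbr_linl _ _); case: sP => _; apply.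
have com0 e z : P (sbr e 0 z) by rewrite (lin0 (sbr_linl _ _)).
have comV k v d : V k v -> forall l, gen_alg l d -> P (sbr (l && k) d v).
  move=> Vv l Cd; elim: Cd => {l d} [b||b a x y _ IHx _ IHy|i' l w d Vw _ IH] //.
  - exact: com1.
  - exact: comL.
  - by apply: comMl => //; apply: PV.
move=> Cc Cc'; elim: Cc => {i c} [b||b a x y _ IHx _ IHy|i k v c Vv _ IH] //.
- exact: com1.
- exact: comL.
apply: comMl => //; apply: com_sym; rewrite andbC; exact: comV.
Qed.

Lemma com_even x y : gen_alg false x -> gen_alg false y -> P (x * y - y * x).
Proof. by move=> Cx Cy; have := com_gen Cx Cy; rewrite /sbr expr0 scale1r. Qed.

Lemma odd_square x : gen_alg true x -> P (x * x).
Proof.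
move=> Cx; have := com_gen Cx Cx; rewrite /sbr expr1 scaleN1r opprK => h.
by rewrite -[x * x](scalerK two_neq0) scaler_nat mulr2n; apply: subspace_scale.
Qed.

Lemma congX x y n : P (x - y) -> P (x ^+ n - y ^+ n).
Proof.
move=> Pxy; elim: n => [|n IH]; first by rewrite !expr0 subrr; case: Pi.
rewrite !exprS (_ : _ - _ = (x - y) * x ^+ n + y * (x ^+ n - y ^+ n)); last by nring.
exact: (idealD Pi (ideal_mulr _ Pi Pxy) (ideal_mull _ Pi IH)).
Qed.

Lemma com_exp x y n : P (x * y - y * x) -> P (x * y ^+ n - y ^+ n * x).
Proof.
move=> Pxy; elim: n => [|n IH]; first by rewrite !expr0 mulr1 mul1r subrr; case: Pi.
rewrite !exprS (_ : _ - _ = (x * y - y * x) * y ^+ n + y * (x * y ^+ n - y ^+ n * x)).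
  exact: (idealD Pi (ideal_mulr _ Pi Pxy) (ideal_mull _ Pi IH)).
by nring.
Qed.

Lemma com_exprM x y n : P (x * y - y * x) -> P ((x * y) ^+ n - x ^+ n * y ^+ n).
Proof.
move=> Pxy; elim: n => [|n IH]; first by rewrite !expr0 mulr1 subrr; case: Pi.
have Pyx : P (y * x - x * y) by rewrite -opprB; apply: subspaceN.
rewrite !exprS (_ : _ - _ = x * y * ((x * y) ^+ n - x ^+ n * y ^+ n) +
   x * (y * x ^+ n - x ^+ n * y) * y ^+ n); last by nring.
apply: idealD => //; first exact: ideal_mull.
by apply: ideal_mulr => //; apply: ideal_mull => //; apply: com_exp.
Qed.

Lemma binomial_mod x y n : P (x * y - y * x) ->
  P ((x + y) ^+ n - \sum_(k < n.+1) 'C(n, k)%:R *: (x ^+ k * y ^+ (n - k))).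
Proof.
move=> Pxy; elim: n => [|n IH].
  by rewrite big_ord1 !expr0 mulr1 scale1r subrr; case: Pi.
rewrite exprS -(pascal_sum n (fun k l => x ^+ k * y ^+ l)).
set S := \sum_(k < n.+1) _ in IH.
have -> : \sum_(k < n.+1) 'C(n, k)%:R *: (x ^+ k.+1 * y ^+ (n - k)) = x * S.
  by rewrite mulr_sumr; apply: eq_bigr => k _; rewrite exprS -scalerAr mulrA.
set S' := \sum_(k < n.+1) _.
rewrite (_ : _ - _ = (x + y) * ((x + y) ^+ n - S) + (y * S - S')); last by nring.
apply: idealD => //; first exact: ideal_mull.
rewrite mulr_sumr -sumrB; apply: subspace_sum => // k _.
rewrite -scalerAr -scalerBr; apply: subspace_scale => //.
rewrite exprS !mulrA -mulrBl; apply: ideal_mulr => //.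
by apply: com_exp; rewrite -opprB; apply: subspaceN.
Qed.

Variable p : nat.
Hypothesis charF : p \in [pchar F].

Lemma Frobenius_mod x y e : gen_alg false x -> gen_alg false y ->
  P ((x + y) ^+ (p ^ e) - (x ^+ (p ^ e) + y ^+ (p ^ e))).
Proof.
move=> Cx Cy.
have CX z n : gen_alg false z -> gen_alg false (z ^+ n).
  move=> Cz; elim: n => [|n IH]; first exact: gen_alg1.
  by rewrite exprS; apply: (gen_alg_mul Cz IH).
elim: e => [|e IH]; first by rewrite expn0 !expr1 subrr; case: Pi.
rewrite expnSr !exprM.
have h1 := congX p IH.
have h2 := binomial_mod p (com_even (CX x (p ^ e)%N Cx) (CX y (p ^ e)%N Cy)).
rewrite (sum_binomial_pchar (fun k => (x ^+ (p ^ e)) ^+ k * (y ^+ (p ^ e)) ^+ (p - k)))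
  // in h2.
rewrite subnn subn0 !expr0 mulr1 mul1r in h2.
rewrite -[X in P X](subrKA ((x ^+ (p ^ e) + y ^+ (p ^ e)) ^+ p)).
by apply: idealD => //; rewrite [X in _ - X]addrC.
Qed.

Variables (X : bool -> set R) (e : nat).
Hypothesis e_gt0 : (0 < e)%N.
Hypothesis XV : forall b, X b `<=` V b.
Hypothesis Xnil : forall s, X false s -> P (s ^+ (p ^ e)).

Definition nil_part b : set R := lspan [set y | exists i j c s,
  [/\ gen_alg i c, X j s, i (+) j = b & y = c * s]].

Lemma nil_part_gen b : nil_part b `<=` gen_alg b.
Proof.
apply: lspan_min; first exact: gen_alg_subspace.
move=> _ [i [j [c [s [Cc Xs <- ->]]]]].
by apply: gen_alg_mul => //; apply: gen_alg_gen; apply: XV.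
Qed.

Lemma two_le_pe : (2 <= p ^ e)%N.
Proof.
have /andP[/prime_gt1 p1 _] := charF.
by rewrite -(prednK e_gt0) expnS; apply: (leq_trans p1);
  rewrite leq_pmulr // expn_gt0 (ltnW p1).
Qed.

(** An odd element has its square in P. For even ones Frobenius reduces to a product c s: with even
    factors its power is c ^ (p ^ e) s ^ (p ^ e) modulo P, and with odd factors already (c s) ^ 2 is
    - c ^ 2 s ^ 2, which lies in P. *)
Lemma nil_part_nil b g : nil_part b g -> P (g ^+ (p ^ e)).
Proof.
case: b => Kg.
  apply: (ideal_exp_le Pi two_le_pe); rewrite expr2.
  exact: odd_square (nil_part_gen Kg).
suff : gen_alg false g /\ P (g ^+ (p ^ e)) by case.
move: Kg; apply: (@lspan_min _ _ _ [set g | gen_alg false g /\ P (g ^+ (p ^ e))]).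
  split=> [|a x y [Cx Px] [Cy Py]]; split; try exact: gen_alg0.
  - by rewrite expr0n -leqn0 leqNgt (ltnW two_le_pe); case: Pi.
  - exact: gen_algL.
  have Cax : gen_alg false (a *: x) by apply: subspace_scale => //;
    apply: gen_alg_subspace.
  have := Frobenius_mod e Cax Cy; set u := _ ^+ _ => h.
  rewrite -[u](subrK ((a *: x) ^+ (p ^ e) + y ^+ (p ^ e))).
  apply: idealD => //; apply: idealD => //.
  by rewrite exprZn; apply: subspace_scale.
move=> _ [i [j [c [s [Cc Xs ij ->]]]]].
have Cs := gen_alg_gen (XV Xs); split; first by rewrite -ij; apply: gen_alg_mul.
case: i j ij Cc Xs Cs => [] [] // _ Cc Xs Cs; last first.
  have := com_exprM (p ^ e) (com_even Cc Cs); set u := _ ^+ _ => h.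
  rewrite -[u](subrK (c ^+ (p ^ e) * s ^+ (p ^ e))).
  by apply: idealD => //; apply: ideal_mull => //; apply: Xnil.
apply: (ideal_exp_le Pi two_le_pe).
have h := com_gen Cs Cc; rewrite /sbr expr1 scaleN1r opprK in h.
rewrite (_ : (c * s) ^+ 2 = c * (s * c + c * s) * s - c * c * (s * s)).
  apply: subspaceB => //; last by apply: ideal_mull => //; apply: odd_square.
  by apply: ideal_mulr => //; apply: ideal_mull.
by rewrite expr2; nring.
Qed.

(* Elements of the nil part super commute modulo P. *)
Lemma nil_product_mod (L : eqType) (par : L -> bool) (val : L -> R) (ls w : seq L) :
  (forall x, x \in ls -> nil_part (par x) (val x)) -> {subset w <= ls} ->
  (size ls * p ^ e < size w)%N -> P (\prod_(x <- w) val x).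
Proof.
move=> lsK wls sz.
pose Q (w : seq L) := {subset w <= ls} -> P (\prod_(x <- w) val x).
have [x xls /ltnW xw] := pigeonhole wls sz.
have [r [pr _]] := perm_nseq xw.
suff hQ : Q w by apply: hQ.
have prs : perm_eq (nseq (p ^ e) x ++ r) w by rewrite perm_sym.
apply: (@swap_perm_ind _ Q _ _ _ prs); last first.
  move=> _; rewrite big_cat; apply: ideal_mulr => //; rewrite big_nseq.
  have -> : iter (p ^ e) ( *%R (val x)) 1 = val x ^+ (p ^ e).
    by elim: (p ^ e)%N => // n IH; rewrite iterS IH exprS.
  exact: nil_part_nil (lsK x xls).
move=> w1 a b w2 h sub.
have al : a \in ls by apply: sub; rewrite mem_cat !inE eqxx !orbT.
have bl : b \in ls by apply: sub; rewrite mem_cat !inE eqxx !orbT.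
have hab : P (\prod_(x <- w1 ++ a :: b :: w2) val x).
  apply: h => z; rewrite mem_cat !inE => zin; apply: sub; rewrite mem_cat !inE.
  by case/or4P: zin => ->; rewrite ?orbT.
have := com_gen (nil_part_gen (lsK b bl)) (nil_part_gen (lsK a al));
  rewrite /sbr => hc.
rewrite big_cat !big_cons /= in hab; rewrite big_cat !big_cons /=.
set W1 := \prod_(x <- w1) _ in hab *; set W2 := \prod_(x <- w2) _ in hab *.
rewrite [X in P X](_ : _ =
  W1 * (val b * val a - (-1) ^+ (par b && par a) *: (val a * val b)) * W2
   + (-1) ^+ (par b && par a) *: (W1 * (val a * (val b * W2)))).
  apply: idealD => //; last exact: subspace_scale.
  by apply: ideal_mulr => //; apply: ideal_mull.
by case: (_ && _); rewrite ?(expr1, expr0, scaleN1r, scale1r); nring.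
Qed.

End GeneratedAlgebra.

(** * R as a finitely generated module over the algebra generated by V *)

Section FiniteGeneration.
Variables (F : fieldType) (R : algType F).
Hypothesis two_neq0 : (2%:R : F) != 0.
Variables (p : nat) (G V : bool -> set R).
Hypothesis charF : p \in [pchar F].
Hypothesis p_gt2 : (2 < p)%N.
Hypothesis generated : forall Q : set R, (forall a, Q (a *: 1)) ->
  (forall b x, G b x -> Q x) -> (forall x y, Q x -> Q y -> Q (x + y)) ->
  (forall x y, Q x -> Q y -> Q (x * y)) -> forall x, Q x.
Hypothesis sG : forall b, subspace (G b).
Hypothesis GG : forall i j x y, G i x -> G j y -> G (i (+) j) (sbr (i && j) x y).
Hypothesis Gp : forall x, G false x -> G false (x ^+ p).
Hypothesis sV : forall b, subspace (V b).
Hypothesis VG : forall b, V b `<=` G b.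
Hypothesis VI : forall i j g v, G i g -> V j v -> V (i (+) j) (sbr (i && j) g v).
Hypothesis cV : forall b, fcodim (G b) (V b).
Local Notation C := (gen_alg V).
Local Notation wp w := (\prod_(x <- w) x).

Section Letters.
Variable xs : seq R.
Hypothesis xsG : forall x, x \in xs -> exists b, G b x.
Hypothesis Gxs : forall b, G b `<=` spn (V b) xs.

(** A filtration of R by the number of coset representatives standing to the left of C; it becomes
    stationary by [fil_stable]. *)
Definition fil n : set R := lspan [set y | exists (w : seq R) c b,
  [/\ {subset w <= xs}, (size w <= n)%N, C b c & y = wp w * c]].

Lemma fil_subspace n : subspace (fil n).
Proof. exact: lspan_subspace. Qed.

Lemma fil_gen w c b : {subset w <= xs} -> C b c -> fil (size w) (wp w * c).
Proof. by move=> wx Cc; apply: lspan_gen; exists w, c, b. Qed.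

Lemma fil_mono m n : (m <= n)%N -> fil m `<=` fil n.
Proof.
move=> mn; apply: lspan_min; first exact: fil_subspace.
move=> _ [w [c [b [wx sw Cc ->]]]]; apply: lspan_gen; exists w, c, b.
by split=> //; apply: leq_trans mn.
Qed.

Lemma fil_min n (W : set R) : subspace W ->
  (forall w c b, {subset w <= xs} -> (size w <= n)%N -> C b c -> W (wp w * c)) ->
  fil n `<=` W.
Proof.
move=> sW h; apply: lspan_min => // _ [w [c [b [wx sw Cc ->]]]].
exact: (h _ _ _ wx sw Cc).
Qed.

Lemma fil_alg n b c : C b c -> fil n c.
Proof.
move=> Cc; apply: (fil_mono (leq0n n)); have := @fil_gen [::] c b.
by rewrite big_nil mul1r; apply.
Qed.

Lemma fil_mul_letter n x f : x \in xs -> fil n f -> fil n.+1 (x * f).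
Proof.
move=> xx; apply: (@fil_min n ((fun f => x * f) @^-1` fil n.+1)).
  by apply: subspace_preim (mulr_linear x) _; apply: fil_subspace.
move=> w c b wx sw Cc; rewrite /= (_ : x * (wp w * c) = wp (x :: w) * c);
  last by rewrite big_cons mulrA.
apply: (@fil_mono (size (x :: w))) => //; apply: fil_gen Cc.
by move=> y; rewrite inE => /predU1P[->|/wx].
Qed.

Lemma VI_sym i j g v : G i g -> V j v -> V (j (+) i) (sbr (j && i) v g).
Proof.
move=> Gg Vv; rewrite sbrC [j && i]andbC addbC; apply: subspaceN => //.
by apply: subspace_scale => //; apply: VI.
Qed.

(** Moving v past a letter x costs the bracket [v, x], which lies in V again and stands before a
    shorter word. *)
Lemma fil_mulV n i v f : V i v -> fil n f -> fil n (v * f).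
Proof.
move=> Vv; apply: (@fil_min n ((fun f => v * f) @^-1` fil n)).
  by apply: subspace_preim (mulr_linear v) _; apply: fil_subspace.
move=> w c b wx sw Cc; apply: (fil_mono sw) => /=.
elim: w i v Vv wx {sw} => [|x w IH] i v Vv wx.
  by rewrite big_nil mul1r; apply: (@fil_alg _ (i (+) b)); apply: gen_algM.
have xx : x \in xs by apply: wx; rewrite mem_head.
have wx' : {subset w <= xs} by move=> y yw; apply: wx; rewrite inE yw orbT.
have [j Gx] := xsG xx.
rewrite big_cons (_ : v * (x * wp w * c) = (-1) ^+ (i && j) *: (x * (v * (wp w * c)))
   + sbr (i && j) v x * (wp w * c)).
  apply: (subspaceD (fil_subspace _)).
    apply: (subspace_scale _ (fil_subspace _)).
    by apply: fil_mul_letter => //; apply: (IH i).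
  apply: (fil_mono (leqnSn _)); apply: (IH (i (+) j)) => //; exact: VI_sym.
by rewrite /sbr; case: (i && j); rewrite ?(expr1, expr0, scaleN1r, scale1r); nring.
Qed.

Lemma fil_mulG n i g f : G i g -> fil n f -> fil n.+1 (g * f).
Proof.
move=> /Gxs gs ff; move: gs; apply: (@spn_min _ _ _ _ ((fun g => g * f) @^-1` fil n.+1)).
- by apply: subspace_preim (mull_linear f) _; apply: fil_subspace.
- by move=> v Vv; apply: (fil_mono (leqnSn n)); apply: (fil_mulV Vv ff).
- by move=> x xx; apply: fil_mul_letter.
Qed.

Lemma fil_prodG n w f : (forall x, x \in w -> exists b, G b x) -> fil n f ->
  fil (size w + n) (wp w * f).
Proof.
elim: w => [|x w IH] wG ff; first by rewrite big_nil mul1r.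
have [b Gx] := wG x (mem_head _ _).
rewrite big_cons -mulrA addSn; apply: (fil_mulG Gx); apply: IH => // y yw.
by apply: wG; rewrite inE yw orbT.
Qed.

(* Modulo shorter words the letters commute up to sign, so some letter x can  *)
(* be made to occur p times in a row; x ^ p is a shorter word, as x ^ p is in *)
(* G 0 for x even and x x = [x, x] / 2 is in G 0 for x odd.                   *)
Lemma fil_stable n : (size xs * p <= n)%N -> fil n.+1 `<=` fil n.
Proof.
move=> nbig; have sF := fil_subspace n.
apply: fil_min => // w c b wx; rewrite leq_eqVlt => /orP[/eqP sw|sw] Cc; last first.
  by apply: (fil_mono (sw : (size w <= n)%N)); apply: fil_gen Cc.
pose Q (w : seq R) := {subset w <= xs} -> size w = n.+1 -> fil n (wp w * c).
have [|x xx /ltnW xw] := @pigeonhole _ xs w p wx; first by rewrite sw.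
have [r [pr rw]] := perm_nseq xw.
have prs : perm_eq (nseq p x ++ r) w by rewrite perm_sym.
have one_c : fil 0 c by apply: fil_alg Cc.
suff : Q w by apply.
apply: (@swap_perm_ind _ Q _ _ _ prs); last first.
  move=> _ szr; rewrite size_cat size_nseq in szr.
  have pr_le : (size r = n.+1 - p)%N by rewrite -szr addKn.
  have rG y : y \in r -> exists b, G b y by move=> /rw/wx/xsG.
  have fr : fil (n.+1 - p) (wp r * c).
    by rewrite -pr_le -[size r]addn0; apply: fil_prodG.
  have pn : (p <= n.+1)%N by rewrite -szr leq_addr.
  rewrite big_cat /= -mulrA big_nseq.
  have -> : iter p ( *%R x) 1 = x ^+ p.
    by elim: (p) => // k IH; rewrite iterS IH exprS.
  have [[] Gx] := xsG xx; last first.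
    apply: (@fil_mono (n.+1 - p).+1); first by clear - pn p_gt2; lia.
    exact: fil_mulG (Gp Gx) fr.
  have Gxx : G false (x * x).
    rewrite -[x * x](scalerK two_neq0); apply: subspace_scale => //.
    have := GG Gx Gx; rewrite /sbr expr1 scaleN1r opprK -mulr2n -scaler_nat.
    by [].
  have -> : x ^+ p = wp (x * x :: nseq (p - 2) x).
    rewrite big_cons big_nseq -expr2 -[X in x ^+ X](subnKC (ltnW p_gt2)) exprD.
    by congr (_ * _); elim: (p - 2)%N => // k IH; rewrite iterS -IH exprS.
  apply: (@fil_mono (size (x * x :: nseq (p - 2) x) + (n.+1 - p))).
    by rewrite /= size_nseq; clear - pn p_gt2; lia.
  apply: fil_prodG => // y; rewrite inE => /predU1P[->|]; first by exists false.
  by rewrite mem_nseq => /andP[_ /eqP ->]; exists true.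
move=> w1 x1 x2 w2 h sub szw.
have x1G : exists b, G b x1 by apply/xsG/sub; rewrite mem_cat !inE eqxx !orbT.
have x2G : exists b, G b x2 by apply/xsG/sub; rewrite mem_cat !inE eqxx !orbT.
have [i G1] := x1G; have [j G2] := x2G.
have {}h : fil n (wp (w1 ++ x1 :: x2 :: w2) * c).
  apply: h; last by rewrite -szw !size_cat.
  move=> z; rewrite mem_cat !inE => zin; apply: sub; rewrite mem_cat !inE.
  by case/or4P: zin => ->; rewrite ?orbT.
have hb : fil n (wp (w1 ++ sbr (j && i) x2 x1 :: w2) * c).
  rewrite (_ : n = size (w1 ++ sbr (j && i) x2 x1 :: w2) + 0)%N; last first.
    by move: szw; rewrite !size_cat /= addn0 !addnS => -[].
  apply: fil_prodG => // z; rewrite mem_cat inE => /or3P[zw|/eqP ->|zw].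
  - by apply/xsG/sub; rewrite mem_cat zw.
  - by exists (j (+) i); apply: GG.
  - by apply/xsG/sub; rewrite mem_cat !inE zw !orbT.
rewrite big_cat !big_cons /= in h; rewrite big_cat !big_cons /= in hb.
rewrite big_cat !big_cons /=.
set W1 := \prod_(y <- w1) _ in h hb *; set W2 := \prod_(y <- w2) _ in h hb *.
rewrite [X in fil n X](_ : _ = W1 * (sbr (j && i) x2 x1 * W2) * c +
   (-1) ^+ (j && i) *: (W1 * (x1 * (x2 * W2)) * c)).
  exact: (subspaceD sF hb (subspace_scale _ sF h)).
by rewrite /sbr; case: (j && i); rewrite ?(expr1, expr0, scaleN1r, scale1r); nring.
Qed.

Lemma fil_full r : fil (size xs * p) r.
Proof.
set N := (size xs * p)%N.
have stable n : fil n `<=` fil N.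
  have [nN|Nn] := leqP n N; first exact: fil_mono.
  elim: n Nn => // n IH; rewrite ltnS leq_eqVlt => /predU1P[<-|Nn].
    exact: fil_stable.
  by move=> x /(fil_stable (ltnW Nn)); apply: IH.
have f1 : fil N 1.
  exact: fil_alg (gen_alg1 V).
suff h : forall f, fil N f -> fil N (r * f) by rewrite -[r]mulr1; apply: h.
apply: (generated (Q := fun r => forall f, fil N f -> fil N (r * f))) r => //.
- by move=> a f ff; rewrite -scalerAl mul1r;
  exact: (subspace_scale _ (fil_subspace _) ff).
- by move=> b x Gx f ff; apply: (stable N.+1); apply: (fil_mulG Gx ff).
- move=> x y hx hy f ff; rewrite mulrDl; apply: (subspaceD (fil_subspace _)).
    exact: hx.
  exact: hy.
- by move=> x y hx hy f ff; rewrite -mulrA; exact: (hx _ (hy _ ff)).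
Qed.

End Letters.

Fixpoint words (xs : seq R) n : seq (seq R) :=
  if n is n'.+1 then [::] :: [seq x :: w | x <- xs, w <- words xs n'] else [:: [::]].

Lemma mem_words xs n w : {subset w <= xs} -> (size w <= n)%N -> w \in words xs n.
Proof.
elim: n w => [|n IH] [|x w] //= wx sw; rewrite inE; apply/orP; right.
apply/allpairsP; exists (x, w); split=> //=; first by apply: wx; rewrite mem_head.
by apply: IH => // y yw; apply: wx; rewrite inE yw orbT.
Qed.

(** Coefficients are kept as an even and an odd part, since super commutation is only available for
    homogeneous elements. *)
Definition representable (es : seq R) (K : bool -> set R) : set R :=
  [set r | exists k : bool -> nat -> R, (forall b n, K b (k b n)) /\
    r = \sum_(n < size es) es`_n * (k false n + k true n)].

Lemma representable_subspace es K : (forall b, subspace (K b)) ->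
  subspace (representable es K).
Proof.
move=> sK; split.
  exists (fun _ _ => 0); split; first by move=> b n; case: (sK b).
  by rewrite big1 // => n _; rewrite addr0 mulr0.
move=> a _ _ [k [kK ->]] [l [lK ->]].
exists (fun b n => a *: k b n + l b n); split.
  by move=> b n; case: (sK b) => _; apply.
rewrite scaler_sumr -big_split; apply: eq_bigr => n _ /=.
by rewrite !mulrDr -!scalerAr scalerDr; abel.
Qed.

Lemma representable_gen es K b x y : (forall b, subspace (K b)) -> x \in es -> K b y ->
  representable es K (x * y).
Proof.
move=> sK xes Ky.
exists (fun b' n => if (n == index x es) && (b' == b) then y else 0); split.
  by move=> b' n; case: andP => [[_ /eqP ->] //|_]; case: (sK b').
have lt : (index x es < size es)%N by rewrite index_mem.
rewrite (bigD1 (Ordinal lt)) //= eqxx nth_index // big1 ?addr0.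
  by case: b {Ky}; rewrite /= ?add0r ?addr0.
move=> n; rewrite -val_eqE /= => /negPf ->; rewrite /= addr0 mulr0.
by [].
Qed.

(* R is a finitely generated right C-module. *)
Lemma finitely_generated : exists es : seq R,
  es`_0 = 1 /\ (0 < size es)%N /\ forall r, representable es C r.
Proof.
have [t0 [t0G G0]] := fcodim_basis (sG false) (sV false) (cV false).
have [t1 [t1G G1]] := fcodim_basis (sG true) (sV true) (cV true).
pose xs := t0 ++ t1.
have xsG x : x \in xs -> exists b, G b x.
  by rewrite mem_cat => /orP[/t0G|/t1G]; [exists false|exists true].
have Gxs b : G b `<=` spn (V b) xs.
  case: b => x; [move/G1|move/G0]; apply: spn_mono => // y; try by move=> [].
    by move=> yt; rewrite mem_cat yt orbT.
  by move=> yt; rewrite mem_cat yt.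
pose N := (size xs * p)%N.
exists [seq wp w | w <- words xs N].
have w0 : nth 0 [seq wp w | w <- words xs N] 0 = 1 by case: N => [|n] /=;
  rewrite big_nil.
have sw : (0 < size [seq wp w | w <- words xs N])%N by case: N {w0}.
split=> //; split=> // r; have := fil_full xsG Gxs r.
have sC b : subspace (C b) by apply: gen_alg_subspace.
apply: fil_min; first exact: representable_subspace.
move=> w c b wx szw Cc; apply: (representable_gen sC _ Cc).
by apply/mapP; exists w => //; apply: mem_words.
Qed.

Variables (P : set R) (X : bool -> set R) (e : nat).
Hypothesis Pi : two_sided_ideal P.
Hypothesis PV : forall i j v v', V i v -> V j v' -> P (sbr (i && j) v v').
Hypothesis e_gt0 : (0 < e)%N.
Hypothesis XV : forall b, X b `<=` V b.
Hypothesis Xnil : forall s, X false s -> P (s ^+ (p ^ e)).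
Local Notation J := (left_span (X false `|` X true)).
Local Notation K := (nil_part V X).
Hypothesis Ji : two_sided_ideal J.

Lemma J_representable es : (forall r, representable es C r) ->
  J `<=` representable es K.
Proof.
move=> esC.
have sK b : subspace (K b) by apply: lspan_subspace.
apply: left_span_ind; first exact: representable_subspace.
move=> r s Xs.
have [j Xj] : exists j, X j s by case: Xs => ?; [exists false|exists true].
have [k [kC ->]] := esC r.
exists (fun b n => k (b (+) j) n * s); split.
  move=> b n; apply: lspan_gen; exists (b (+) j), j, (k (b (+) j) n), s; split=> //.
  by rewrite -addbA addbb addbF.
rewrite mulr_suml; apply: eq_bigr => n _; rewrite -mulrA mulrDl; congr (_ * _).
by case: j {Xj} => //=; rewrite addrC.
Qed.

(* An element of J acts on the generators of the C-module R by a finite       *)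
(* matrix with entries in the nil part of C.                                  *)
Lemma J_nil_mod : exists n, forall a, J a -> P (a ^+ n).
Proof.
have [es [es0 [es_gt0 esC]]] := finitely_generated.
have JK := J_representable esC.
pose Q := size es.
(* The labels of the matrix entries: column, parity of the component, row. By [nil_product_mod], a
   product of more than [size ls * p ^ e] entries lies in P. *)
pose ls : seq (nat * (bool * nat)) :=
  [seq (m, y) | m <- iota 0 Q, y <- [seq (b, k) | b <- [:: false; true], k <- iota 0 Q]].
exists (size ls * p ^ e).+1 => a Ja.
have /choice[k kP] : forall m, exists k : bool -> nat -> R,
  (forall b n, K b (k b n)) /\
    a * es`_m = \sum_(n < Q) es`_n * (k false n + k true n).
  by move=> m; exact: (JK _ (ideal_mulr _ Ji Ja)).
pose val (x : nat * (bool * nat)) := k x.1 x.2.1 x.2.2.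
have lsK x : x \in ls -> K x.2.1 (val x) by move=> _; case: (kP x.1) => h _; apply: h.
have mem_ls m b n : (m < Q)%N -> (n < Q)%N -> (m, (b, n)) \in ls.
  move=> mQ nQ; apply: allpairs_f; first by rewrite mem_iota.
  by apply: allpairs_f; [case: (b)|rewrite mem_iota].
pose W n : set R := lspan [set y | exists m (w : seq (nat * (bool * nat))),
  [/\ (m < Q)%N, {subset w <= ls}, size w = n & y = es`_m * \prod_(x <- w) val x]].
(* Since the first generator is 1, a ^ n is the image of a generator under n multiplications by a,
   each of which contributes one matrix entry. *)
have Wn n : W n (a ^+ n).
  elim: n => [|n IH].
    by apply: lspan_gen; exists 0, [::]; split=> //; rewrite big_nil es0 mulr1.
  rewrite exprS; move: IH.
  apply: (@lspan_min _ _ _ ((fun y => a * y) @^-1` W n.+1)).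
    by apply: subspace_preim (mulr_linear a) _; apply: lspan_subspace.
  move=> _ [m [w [mQ wls sw ->]]] /=; rewrite mulrA; case: (kP m) => _ ->.
  rewrite mulr_suml; apply: (subspace_sum _ (lspan_subspace _)) => n' _.
  rewrite -mulrA mulrDl mulrDr.
  have mem b : W n.+1 (es`_n' * (k m b n' * \prod_(x <- w) val x)).
    apply: lspan_gen; exists n', ((m, (b, n' : nat)) :: w); split=> //.
    - by move=> y; rewrite inE => /predU1P[->|/wls //]; apply: mem_ls.
    - by rewrite /= sw.
    - by rewrite big_cons.
  exact: (subspaceD (lspan_subspace _) (mem false) (mem true)).
have := Wn (size ls * p ^ e).+1; apply: lspan_min; first exact: ideal_subspace.
move=> _ [m [w [mQ wls sw ->]]]; apply: ideal_mull => //.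
apply: (nil_product_mod two_neq0 Pi PV charF e_gt0 XV Xnil lsK wls).
by rewrite sw.
Qed.

End FiniteGeneration.

(** * The commutator ideal *)


Lemma sbr_jacobi (F : fieldType) (R : algType F) i j k (x y z : R) :
  sbr (i && (j (+) k)) x (sbr (j && k) y z) =
  sbr ((i (+) j) && k) (sbr (i && j) x y) z
  + (-1) ^+ (i && j) *: sbr (j && (i (+) k)) y (sbr (i && k) x z).
Proof.
by rewrite /sbr; case: i j k => [] [] [];
  rewrite /= ?(expr1, expr0, scaleN1r, scale1r); nring.
Qed.

Section Assembly.
Variables (F : fieldType) (R : algType F).
Hypothesis two_neq0 : (2%:R : F) != 0.
Variables (p e : nat) (G : bool -> set R) (theta : R -> R).
Hypothesis charF : p \in [pchar F].
Hypothesis p_gt2 : (2 < p)%N.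
Hypothesis e_gt0 : (0 < e)%N.
Hypothesis thetaL : is_linear theta.
Hypothesis thetaM : forall r s, theta (r * s) = theta r * theta s.
Hypothesis thetaG : forall b x, G b x -> theta x = (-1) ^+ b *: x.
Hypothesis generated : forall Q : set R, (forall a, Q (a *: 1)) ->
  (forall b x, G b x -> Q x) -> (forall x y, Q x -> Q y -> Q (x + y)) ->
  (forall x y, Q x -> Q y -> Q (x * y)) -> forall x, Q x.
Hypothesis sG : forall b, subspace (G b).
Hypothesis GG : forall i j x y, G i x -> G j y -> G (i (+) j) (sbr (i && j) x y).
Hypothesis Gp : forall x, G false x -> G false (x ^+ p).

(** For g in G and x in X, the product x g equals g x - [g, x] up to sign, so right multiplication
    preserves R X. *)
Lemma graded_left_span_ideal (X : bool -> set R) :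
  (forall i j g s, G i g -> X j s -> X (i (+) j) (sbr (i && j) g s)) ->
  two_sided_ideal (left_span (X false `|` X true)).
Proof.
move=> XI; apply: left_span_ideal => x r; move: r x.
have sub b x : X b x -> (X false `|` X true) x by case: b; [right|left].
apply: (generated (Q := fun r => forall x, (X false `|` X true) x ->
  left_span (X false `|` X true) (x * r))).
- by move=> a x Xx; rewrite -scalerAr mulr1 -[x]mul1r scalerAl; apply: left_span_gen.
- move=> i g Gg x Xx.
  have [j Xj] : exists j, X j x by case: Xx => ?; [exists false|exists true].
  have sL : subspace (left_span (X false `|` X true)) by apply: lspan_subspace.
  rewrite (_ : x * g = (-1) ^+ (i && j) *: (g * x - sbr (i && j) g x)).
    apply: (subspace_scale _ sL); apply: (subspaceB sL); first exact: left_span_gen.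
    by apply: left_span_sub; apply: sub (XI _ _ _ _ Gg Xj).
  by rewrite /sbr; case: (i && j); rewrite ?(expr1, expr0, scaleN1r, scale1r); nring.
- move=> r s hr hs x Xx; rewrite mulrDr.
  exact: (subspaceD (lspan_subspace _) (hr x Xx) (hs x Xx)).
- by move=> r s hr hs x Xx; rewrite mulrA; apply: left_spanMr hs (hr x Xx).
Qed.

(** By the Jacobi identity [u, [g, v]] is the sum of [[u, g], v] and, up to sign, [g, [u, v]]; both
    range over finite-dimensional spaces. *)
Lemma finite_adjoint_ideal i j g v : G i g -> finite_adjoint G j v ->
  finite_adjoint G (i (+) j) (sbr (i && j) g v).
Proof.
move=> Gg /finite_adjointP[Gv fv]; apply/finite_adjointP; split; first exact: GG.
move=> k.
pose ad x := (-1) ^+ (k && i) *: sbr (i && (k (+) j)) g x.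
have adL : is_linear ad.
  by move=> a x y; rewrite /ad (sbr_linr _ _) scalerDr !scalerA mulrC.
apply: fdim_sub (fdimD (fv (k (+) i)) (fdim_image adL (fv k))).
move=> _ [u Gu <-].
exists (sbr ((k (+) i) && j) (sbr (k && i) u g) v), (ad (sbr (k && j) u v)).
split; last exact: sbr_jacobi.
- by exists (sbr (k && i) u g) => //; apply: GG.
- by exists (sbr (k && j) u v) => //; exists u.
Qed.

(* the images of (L_0, L_0), (M, L_1) and M, and L_1 = M + F z                *)
Variables (D Q M : set R) (z : R).
Hypotheses (sD : subspace D) (sQ : subspace Q) (sM : subspace M).
Hypotheses (DG : D `<=` G false) (QG : Q `<=` G false) (MG : M `<=` G true).
Hypothesis brGG : forall x y, G false x -> G false y -> D (sbr false x y).
Hypothesis brG1G0 : forall x y, G true x -> G false y -> M (sbr false x y).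
Hypothesis brMG : forall x y, M x -> G true y -> Q (sbr true x y).
Hypothesis Dnil : forall x, D x -> x ^+ (p ^ e) = 0.
Hypothesis Qnil : forall x, Q x -> x ^+ (p ^ e) = 0.
Hypothesis Mz : forall y, G true y -> exists a : F, M (y - a *: z).
Hypothesis cA : forall i, fcodim (G i) (finite_adjoint G i).
Hypothesis fA : forall i j,
  fdim [set sbr (j && i) a c | a in finite_adjoint G j & c in finite_adjoint G i].

Let S b : set R := if b then M else D `|` Q.
(** In degree 1 the restriction to M, of codimension at most 1, puts brackets of two odd elements of
    V into Q, hence all brackets of V into S. *)
Let V b : set R := finite_adjoint G b `&` (if b then M else setT).
Let B := lspan [set y | exists i j a c, [/\ V i a, V j c & y = sbr (i && j) a c]].
Let X b := S b `&` V b.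
Let Y b := S b `&` B.
Let all (T : bool -> set R) := T false `|` T true.
Let I := left_span (all S).
Let J := left_span (all X).
Let P := left_span (all Y).

Let SG b : S b `<=` G b.
Proof. by case: b => x; [apply: MG|case=> [/DG|/QG]]. Qed.

Let brGM x y : G false x -> G true y -> M (sbr false x y).
Proof.
move=> Gx Gy; rewrite sbrC.
exact: (subspaceN sM (subspace_scale _ sM (brG1G0 Gy Gx))).
Qed.

Let SI i j g s : G i g -> S j s -> S (i (+) j) (sbr (i && j) g s).
Proof.
move=> Gg Ss; have Gs := SG Ss; case: i j Gg Ss Gs => [] [] Gg Ss Gs /=.
- right; rewrite sbrC expr1 scaleN1r opprK; exact: brMG.
- exact: brG1G0.
- exact: brGM.
- by left; apply: brGG.
Qed.

(** For s in M, 2 s ^ 2 is the bracket [s, s], which lies in Q; this accounts for the factor 2 in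
    the exponent. *)
Let Snil b s : S b s -> s ^+ (2 * p ^ e) = 0.
Proof.
case: b => [Ms|]; last by rewrite mulnC exprM => -[/Dnil ->|/Qnil ->]; rewrite expr0n.
have := brMG Ms (MG Ms); rewrite /sbr expr1 scaleN1r opprK => Qs.
have : Q (s * s).
  by rewrite -[s * s](scalerK two_neq0) scaler_nat mulr2n; apply: subspace_scale.
by rewrite -expr2 exprM => /Qnil.
Qed.

Let sV b : subspace (V b).
Proof.
apply: subspaceI; first exact: finite_adjoint_subspace.
by case: b => //; split.
Qed.

Let VG b : V b `<=` G b.
Proof. by move=> x [/finite_adjointP[]]. Qed.

Let VI i j g v : G i g -> V j v -> V (i (+) j) (sbr (i && j) g v).
Proof.
move=> Gg Vv; split; first by apply: finite_adjoint_ideal => //; case: Vv.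
have Gv := VG Vv; case: i j Gg Vv Gv => [] [] //= Gg Vv Gv.
- exact: brG1G0.
- exact: brGM.
Qed.

Let cV b : fcodim (G b) (V b).
Proof.
have sF := finite_adjoint_subspace sG.
case: b; last by apply: fcodim_sub (cA false) => // x Ax; split.
have cM : fcodim (G true) M by exists [:: z] => y /Mz[a Ma]; exists a.
by apply: fcodim_sub (fcodimI (sG true) (sF true) sM (cA true) cM) => // x [[_ ?] ?].
Qed.

Let VS i j v w : V i v -> V j w -> S (i (+) j) (sbr (i && j) v w).
Proof.
move=> Vv Vw; have Gv := VG Vv; have Gw := VG Vw.
case: i j Vv Vw Gv Gw => [] [] [_ Mv] [_ Mw] Gv Gw /=.
- by right; apply: brMG.
- exact: brG1G0.
- exact: brGM.
- by left; apply: brGG.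
Qed.

Let fB : fdim B.
Proof.
apply: fdim_lspan.
pose A i j := [set sbr (j && i) a c | a in finite_adjoint G j & c in finite_adjoint G i].
apply: fdim_sub (fdimU (fdimU (fA false false) (fA false true))
  (fdimU (fA true false) (fA true true))).
move=> _ [i [j [a [c [[Aa _] [Ac _] ->]]]]].
case: i j Aa Ac => [] [] Aa Ac.
- by right; right; exists a => //; exists c.
- by left; right; exists a => //; exists c.
- by right; left; exists a => //; exists c.
- by left; left; exists a => //; exists c.
Qed.

Let BI i j g s : G i g -> G j s -> B s -> B (sbr (i && j) g s).
Proof.
move=> Gg Gs.
(* B is spanned without regard to degree, so the sign of the super bracket with g is produced by
   [theta]; this gives one linear map on all of R. *)
pose ad x := g * x - (if i then theta x else x) * g.
have adL : is_linear ad.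
  move=> a x y; rewrite /ad; case: (i);
    rewrite ?thetaL !mulrDr !mulrDl -!scalerAr -!scalerAl scalerBr; abel.
have adE k x : G k x -> ad x = sbr (i && k) g x.
  move=> Gx; rewrite /ad /sbr; case: (i) => /=; last by rewrite expr0 scale1r.
  by rewrite (thetaG Gx) scalerAl.
rewrite -(adE j) //; move: s {Gs}.
apply: (@lspan_min _ _ _ (ad @^-1` B)).
  by apply: subspace_preim => //; apply: lspan_subspace.
move=> _ [k [l [a [c [Va Vc ->]]]]] /=.
rewrite (adE (k (+) l)); last by apply: GG; apply: VG.
rewrite sbr_jacobi; apply: (subspaceD (lspan_subspace _)).
  by apply: lspan_gen; exists (i (+) k), l, (sbr (i && k) g a), c; split=> //;
    apply: VI.
apply: (subspace_scale _ (lspan_subspace _)).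
by apply: lspan_gen; exists k, (i (+) l), a, (sbr (i && l) g c); split=> //;
  apply: VI.
Qed.

Let Ii : two_sided_ideal I. Proof. exact: graded_left_span_ideal. Qed.

Let Ji : two_sided_ideal J.
Proof.
by apply: graded_left_span_ideal => i j g s Gg [Ss Vs]; split; [apply: SI|apply: VI].
Qed.

Let Pi : two_sided_ideal P.
Proof.
apply: graded_left_span_ideal => i j g s Gg [Ss Bs]; split; first exact: SI.
by apply: BI => //; apply: SG.
Qed.

Let Jtheta x : J x -> J (theta x).
Proof.
apply: (@left_span_ind _ _ _ (theta @^-1` J)).
  by apply: subspace_preim => //; apply: lspan_subspace.
move=> r s Xs /=; rewrite thetaM; apply: left_spanMl.
have [b [Sb Vb]] : exists b, X b s by case: Xs => ?; [exists false|exists true].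
rewrite (thetaG (SG Sb)); apply: (subspace_scale _ (lspan_subspace _)).
exact: left_span_sub.
Qed.

Let P_nilpotent : exists n, forall a, P a -> a ^+ n = 0.
Proof.
have YG b : Y b `<=` G b by move=> x [/SG].
have [||||t nilt] := @engel _ _ two_neq0 G theta thetaL thetaG sG [set 0] (ideal_zero R) _ Y YG.
- by move=> x /= ->; apply: lin0.
- by move=> i j g s Gg [Ss Bs]; split; [apply: SI|apply: BI => //; apply: SG].
- by move=> b s [Ss _]; exists (2 * p ^ e)%N; apply: Snil Ss.
- have [s Bs] := fB; exists s; apply: lspan_min.
    exact: (spn_subspace _ (subspace0 _)).
  by move=> x [] [_ /Bs].
exists t => a Pa; apply: (left_span_power Pi (ideal_zero R) _ Pa) => w wY sw.
by apply: nilt; rewrite ?sw // => x /wY; apply: lspan_gen.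
Qed.

Let J_nil : exists n, forall a, J a -> P (a ^+ n).
Proof.
apply: (J_nil_mod two_neq0 charF p_gt2 generated sG GG Gp sV VI cV Pi _ e_gt0 _ _ Ji).
- move=> i j v w Vv Vw.
  have Yvw : Y (i (+) j) (sbr (i && j) v w).
    by split; [apply: VS|apply: lspan_gen; exists i, j, v, w].
  by apply: left_span_sub; case: (i (+) j) Yvw; [right|left].
- by move=> b x [].
- by move=> s [[/Dnil ->|/Qnil ->] _]; case: Pi.
Qed.

Let I_nil : exists n, forall a, I a -> J (a ^+ n).
Proof.
have sJ : subspace J by apply: lspan_subspace.
have XJ b x : X b x -> J x by move=> Xx; apply: left_span_sub; case: b Xx;
  [right|left].
(* W modulo its intersection with [V b] embeds into the finite-dimensional quotient of [G b] by
   [V b], and that intersection lies in J. *)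
have part_fcodim b (W : set R) : subspace W -> W `<=` S b -> exists s, W `<=` spn J s.
  move=> sW WS; have cW : fcodim W (V b).
    by have [s Gs] := cV b; exists s => x /WS/SG/Gs.
  have [s [_ Ws]] := fcodim_basis sW (sV b) cW; exists s => x /Ws.
  by apply: spn_mono => // y [/WS Sy Vy]; apply: (XJ b).
have [|||t nilt] := @engel _ _ two_neq0 G theta thetaL thetaG sG J Ji Jtheta S SG.
- exact: SI.
- by move=> b s Ss; exists (2 * p ^ e)%N; rewrite (Snil Ss); case: Ji.
- have DS : D `<=` S false by move=> x; left.
  have QS : Q `<=` S false by move=> x; right.
  have MS : M `<=` S true by [].
  have [sd Ds] := part_fcodim _ _ sD DS; have [sq Qs] := part_fcodim _ _ sQ QS.
  have [sm Ms] := part_fcodim _ _ sM MS.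
  exists (sd ++ sq ++ sm); apply: lspan_min; first exact: spn_subspace.
  move=> x [[/Ds|/Qs]|/Ms]; apply: spn_mono => // y ys; rewrite !mem_cat ys ?orbT //.
exists t => a Ia; apply: (left_span_power Ii Ji _ Ia) => w wS sw.
by apply: nilt; rewrite ?sw // => x /wS; apply: lspan_gen.
Qed.

(** Commutators of two generators that are not both odd are super brackets, hence in S; for odd ones
    only the part modulo M could escape I. The Leibniz rule extends this from generators to R. *)
Let commutator_sub : commutator_ideal R `<=` I.
Proof.
have sI : subspace I by apply: lspan_subspace.
have SI' b x : S b x -> I x by move=> Sx; apply: left_span_sub; case: b Sx;
  [right|left].
apply: smallest_sub => // _ [a _ [b _ <-]].
have MI x y : M x -> I (x * y - y * x).
  move=> Mx; have Ix := SI' true x Mx.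
  exact: (subspaceB sI (ideal_mulr _ Ii Ix) (ideal_mull _ Ii Ix)).
have homog i j g h : G i g -> G j h -> I (g * h - h * g).
  have comm x y : x * y - y * x = sbr false x y by rewrite /sbr expr0 scale1r.
  case: i j => [] [] Gg Gh.
  - (* z commutes with itself *)
    have [c Mg] := Mz Gg; have [d Mh] := Mz Gh.
    rewrite (_ : _ - _ = ((g - c *: z) * h - h * (g - c *: z)) -
      c *: ((h - d *: z) * z - z * (h - d *: z))).
      exact: (subspaceB sI (MI _ _ Mg) (subspace_scale _ sI (MI _ _ Mh))).
    rewrite !mulrBl !mulrBr -!scalerAl -!scalerAr !scalerBr !scalerA; abel.
  - by rewrite comm; apply: (SI' true); apply: brG1G0.
  - by rewrite comm; apply: (SI' true); apply: brGM.
  - by rewrite comm; apply: (SI' false); left; apply: brGG.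
have I0 : I 0 by case: sI.
have deriv x y b' : I (x * b' - b' * x) -> I (y * b' - b' * y) ->
    I (x * y * b' - b' * (x * y)).
  move=> hx hy; rewrite (_ : _ - _ = x * (y * b' - b' * y) + (x * b' - b' * x) * y).
    exact: (idealD Ii (ideal_mull _ Ii hy) (ideal_mulr _ Ii hx)).
  by nring.
have anti x y : I (x * y - y * x) -> I (y * x - x * y).
  by move=> h; rewrite -opprB; apply: (subspaceN sI).
apply: (generated (Q := fun a => forall b, I (a * b - b * a))) => {a b}.
- by move=> a b; rewrite -scalerAl -scalerAr mulr1 mul1r subrr.
- move=> i g Gg; apply: (generated (Q := fun b => I (g * b - b * g))).
  + by move=> a; rewrite -scalerAl -scalerAr mulr1 mul1r subrr.
  + by move=> j h Gh; apply: (homog i j).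
  + by move=> x y hx hy; rewrite mulrDr mulrDl opprD addrACA;
    apply: (subspaceD sI hx hy).
  + by move=> x y hx hy; exact: (anti _ _ (deriv _ _ _ (anti _ _ hx) (anti _ _ hy))).
- move=> x y hx hy b; rewrite mulrDl mulrDr opprD addrACA.
  exact: (subspaceD sI (hx b) (hy b)).
- by move=> x y hx hy b; exact: (deriv _ _ _ (hx b) (hy b)).
Qed.

Theorem commutator_ideal_nil : nil_bounded_index (commutator_ideal R).
Proof.
have [n1 h1] := I_nil; have [n2 h2] := J_nil; have [n3 h3] := P_nilpotent.
exists (n1 * n2 * n3)%N => a /commutator_sub/h1/h2/h3.
by rewrite !exprM.
Qed.

End Assembly.

(** * Specialization to u(L) *)

Section EnvelopingAlgebra.
Variables (F : fieldType) (p : nat) (L : restrictedLieSuperalgebra F p).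
Local Notation R := (uenv L).

Definition upart (b : bool) : set R := @uin F p L @` part b.

Lemma uin_subspace (W : set L) : subspace W -> subspace (@uin F p L @` W : set R).
Proof.
move=> [W0 WL]; split; first by exists 0 => //; apply: lin0 (@uin_linear F p L).
move=> a _ _ [x Wx <-] [y Wy <-]; exists (a *: x + y); first exact: WL.
exact: uin_linear.
Qed.

Lemma upart_subspace b : subspace (upart b).
Proof. exact/uin_subspace/part_subspace. Qed.

Lemma sbr_uin i j x y : part i x -> part j y ->
  sbr (i && j) (uin x : R) (uin y) = uin (br x y).
Proof. by move=> xi yj; rewrite (uin_br xi yj). Qed.

Lemma upart_generated (Q : set R) : (forall a, Q (a *: 1)) ->
  (forall b x, upart b x -> Q x) -> (forall x y, Q x -> Q y -> Q (x + y)) ->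
  (forall x y, Q x -> Q y -> Q (x * y)) -> forall x, Q x.
Proof.
move=> Q1 Qg QD QM; apply: uenv_gen => // x.
rewrite (lpartD x) (linD (@uin_linear F p L)).
have Qpart b : Q (uin (lpart b x)).
  by apply: (Qg b); exists (lpart b x) => //; apply: lpartP.
exact: QD.
Qed.

Lemma uin_iter_ppow s x : part false x ->
  uin (iter s (@ppow F p L) x) = uin x ^+ (p ^ s) :> R.
Proof.
move=> x0; suff [] : part false (iter s (@ppow F p L) x) /\
  uin (iter s (@ppow F p L) x) = uin x ^+ (p ^ s) :> R by [].
elim: s => [|s [is0 IH]]; first by rewrite expr1.
by split; rewrite iterS; [apply: ppow_part|rewrite uin_ppow // IH -exprM -expnSr].
Qed.

(** All larger exponents are allowed, so that (L_0, L_0) and (M, L_1) can share one. *)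
Lemma p_nilpotent_set_uin (X : set L) : p_nilpotent_set X ->
  exists s, forall t x, (s <= t)%N -> X x -> uin x ^+ (p ^ t) = 0 :> R.
Proof.
move=> [X0 [s Xs]]; exists s => t x st Xx.
have xs : uin x ^+ (p ^ s) = 0 :> R.
  by rewrite -uin_iter_ppow ?Xs ?(lin0 (@uin_linear F p L)) //; apply: X0.
have p_gt0 := prime_gt0 (pcharf_prime (rlsa_char L)).
by rewrite -(subnKC st) expnD exprM xs expr0n expn_eq0 eqn0Ngt p_gt0.
Qed.

(** All conditions concern images in R, so any preimages in L of the u_k and v_k turn a
    configuration into [contraction_data]. *)
Lemma no_contraction_config : (2%:R : F) != 0 -> satisfies_PI R ->
  exists m, forall i j u v, ~ contraction_config upart i j m u v.
Proof.
move=> two_neq0 /(contraction_data_bounded two_neq0)[m no_data].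
exists m => i j u v [uvG dual zex].
have lift b (w : nat -> R) : (forall k, (k < m)%N -> upart b (w k)) ->
    exists w' : nat -> L, forall k, (k < m)%N -> part b (w' k) /\ uin (w' k) = w k.
  move=> wG.
  suff /choice[w' w'P] k : exists x,
    (k < m)%N -> part b x /\ uin x = w k by exists w'.
  have [km|] := boolP (k < m)%N; last by exists 0.
  by have [x bx xw] := wG k km; exists x.
have [u' u'P] := lift j u (fun k km => (uvG k km).1).
have [v' v'P] := lift i v (fun k km => (uvG k km).2).
apply: (no_data i j u' v'); split=> [k km|a b|k km].
- by have [? _] := u'P k km; have [? _] := v'P k km.
- have [g [gL g1 guv]] := dual a b; exists g; split=> // k km.
  by have [_ ->] := u'P k km; have [_ ->] := v'P k km; apply: guv.
have [g [gL g1 g0 gvv guv]] := zex k km; exists g; split=> //.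
- move=> l lm.
  by have [_ ->] := u'P l lm; have [_ ->] := v'P l lm; apply: g0.
- move=> l l' lm l'm ll'.
  have [vl lv] := v'P l lm; have [vl' lv'] := v'P l' l'm.
  by rewrite -(sbr_uin vl vl') lv lv'; apply: gvv.
- move=> l l' lm l'm.
  have [ul lu] := u'P l lm; have [vl' lv'] := v'P l' l'm.
  by rewrite -(sbr_uin ul vl') lu lv'; apply: guv.
Qed.

End EnvelopingAlgebra.

Theorem mainTheorem2 (F : fieldType) (p : nat) (charF : p \in [pchar F])
    (p_gt2 : (2 < p)%N) (L : restrictedLieSuperalgebra F p) :
  let L0 : set L := part false in
  let L1 : set L := part true in
  let M : set L := lspan [set y | L1 y /\ p_nilpotent (br y y)] in
  satisfies_PI (uenv L) ->
  p_nilpotent_set (brspace L0 L0) ->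
  quot_dim_le 1 L1 M ->
  p_nilpotent_set (brspace M L1) ->
  brspace L1 L0 `<=` M ->
  nil_bounded_index (commutator_ideal (uenv L)).
Proof.
move=> L0 L1 M PI nilD [e1 [e1L quotM]] nilQ LM.
have two_neq0 : (2%:R : F) != 0.
  by rewrite -(dvdn_pcharf charF) gtnNdvd.
have [s1 nilD'] := p_nilpotent_set_uin nilD.
have [s2 nilQ'] := p_nilpotent_set_uin nilQ.
have [m no_config] := no_contraction_config two_neq0 PI.
have sG := @upart_subspace F p L.
have augG b x : upart b x -> @ueps F p L x = 0 by move=> [y _ <-]; apply: ueps_in.
have ML1 : M `<=` L1 by apply: lspan_min => [|y []]; first exact: part_subspace.
have brM x y (B C : set L) : B x -> C y -> brspace B C (br x y).
  by move=> Bx Cy; apply: lspan_gen; exists x => //; exists y.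
pose uM : set (uenv L) := @uin F p L @` M.
pose uQ : set (uenv L) := @uin F p L @` brspace M L1.
pose uD : set (uenv L) := @uin F p L @` brspace L0 L0.
(* The successor makes the common exponent positive, as [e_gt0] demands; [e1 ord0] spans L_1 modulo
   M and plays the part of z. *)
apply: (@commutator_ideal_nil F (uenv L) two_neq0 p (maxn s1 s2).+1
  (@upart F p L) (@utheta F p L) charF p_gt2 isT _ _ _ _ sG _ _ uD uQ uM (uin (e1 ord0))).
- exact: utheta_linear.
- exact: uthetaM.
- by move=> b _ [x xb <-]; apply: utheta_hom.
- exact: upart_generated.
- move=> i j _ _ [x xi <-] [y yj <-]; rewrite sbr_uin //.
  by exists (br x y) => //; apply: br_part.
- by move=> _ [x x0 <-]; rewrite -uin_ppow //; exists (ppow x) => //;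
  apply: ppow_part.
- exact/uin_subspace/lspan_subspace.
- exact/uin_subspace/lspan_subspace.
- exact/uin_subspace/lspan_subspace.
- by move=> _ [x Dx <-]; exists x => //; case: nilD => h _; apply: h.
- by move=> _ [x Qx <-]; exists x => //; case: nilQ => h _; apply: h.
- by move=> _ [x Mx <-]; exists x => //; apply: ML1.
- move=> _ _ [x x0 <-] [y y0 <-]; rewrite (sbr_uin x0 y0).
  by exists (br x y) => //; apply: brM.
- move=> _ _ [x x1 <-] [y y0 <-]; rewrite (sbr_uin x1 y0).
  by exists (br x y) => //; apply: LM; apply: brM.
- move=> _ _ [x Mx <-] [y y1 <-]; rewrite (sbr_uin (ML1 _ Mx) y1).
  by exists (br x y) => //; apply: brM.
- by move=> _ [x Dx <-]; apply: nilD' => //; rewrite leqW ?leq_maxl.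
- by move=> _ [x Qx <-]; apply: nilQ' => //; rewrite leqW ?leq_maxr.
- move=> _ [y y1 <-]; have [c] := quotM y y1; rewrite big_ord1 => Mc.
  exists (c ord0); exists (y - c ord0 *: e1 ord0) => //.
  by rewrite (linB (@uin_linear F p L)) (linZ (@uin_linear F p L)).
- exact: finite_adjoint_fcodim sG (@ueps_linear F p L) (@ueps1 F p L) augG m no_config.
- exact: finite_adjoint_derived sG m no_config.
Qed.
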